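(* Let $T\subset\mathbb{R}^2$ be a nondegenerate triangle with Clough--Tocher split $\mathcal{R}(T)$, and define $$A^0(T)=\mathrm{C}^0_{\mathrm{curl}\,{}^T}\mathrm{P}^2(\mathcal{R}(T),\mathbb{V}),\quad A^1(T)=\mathrm{def}\,A^0(T)\oplus W(T),\quad A^2(T)=\mathrm{P}^0(\mathcal{R}(T),\mathbb{R}),$$ with degrees of freedom (DoFs) as follows. - On $A^0(T)$: vertex values of $u$ ($3\times2$) and vertex values of $\mathrm{curl}\,u^T$ ($3\times1$); for each edge $E$, $u\mapsto\int_E(\mathrm{def}\,u\,\tau\cdot\tau)\chi_E$ and $u\mapsto\int_E(\mathrm{def}\,u\,\tau\cdot\nu)\chi_E$ ($3\times2$). - On $A^1(T)$: for each edge $E$ the pairings $u\mapsto\int_E\big((u\tau\cdot\tau)\,\psi+\partial_\tau(u\tau\cdot\nu)\,\phi-(u\tau\cdot\nu)\,\partial_\tau\phi-(\partial_\nu u\,\tau\cdot\tau)\,\phi\big)$ for $(\phi,\psi)\in M(E)$ ($3\times3$); and $u\mapsto\int_E(u\tau\cdot\tau)\chi_E$ and $u\mapsto\int_E(u\tau\cdot\nu)\chi_E$ ($3\times2$). - On $A^2(T)$: $u\mapsto\int_Tu\phi$ for $\phi$ an affine function on $T$ ($3$). Then: 1. $A^0(T)$ has dimension $15$, and the provided degrees of freedom are unisolvent. 2. $A^1(T)$ has dimension $15$, and the provided degrees of freedom are unisolvent. 3. $A^2(T)$ has dimension $3$, and the provided degrees of freedom are unisolvent. 4. The sequence $A^0(T)\xrightarrow{\mathrm{def}}A^1(T)\xrightarrow{\mathrm{sven}}A^2(T)$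 resolves the rigid motions, i.e. $0\to RM\to A^0(T)\to A^1(T)\to A^2(T)\to0$ is exact, where $RM$ is the space of rigid motions.
   Context: $\mathbb{V}=\mathbb{R}^2$ (column vectors), $\mathbb{S}$ is the space of symmetric $2\times2$ real matrices. $RM=\{x\mapsto a+b\,(-x_2,x_1)^{T}:a\in\mathbb{V},b\in\mathbb{R}\}$. For a column vector field $u$, $\mathrm{def}\,u$ is the symmetric part of its gradient (Jacobian) matrix and $\mathrm{curl}\,u^T=\partial_1u_2-\partial_2u_1$. For a matrix field, $\mathrm{sven}\,u=\partial_{22}u_{11}+\partial_{11}u_{22}-\partial_{12}u_{21}-\partial_{21}u_{12}$ (in the distribution sense). The Clough--Tocher split $\mathcal{R}(T)$ is the subdivision of $T$ into three triangles obtained by joining an interior point of $T$ (the central vertex) to the three vertices of $T$. $\mathrm{P}^r$ denotes polynomials of degree at most $r$, and $\mathrm{P}^r(\mathcal{R}(T),\cdot)$ fields that are piecewise $\mathrm{P}^r$ with respect to $\mathcal{R}(T)$. $\mathrm{C}^0_{\mathrm{curl}\,{}^T}\mathrm{P}^2(\mathcal{R}(T),\mathbb{V})$ is the space of continuous piecewise $\mathrm{P}^2$ vector fields $u$ such that $\mathrm{curl}\,u^T$ is also continuous on $T$. For an edge $E$ of $T$, $\tau$ is the oriented unit tangent and $\nu$ the unit normal such that $(\tau,\nu)$ is a positively oriented orthonormal basis. $M(E)$ is the space of pairs $(\phi,\psi)$ with $\phi$ an affine function on $E$ and $\psi$ a constant. $\chi_E:E\to\mathbb{R}$ is a fixed nonzero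 affine function with $\int_E\chi_E=0$. Traces on an edge $E$ of $T$ are taken from the unique triangle of $\mathcal{R}(T)$ containing $E$. $W(T)$ is the space of continuous piecewise $\mathrm{P}^2$ (with respect to $\mathcal{R}(T)$) $\mathbb{S}$-valued fields $u$ whose distributional $\mathrm{sven}\,u$ is an integrable function, whose restriction to $\partial T$ is zero, and for which $\partial_\nu u\,\tau\cdot\tau$ is constant on each edge of $T$; $\mathrm{sven}$ is a bijection from $W(T)$ onto $\mathrm{P}^0(\mathcal{R}(T),\mathbb{R})$. A set of DoFs on a finite-dimensional space $A$ is unisolvent if the listed linear forms (bases being chosen for the test functions) form a basis of the dual $A^\star$. *)

(* Defs.v *)
From HB Require Import structures.
From mathcomp Require Export all_boot all_order all_algebra.
From mathcomp Require Export all_classical all_reals all_analysis.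
Set Implicit Arguments.
Unset Strict Implicit.
Unset Printing Implicit Defensive.
Import Order.TTheory GRing.Theory Num.Theory.
Import numFieldNormedType.Exports.
Local Open Scope classical_set_scope.
Local Open Scope ring_scope.

Section LinearAlgebra.
Variables (R : realType) (V : lmodType R).

(* The surjectivity part makes [A] a linear subspace. *)
Definition is_basis (A : set V) (I : finType) (b : I -> V) : Prop :=
  injective (fun c : {ffun I -> R} => \sum_i c i *: b i) /\
  range (fun c : {ffun I -> R} => \sum_i c i *: b i) = A.

Definition has_dim (A : set V) (n : nat) : Prop :=
  exists b : 'I_n -> V, is_basis A b.

End LinearAlgebra.

(* Here [A] is coerced to the type of its elements. *)
Definition dual (R : realType) (V : lmodType R) (A : set V) : set (A -> R^o) :=
  [set g | forall (a : R) (u v w : A),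
     val w = a *: val u + val v -> g w = a * g u + g v].

Arguments dual {R V} A.

Definition unisolvent (R : realType) (V : lmodType R) (A : set V)
    (I : finType) (l : I -> V -> R) : Prop :=
  is_basis (dual A) (fun (i : I) (u : A) => l i (val u)).

Section Plane.
Variable R : realType.

Definition plane := 'cV[R]_2.

Definition dotv (a b : plane) : R := \sum_i a i 0 * b i 0.
Definition enorm (a : plane) : R := Num.sqrt (dotv a a).
Definition rot (a : plane) : plane :=
  \col_i (if i == 0 then - a 1 0 else a 0 0).

Definition partial (i : 'I_2) (f : plane -> R) (x : plane) : R :=
  'D_(delta_mx i 0 : plane) f x.

Definition poly_fun (r : nat) (f : plane -> R) : Prop :=
  exists c : nat -> nat -> R, forall x,
    f x = \sum_(i < r.+1) \sum_(j < r.+1 | (i + j <= r)%N)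
            c i j * x 0 0 ^+ i * x 1 0 ^+ j.

(* The library has Lebesgue measure on [R * R] but not on column vectors. *)
Definition pt (p : R * R) : plane := \col_i (if i == 0 then p.1 else p.2).

Definition plane_integrable (D : set plane) (f : plane -> R) : Prop :=
  (@lebesgue_measure R \x @lebesgue_measure R)%E.-integrable (pt @^-1` D)
    (fun p => (f (pt p))%:E).

Definition plane_int (D : set plane) (f : plane -> R) : R :=
  (\int[(@lebesgue_measure R \x @lebesgue_measure R)%E]_(p in pt @^-1` D)
     f (pt p))%R.

Fixpoint Cn (n : nat) (f : plane -> R) : Prop :=
  match n with
  | 0 => continuous f
  | m.+1 => continuous f /\
      forall i, (forall x, derivable f x (delta_mx i 0)) /\ Cn m (partial i f)
  end.

Definition smooth (f : plane -> R) : Prop := forall n, Cn n f.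

(* Only used for bounded [D], so that the support is automatically compact. *)
Definition test_function (D : set plane) (f : plane -> R) : Prop :=
  smooth f /\ closure [set x | f x != 0] `<=` D°.

Definition hull (p : 'I_3 -> plane) : set plane :=
  [set x | exists t : 'I_3 -> R,
     [/\ forall i, 0 <= t i, \sum_i t i = 1 & x = \sum_i t i *: p i]].

Definition nondegenerate (v : 'I_3 -> plane) : Prop :=
  \det (row_mx (v 1 - v 0) (v 2%:R - v 0)) != 0.

End Plane.

Section CloughTocher.
Variable R : realType.
Local Notation plane := (plane R).
(* [o e] tells whether edge [e] runs against the cyclic order of the vertices. *)
Variables (v : 'I_3 -> plane) (c : plane) (o : 'I_3 -> bool).

Definition T : set plane := hull v.

(* The triangle of the split that replaces the vertex [v k] by [c]; it is the
   one containing edge [k] of [T], the edge opposite to [v k]. *)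
Definition K (k : 'I_3) : set plane :=
  hull (fun j => if j == k then c else v j).

Definition edge_start (e : 'I_3) : plane :=
  if o e then v (ordS (ordS e)) else v (ordS e).
Definition edge_end (e : 'I_3) : plane :=
  if o e then v (ordS e) else v (ordS (ordS e)).
Definition len (e : 'I_3) : R := enorm (edge_end e - edge_start e).
Definition tau (e : 'I_3) : plane :=
  (len e)^-1 *: (edge_end e - edge_start e).
Definition nu (e : 'I_3) : plane := rot (tau e).

(* Edge [e] is parametrized by arclength: a function on it is a function of
   [s] in [0, len e], and the derivative with respect to [s] is d/dtau. *)
Definition edge_pt (e : 'I_3) (s : R) : plane := edge_start e + s *: tau e.
Definition edge_int (e : 'I_3) (f : R -> R) : R :=
  (\int[@lebesgue_measure R]_(s in `[0, len e]) f s)%R.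

(* Fields on the split: one function per triangle, given on the whole plane.
   For polynomial pieces this is no ambiguity, since a polynomial is determined
   by its restriction to a triangle. The trace on edge [e] is that of piece
   [e]. *)
Definition sfield := 'I_3 -> plane -> R^o.
Definition vfield := 'I_3 -> plane -> 'cV[R]_2.
Definition mfield := 'I_3 -> plane -> 'M[R]_2.

Definition pw_scalar (r : nat) (q : sfield) : Prop :=
  forall k, poly_fun r (q k).
Definition pw_vector (r : nat) (u : vfield) : Prop :=
  forall k i, poly_fun r (fun x => u k x i 0).
Definition pw_matrix (r : nat) (u : mfield) : Prop :=
  forall k i j, poly_fun r (fun x => u k x i j).

(* The pieces are the restrictions of a continuous function on [T]. *)
Definition continuous_on_T (W : topologicalType) (u : 'I_3 -> plane -> W)
    : Prop :=
  exists g : plane -> W, {within T, continuous g} /\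
    forall k x, K k x -> g x = u k x.

Definition pw_int (f : 'I_3 -> plane -> R) : R := \sum_k plane_int (K k) (f k).

Definition curlT (u : vfield) : sfield := fun k x =>
  partial 0 (fun y => u k y 1 0) x - partial 1 (fun y => u k y 0 0) x.

Definition def (u : vfield) : mfield := fun k x =>
  \matrix_(i, j) ((partial j (fun y => u k y i 0) x +
                   partial i (fun y => u k y j 0) x) / 2%:R).

Definition RM : set vfield :=
  [set u | exists (a : plane) (b : R), u = fun _ x => a + b *: rot x].

(* The distribution sven u on the interior of [T], applied to [phi]. *)
Definition sven_dist (u : mfield) (phi : plane -> R) : R :=
  pw_int (fun k x =>
      u k x 0 0 * partial 1 (partial 1 phi) x
    + u k x 1 1 * partial 0 (partial 0 phi) x
    - u k x 1 0 * partial 0 (partial 1 phi) x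
    - u k x 0 1 * partial 1 (partial 0 phi) x).

Definition sven_integrable (u : mfield) : Prop :=
  exists f : plane -> R, plane_integrable T f /\
    forall phi, test_function T phi ->
      sven_dist u phi = plane_int T (fun x => f x * phi x).

(* Equality of distributions on the interior of [T]. *)
Definition is_sven (u : mfield) (q : sfield) : Prop :=
  forall phi, test_function T phi ->
    sven_dist u phi = pw_int (fun k x => q k x * phi x).

Definition A0 : set vfield :=
  [set u | [/\ pw_vector 2 u, continuous_on_T u & continuous_on_T (curlT u)]].

(* Defined off the edge too, since they are differentiated along [nu e]. *)
Definition tt (e : 'I_3) (u : mfield) (x : plane) : R :=
  dotv (u e x *m tau e) (tau e).
Definition tn (e : 'I_3) (u : mfield) (x : plane) : R :=
  dotv (u e x *m tau e) (nu e).

Definition W : set mfield :=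
  [set u | [/\ pw_matrix 2 u /\ (forall k x, (u k x)^T = u k x),
               continuous_on_T u,
               sven_integrable u,
               forall e s, s \in `[0, len e] -> u e (edge_pt e s) = 0 &
               forall e, exists a : R, forall s, s \in `[0, len e] ->
                 'D_(nu e) (tt e u) (edge_pt e s) = a]].

(* The theorem asserts separately that the sum is direct. *)
Definition A1 : set mfield :=
  [set u | exists a w, [/\ A0 a, W w & u = def a + w]].

Definition A2 : set sfield := [set q | pw_scalar 0 q].

Definition affine1 (phi : R -> R) : Prop :=
  exists a b : R, forall s, phi s = a + b * s.

(* On each edge, in terms of arclength. *)
Definition M : set ((R -> R^o) * R^o)%type := [set m | affine1 m.1].

Definition P1 : set (plane -> R^o) := [set phi | poly_fun 1 phi].

Definition is_chi (chi : 'I_3 -> R -> R) : Prop :=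
  forall e, [/\ affine1 (chi e), exists s, chi e s != 0 &
                edge_int e (chi e) = 0].

Definition dof_tt (chi : 'I_3 -> R -> R) (e : 'I_3) (u : mfield) : R :=
  edge_int e (fun s => tt e u (edge_pt e s) * chi e s).
Definition dof_tn (chi : 'I_3 -> R -> R) (e : 'I_3) (u : mfield) : R :=
  edge_int e (fun s => tn e u (edge_pt e s) * chi e s).

Definition dof_M (m : (R -> R^o) * R^o) (e : 'I_3) (u : mfield) : R :=
  edge_int e (fun s =>
      tt e u (edge_pt e s) * m.2
    + 'D_(tau e) (tn e u) (edge_pt e s) * m.1 s
    - tn e u (edge_pt e s) * derive1 m.1 s
    - 'D_(nu e) (tt e u) (edge_pt e s) * m.1 s).

(* The value at [v j] is read off a piece whose triangle contains [v j]; for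
   elements of [A0] the choice is irrelevant. *)
Definition dof0 (chi : 'I_3 -> R -> R)
    (i : ('I_3 * 'I_2) + 'I_3 + ('I_3 + 'I_3)) (u : vfield) : R :=
  match i with
  | inl (inl (j, l)) => u (ordS j) (v j) l 0
  | inl (inr j) => curlT u (ordS j) (v j)
  | inr (inl e) => dof_tt chi e (def u)
  | inr (inr e) => dof_tn chi e (def u)
  end.

Definition dof1 (m : 'I_3 -> 'I_3 -> (R -> R^o) * R^o) (chi : 'I_3 -> R -> R)
    (i : ('I_3 * 'I_3) + ('I_3 + 'I_3)) (u : mfield) : R :=
  match i with
  | inl (e, l) => dof_M (m e l) e u
  | inr (inl e) => dof_tt chi e u
  | inr (inr e) => dof_tn chi e u
  end.

Definition dof2 (p : 'I_3 -> plane -> R^o) (i : 'I_3) (q : sfield) : R :=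
  pw_int (fun k x => q k x * p i x).

End CloughTocher.

(* Main.v *)
(* On the piece [K k] put [mu k := lam k / lam k c]. A continuous piecewise quadratic
   function is a quadratic polynomial plus a combination of the three bubbles
   [mu k * (lam l - lam l c / 2 * mu k)] and of [mu k ^ 2]; the bubbles are
   differentiable at [c]. With vector coefficients, continuity of the curl kills the
   [mu k ^ 2] term and makes the coefficient of the [l]-th bubble a multiple of the
   rotated [v l - c]. With symmetric matrix coefficients [S l], integration by parts
   shows that the singular part of sven is carried by the segments from [c] to [v l]
   with density proportional to [S l (v l - c, v l - c)], and test functions that
   concentrate on the segments detect it; the condition on the normal derivative
   makes [S l (t_e, t_e)] the same number [h e] for both endpoints [l] of edge [e],
   and the three numbers [h e] parametrize [W].

   In these parameters all degrees of freedom are explicit. On [A0] they are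
   triangular. On [def a + w] the pairings with [M(E)] reduce to the values of [a]
   and of [om := curl a] at the endpoints and to [h e]. If they vanish, the increment
   of [a] along [E] is [(om' + om'') / 4] times the rotated edge; as the increments add
   up to zero around [T], [om] takes the same value at the three vertices, so [a] is
   rigid and then [h = 0]. The same equations with a right-hand side can be solved.

   [sven (def a) = 0] by Green's formula and the symmetry of the second derivatives of
   test functions. With [g k := h k / lam k c], sven of the element [h] of [W] is
   proportional to [((1 - 2 * lam k c) * sum g - 3 * g k) / lam k c] on [K k], which is
   invertible because the numerators add up to [- 2 * sum g]. *)
From HB Require Import structures.
Require Import Defs.
From mathcomp Require Import measurable_realfun ring lra.
Set Implicit Arguments.
Unset Strict Implicit.
Unset Printing Implicit Defensive.
Import Order.TTheory GRing.Theory Num.Theory.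
Import numFieldNormedType.Exports.
Local Open Scope classical_set_scope.
Local Open Scope ring_scope.

(** * Integration over plane triangles *)

(** Unisolvence is reduced to unique solvability of small linear systems: each space gets explicit
    coordinates, and both halves of bijectivity are proved. Two facts keep the systems elementary.
    The symmetric difference quotient with step one is exact on quadratics, so derivatives become
    values. At parameter [t] on the segment from [c] to [v l] the gradient of the [l]-th bubble
    jumps with factor [t], that of the [mu k ^ 2] term with factor [2 * (1 - t)], and the other
    bubbles do not jump; so the two endpoints separate the coefficients.

    The obstacle is analytic: a density on the segments must be shown to vanish from an identity
    that also contains an unknown integrable function. The concentrating test function is multiplied
    by the density itself, so that the line integral becomes that of a weighted square and stays
    fixed, while the area integrals tend to zero.

    A symmetric form on the plane is determined by its values on three pairwise nonparallel
    directions. With the three [v l - c] this removes the [mu k ^ 2] coefficient; with two edges and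
    [v l - c] it determines [S l]. *)

Section AffineChange.
Variable R : realType.
Local Notation leb := (@lebesgue_measure R).
Local Open Scope ereal_scope.

Let affm (a b : R) : measurable_fun setT
  ((fun x : R => a * x + b)%R : measurableTypeR R -> measurableTypeR R).
Proof. by apply: measurable_funD => //; apply: measurable_funM. Qed.

Let affpush (a b : R) (h : (0 <= `|a|)%R) :
    {measure set (measurableTypeR R) -> \bar R} :=
  mscale (NngNum h)
    (measure_function_pushforward__canonical__measure_function_Measure leb (affm a b)).

(** Uniqueness of Lebesgue measure: the right-hand side is a scaled push-forward, and it is enough
    to compare the two measures on half-open intervals. *)
Lemma lebesgue_measure_affine (a b : R) (A : set R) : (a != 0)%R -> measurable A ->
  leb A = `|a|%:E * leb ((fun x => a * x + b)%R @^-1` A).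
Proof.
move=> a0 mA.
have h : (0 <= `|a|)%R by [].
pose m' := affpush b h.
transitivity (m' A); last by [].
apply: lebesgue_measure_unique => // _ [[u v]] _ <-.
transitivity (`|a|%:E * leb ((fun x => a * x + b)%R @^-1` `]u, v])); last by [].
set S := _ @^-1` _.
have [a1|a1] := ltP 0%R a.
- have -> : S = `]((u - b) / a)%R, ((v - b) / a)%R]%classic.
    by apply/seteqP; split => x /=; rewrite !in_itv /= ltr_pdivrMr// ler_pdivlMr// ltrBlDr lerBrDr (mulrC x).
  rewrite !lebesgue_measure_itv/= !lte_fin ltr_pM2r ?invr_gt0// ltrD2r.
  case: ifPn => _; rewrite ?mule0// -!EFinB -EFinM gtr0_norm//; congr EFin.
  by field.
(* For negative [a] the preimage of []u, v]] is half-open on the other side, which does not change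
   its length. *)
- have {}a1 : (a < 0)%R by rewrite lt_neqAle a0 a1.
  have -> : S = `[((v - b) / a)%R, ((u - b) / a)%R[%classic.
    by apply/seteqP; split => x /=; rewrite !in_itv /= ler_ndivrMr// ltr_ndivlMr// ltrBlDr lerBrDr (mulrC x) andbC.
  rewrite !lebesgue_measure_itv/= !lte_fin ltr_nM2r ?invr_lt0// ltrD2r.
  case: ifPn => _; rewrite ?mule0// -!EFinB -EFinM ltr0_norm//; congr EFin.
  by field.
Qed.

(** Stated for nonnegative integrands; [plane_int_tri] treats the positive and the negative part
    separately. *)
Lemma ge0_integral_affine (a b : R) (f : R -> \bar R) : (a != 0)%R ->
  measurable_fun setT f -> (forall x, 0 <= f x) ->
  \int[leb]_x f x = `|a|%:E * \int[leb]_x f (a * x + b)%R.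
Proof.
move=> a0 mf f0.
have h : (0 <= `|a|)%R by [].
pose m' := affpush b h.
transitivity (\int[m']_x f x).
  apply: eq_measure_integral => A mA _ /=.
  by rewrite [LHS](@lebesgue_measure_affine a b)//.
rewrite ge0_integral_mscale//=; congr (_ * _).
have := @ge0_integral_pushforward _ _ _ _ R _ (affm a b) leb setT f measurableT mf.
by move=> ->.
Qed.

End AffineChange.

Section AffineChange2.
Variable R : realType.
Local Notation leb := (@lebesgue_measure R).
Local Notation leb2 := (@lebesgue_measure R \x @lebesgue_measure R)%E.
Local Notation mR := (measurableTypeR R).
Implicit Type f : mR * mR -> \bar R.

Lemma measurable_affine (a b e : R) :
  measurable_fun setT (fun p : mR * mR => (a * p.1 + b * p.2 + e : mR)).
Proof.
apply: measurable_funD => //; apply: measurable_funD; apply: measurable_funM => //.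
Qed.

Lemma measurable_affine2 (a b e c d g : R) : measurable_fun setT
  (fun p : mR * mR => (a * p.1 + b * p.2 + e, c * p.1 + d * p.2 + g) : mR * mR).
Proof. by apply: measurable_fun_pair; exact: measurable_affine. Qed.

Local Open Scope ereal_scope.

Let shear_x (a b e : R) f : (a != 0)%R -> measurable_fun setT f ->
  (forall p, 0 <= f p) ->
  \int[leb2]_p f p = `|a|%:E * \int[leb2]_p f (a * p.1 + b * p.2 + e, p.2)%R.
Proof.
move=> a0 mf f0.
have mf' : measurable_fun setT (fun p : mR * mR => f (a * p.1 + b * p.2 + e, p.2)%R).
  apply: measurableT_comp => //; apply: measurable_fun_pair; first exact: measurable_affine.
  exact: measurable_snd.
rewrite !fubini_tonelli2// /fubini_G -ge0_integralZl//; last 2 first.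
- exact: (measurable_fun_fubini_tonelli_G (m1 := leb) (fun p => f (a * p.1 + b * p.2 + e, p.2)%R)).
- by move=> y _; apply: integral_ge0 => x _.
apply: eq_integral => y _ /=.
rewrite (@ge0_integral_affine R a (b * y + e)%R (fun x => f (x, y)))//.
- by congr (_ * _); apply: eq_integral => x _; rewrite addrA.
- by apply: measurableT_comp => //; exact: measurable_pair2.
Qed.

Let swap f : measurable_fun setT f -> (forall p, 0 <= f p) ->
  \int[leb2]_p f p = \int[leb2]_p f (p.2, p.1).
Proof.
move=> mf f0.
have mf' : measurable_fun setT (fun p : mR * mR => f (p.2, p.1)).
  apply: measurableT_comp => //; apply: measurable_fun_pair; first exact: measurable_snd.
  exact: measurable_fst.
by rewrite fubini_tonelli1// fubini_tonelli2.
Qed.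

Let shear_y (a b e : R) f : (a != 0)%R -> measurable_fun setT f ->
  (forall p, 0 <= f p) ->
  \int[leb2]_p f p = `|a|%:E * \int[leb2]_p f (p.1, b * p.1 + a * p.2 + e)%R.
Proof.
move=> a0 mf f0.
have mg : measurable_fun setT (fun p : mR * mR => f (p.2, p.1)).
  apply: measurableT_comp => //; apply: measurable_fun_pair; first exact: measurable_snd.
  exact: measurable_fst.
rewrite swap// (@shear_x a b e (fun p => f (p.2, p.1)))//=; congr (_ * _).
rewrite [LHS]swap//=.
- by apply: eq_integral => p _ /=; rewrite (addrC (b * _)%R).
- apply: measurableT_comp => //; apply: measurable_fun_pair; first exact: measurable_snd.
  exact: measurable_affine.
Qed.

(** Gaussian elimination: a matrix with nonzero pivot [a] is the product of a shear in [x] and a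
    shear in [y], each covered by the one-dimensional formula and Tonelli. A zero pivot costs one
    exchange of the coordinates. *)
Lemma ge0_integral_affine2 (a b e c d g : R) f : (a * d - b * c != 0)%R ->
  measurable_fun setT f -> (forall p, 0 <= f p) ->
  \int[leb2]_p f p = `|a * d - b * c|%:E *
    \int[leb2]_p f (a * p.1 + b * p.2 + e, c * p.1 + d * p.2 + g)%R.
Proof.
move=> D0 mf f0; have [|a0] := eqVneq a 0%R; last first.
  have d0 : (d - c * b / a != 0)%R.
    apply: contra D0 => /eqP d0; have -> : (a * d - b * c = a * (d - c * b / a))%R by field.
    by rewrite d0 mulr0.
  rewrite (shear_y (c / a) (g - c / a * e)%R d0)//.
  set h := fun p => f (p.1, _)%R.
  have mh : measurable_fun setT h.
    apply: measurableT_comp => //; apply: measurable_fun_pair; first exact: measurable_fst.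
    exact: measurable_affine.
  have h0 p : 0 <= h p by exact: f0.
  rewrite (@shear_x a b e h)// muleA -EFinM -normrM.
  have -> : ((d - c * b / a) * a = a * d - b * c)%R by field.
  congr (_ * _); apply: eq_integral => p _; rewrite /h /=; congr (f (_, _)).
  by field.
move=> a0; move: D0; rewrite a0 !mul0r sub0r oppr_eq0 mulf_eq0 negb_or => /andP[b0 c0].
rewrite (@shear_x b 0 e f)//; set h := fun p => f _.
have mh : measurable_fun setT h.
  apply: measurableT_comp => //; apply: measurable_fun_pair; first exact: measurable_affine.
  exact: measurable_snd.
have h0 p : 0 <= h p by exact: f0.
rewrite (@shear_y c d g h)// muleA -EFinM -normrM normrN; congr (_ * _).
rewrite swap//; last first.
  apply: measurableT_comp => //; apply: measurable_fun_pair; first exact: measurable_fst.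
  exact: measurable_affine.
apply: eq_integral => p _; rewrite /h /=; congr (f (_, _)); by ring.
Qed.

End AffineChange2.

Section PlaneMeasurability.
Variable R : realType.
Local Notation mR := (measurableTypeR R).
Local Notation plane := (plane R).

Lemma ptE (p : R * R) :
  pt p = p.1 *: (delta_mx 0 0 : plane) + p.2 *: (delta_mx 1 0 : plane).
Proof.
apply/matrixP => i j; rewrite (ord1 j) !mxE eqxx andbT.
by case: i => [[|[|[]]]]//= ?; rewrite ?(mulr1, mulr0, addr0, add0r).
Qed.

Lemma ptK (x : plane) : pt (x 0 0, x 1 0) = x.
Proof.
apply/matrixP => i j; rewrite (ord1 j) !mxE.
by case: i => [[|[|[]]]]//= h; congr (x _ _); apply: val_inj.
Qed.

(** Measurability refers to the product sigma-algebra. Rounding the first coordinate down to a grid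
    of mesh [1 / (n + 1)] gives functions whose preimages are countable unions of products, and by
    continuity of [F] they converge pointwise. *)
Lemma measurable_continuous_pt (F : plane -> R) : continuous F ->
  measurable_fun setT (fun p : mR * mR => (F (pt p) : mR)).
Proof.
move=> cF.
pose fl (n : nat) (x : R) : R := (Num.floor (x * n.+1%:R))%:~R / n.+1%:R.
pose g n (p : mR * mR) : R := F (pt (fl n p.1, p.2)).
apply: (measurable_fun_cvg (h := g)) => //.
- move=> n; rewrite /g => _ Y mY; rewrite setTI.
  rewrite (_ : _ @^-1` _ = \bigcup_(k : int)
     ([set x : mR | Num.floor (x * n.+1%:R) = k] `*`
      [set y : mR | Y (F (pt (k%:~R / n.+1%:R, y)))])); last first.
    apply/seteqP; split => [[x y] /= h|[x y] /= [k _ [/= hx hy]]].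
      by exists (Num.floor (x * n.+1%:R)).
    by rewrite /fl hx.
  apply: countable_bigcupT_measurable => // k; apply: measurableX.
  + rewrite (_ : [set x | _] = `[k%:~R / n.+1%:R, (k + 1)%:~R / n.+1%:R[%classic) //.
    apply/seteqP; split => x /=; rewrite in_itv/= ler_pdivrMr// ltr_pdivlMr//.
      by move/eqP; rewrite floor_eq.
    by move=> h; apply/eqP; rewrite floor_eq.
  + rewrite -[X in measurable X]setTI.
    apply: (continuous_measurable_fun (f := fun y => F (pt (k%:~R / n.+1%:R, y)))) => //.
    move=> y; apply: continuous_comp; last exact: cF.
    rewrite (_ : (fun y => pt _) = (fun y => (k%:~R / n.+1%:R) *: (delta_mx 0 0 : plane) +
        y *: (delta_mx 1 0 : plane))); last by apply/funext => z; rewrite ptE.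
    by apply: cvgD; [exact: cvg_cst | apply: cvgZr_tmp; exact: cvg_id].
- move=> [x y] _; rewrite /g /=.
  apply: (@cvg_comp _ _ _ (fun n => pt (fl n x, y)) F _ (nbhs (pt (x, y)))); last exact: cF.
  rewrite (_ : (fun n => _) = (fun n => fl n x *: (delta_mx 0 0 : plane) +
        y *: (delta_mx 1 0 : plane))); last by apply/funext => n; rewrite ptE.
  rewrite ptE /=; apply: cvgD; last exact: cvg_cst.
  apply: cvgZr_tmp.
  suff: fl n x @[n --> \oo] --> x by [].
  apply: (squeeze_cvgr (f := fun n => x - n.+1%:R^-1) (h := fun => x)).
  + near=> n; rewrite /fl.
    have /andP[h1 h2] := floor_itv (x * n.+1%:R).
    rewrite ler_pdivrMr// h1 andbT ler_pdivlMr// mulrBl mulVf// lerBlDr ltW//.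
    by move: h2; rewrite intrD.
  + rewrite -[X in _ --> X]subr0; apply: cvgB; first exact: cvg_cst.
    exact: cvg_harmonic.
  + exact: cvg_cst.
Unshelve. all: by end_near.
Qed.

End PlaneMeasurability.

Definition det2 (R : realType) (a b : plane R) : R :=
  a 0 0 * b 1 0 - a 1 0 * b 0 0.

Definition par (R : realType) (a b d : plane R) (s t : R) : plane R :=
  a + s *: (b - a) + t *: (d - a).

(** A triangle as the affine image of the standard simplex, the form that suits the change of
    variables; [hull_tri] is the bridge to [hull]. *)
Definition tri (R : realType) (a b d : plane R) : set (plane R) :=
  [set x | exists s t, [/\ 0 <= s, 0 <= t, s + t <= 1 & x = par a b d s t]].

Lemma planeP (R : realType) (x y : plane R) : x 0 0 = y 0 0 -> x 1 0 = y 1 0 -> x = y.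
Proof. by move=> h0 h1; rewrite -(ptK x) h0 h1 ptK. Qed.

Lemma cramer0 (F : fieldType) (p q r s x y : F) : p * s - q * r != 0 ->
  p * x + q * y = 0 -> r * x + s * y = 0 -> x = 0 /\ y = 0.
Proof.
move=> D0 h1 h2; split; apply: (mulfI D0).
- have -> : (p * s - q * r) * x = s * (p * x + q * y) - q * (r * x + s * y) by ring.
  by rewrite h1 h2; ring.
- have -> : (p * s - q * r) * y = p * (r * x + s * y) - r * (p * x + q * y) by ring.
  by rewrite h1 h2; ring.
Qed.

Section TriangleIntegral.
Variable R : realType.
Local Notation leb := (@lebesgue_measure R).
Local Notation leb2 := (@lebesgue_measure R \x @lebesgue_measure R)%E.
Local Notation mR := (measurableTypeR R).
Local Notation plane := (plane R).

Let simplex : set (mR * mR) := [set p | [/\ 0 <= p.1, 0 <= p.2 & p.1 + p.2 <= 1]].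

Let msimplex : measurable simplex.
Proof.
have mset (a b e : R) : measurable [set p : mR * mR | 0 <= a * p.1 + b * p.2 + e].
  rewrite (_ : [set p | _] = (fun p : mR * mR => (a * p.1 + b * p.2 + e : mR)) @^-1` `[0, +oo[).
    by rewrite -[X in measurable X]setTI; apply: (@measurable_affine R).
  by apply/seteqP; split => p /=; rewrite in_itv/= andbT.
rewrite (_ : simplex = [set p | 0 <= 1 * p.1 + 0 * p.2 + 0] `&`
  ([set p | 0 <= 0 * p.1 + 1 * p.2 + 0] `&` [set p | 0 <= (-1) * p.1 + (-1) * p.2 + 1])).
  by apply: measurableI => //; apply: measurableI.
by apply/seteqP; split => p /= => [[h1 h2 h3]|[h1 [h2 h3]]]; repeat split; lra.
Qed.

Section Tri.
Variables a b d : plane.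
Hypothesis abd : det2 (b - a) (d - a) != 0.
Let D := det2 (b - a) (d - a).

Let Phi (p : mR * mR) : mR * mR :=
  ((b 0 0 - a 0 0) * p.1 + (d 0 0 - a 0 0) * p.2 + a 0 0,
   (b 1 0 - a 1 0) * p.1 + (d 1 0 - a 1 0) * p.2 + a 1 0).

Let DE : D = (b 0 0 - a 0 0) * (d 1 0 - a 1 0) - (d 0 0 - a 0 0) * (b 1 0 - a 1 0).
Proof. by rewrite /D /det2 !mxE; ring. Qed.

Let ptPhi p : pt (Phi p) = par a b d p.1 p.2.
Proof.
by apply: planeP; rewrite !mxE /=; ring.
Qed.


Let Phi_inj : injective Phi.
Proof.
move=> [x y] [x' y'] [/= h1 h2].
have := @cramer0 R (b 0 0 - a 0 0) (d 0 0 - a 0 0) (b 1 0 - a 1 0) (d 1 0 - a 1 0) (x - x') (y - y').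
rewrite -DE => /(_ abd) []; [lra|lra|].
by move=> /eqP; rewrite subr_eq0 => /eqP -> /eqP; rewrite subr_eq0 => /eqP ->.
Qed.

Let Phi_tri : Phi @^-1` (@pt R @^-1` tri a b d) = simplex.
Proof.
apply/seteqP; split => p.
  move=> [s [t [s0 t0 st e]]]; suff -> : p = (s, t) by [].
  apply: Phi_inj; move: e; rewrite -[par _ _ _ _ _](ptPhi (s, t)).
  move: (Phi p) (Phi (s, t)) => [x y] [x' y'] e.
  have := congr1 (fun x : plane => x 0 0) e; have := congr1 (fun x : plane => x 1 0) e.
  by rewrite !mxE /= => -> ->.
by move=> [h1 h2 h3]; exists p.1, p.2; rewrite -ptPhi.
Qed.

Let mPhi : measurable_fun setT Phi.
Proof. exact: measurable_affine2. Qed.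

(** The displayed map is the inverse of [Phi] by Cramer's rule, so the triangle is the preimage of
    the simplex under a measurable map. *)
Let simplex_tri : (fun p : mR * mR => (((d 1 0 - a 1 0) / D) * p.1 + (- (d 0 0 - a 0 0) / D) * p.2 +
    ((a 1 0 * (d 0 0 - a 0 0) - a 0 0 * (d 1 0 - a 1 0)) / D),
  (- (b 1 0 - a 1 0) / D) * p.1 + ((b 0 0 - a 0 0) / D) * p.2 +
    ((a 0 0 * (b 1 0 - a 1 0) - a 1 0 * (b 0 0 - a 0 0)) / D)) : mR * mR) @^-1` simplex
  = @pt R @^-1` tri a b d.
Proof.
set Psi := fun p => _; rewrite -Phi_tri.
have PP p : Phi (Psi p) = p.
  have abd' := abd; rewrite -/D DE in abd'.
  by case: p => x y; rewrite /Phi /Psi /= DE; congr (_, _); field.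
by apply/seteqP; split => p /=; rewrite PP.
Qed.

Lemma measurable_tri : measurable (@pt R @^-1` tri a b d : set (mR * mR)).
Proof.
by rewrite -simplex_tri -[X in measurable X]setTI; apply: (@measurable_affine2 R).
Qed.

Let ge0_int_tri (f : mR * mR -> \bar R) : measurable_fun setT f -> (forall p, 0 <= f p)%E ->
  (\int[leb2]_(p in @pt R @^-1` tri a b d) f p =
   `|D|%:E * \int[leb2]_(p in simplex) f (Phi p))%E.
Proof.
move=> mf f0; rewrite integral_mkcond [in RHS]integral_mkcond.
rewrite (@ge0_integral_affine2 R (b 0 0 - a 0 0) (d 0 0 - a 0 0) (a 0 0)
  (b 1 0 - a 1 0) (d 1 0 - a 1 0) (a 1 0))//.
- rewrite -DE; congr (_ * _)%E; apply: eq_integral => p _.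
  transitivity ((f \_ (@pt R @^-1` tri a b d)) (Phi p)) => //.
  by rewrite !patchE -Phi_tri.
- by rewrite -DE.
- by apply/(measurable_restrictT _ measurable_tri); exact: measurable_funTS.
- by move=> p; rewrite patchE; case: ifP.
Qed.

Variable F : plane -> R.
Hypothesis cF : continuous F.
Let G (p : mR * mR) : R := F (pt (Phi p)).

Let mF : measurable_fun setT (fun p : mR * mR => (F (pt p))%:E).
Proof. by apply/measurable_EFinP; exact: measurable_continuous_pt. Qed.

Let mG : measurable_fun setT (EFin \o G).
Proof. exact: (measurableT_comp mF mPhi). Qed.

Let cpar (s t : R) : continuous (fun p : R * R => par a b d p.1 p.2).
Proof.
move=> p; apply: cvgD; [apply: cvgD|].
- exact: cvg_cst.
- by apply: cvgZr_tmp; exact: cvg_fst.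
- by apply: cvgZr_tmp; exact: cvg_snd.
Qed.

Let intG : leb2.-integrable simplex (EFin \o G).
Proof.
apply: measurable_bounded_integrable => //.
- apply: (@le_lt_trans _ _ (leb2 (`[0, 1]%classic `*` `[0, 1]%classic))).
    apply: le_measure; rewrite ?inE//; first exact: measurableX.
    by move=> p [h1 h2 h3]; split => /=; rewrite in_itv/=; lra.
  by rewrite product_measure1E//= !lebesgue_measure_itv/= lte_fin ltr01 -!EFinB -EFinM ltry.
- by apply/measurable_EFinP; apply: measurable_funTS.
- suff [M [Mr hM]] : bounded_set ((fun p : R * R => F (par a b d p.1 p.2)) @`
      (`[0, 1]%classic `*` `[0, 1]%classic)).
    exists M; split => // x Mx p [h1 h2 h3].
    apply: (hM x Mx (G p)); exists p; last by rewrite /G ptPhi.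
    by split => /=; rewrite in_itv/=; lra.
  apply: compact_bounded; apply: continuous_compact.
    apply: continuous_subspaceT => p; apply: continuous_comp; first exact: cpar.
    exact: cF.
  by apply: compact_setX; exact: segment_compact.
Qed.

Lemma integrable_tri : plane_integrable (tri a b d) F.
Proof.
apply/integrableP; split; first exact: measurable_funTS.
rewrite ge0_int_tri//; last exact: measurableT_comp.
by case/integrableP: intG => _ h; rewrite lte_mul_pinfty.
Qed.

(** Change of variables to the simplex, then Fubini. For fixed [t] the inner variable [s] runs
    parallel to [b - a], the direction in which [green_tri] differentiates. *)
Lemma plane_int_tri : plane_int (tri a b d) F =
  `|D| * \int[leb]_(t in `[0, 1]) \int[leb]_(s in `[0, 1 - t]) F (par a b d s t).
Proof.
have -> : plane_int (tri a b d) F = `|D| * fine (\int[leb2]_(p in simplex) (G p)%:E)%E.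
  rewrite /plane_int /Rintegral integralE !ge0_int_tri//; last 2 first.
  - by apply: measurable_funeneg.
  - by apply: measurable_funepos.
  have hp := integrable_pos_fin_num msimplex intG.
  have hn := integrable_neg_fin_num msimplex intG.
  pose f := fun p : mR * mR => (F (pt p))%:E.
  rewrite (funepos_comp f Phi) in hp; rewrite (funeneg_comp f Phi) in hn.
  rewrite -muleBr//; last by apply: fin_num_adde_defr; exact: hp.
  rewrite fineM//; last by rewrite fin_numB; apply/andP; split; [exact: hp|exact: hn].
  by rewrite [in RHS]integralE (funepos_comp f Phi) (funeneg_comp f Phi).
congr (_ * _).
have intG' : leb2.-integrable setT ((EFin \o G) \_ simplex).
  exact/(integrable_mkcond _ msimplex).
rewrite integral_mkcond -(integral21_prod_meas1 intG') [in RHS]/Rintegral.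
congr fine; rewrite [RHS]integral_mkcond; apply: eq_integral => t _.
rewrite /fubini_G [in RHS]patchE mem_setE; case: ifPn; rewrite in_itv/= => ht; last first.
  apply: integral0_eq => s _; rewrite patchE ifF//; apply/negbTE/negP; rewrite inE => -[/= h1 h2 h3].
  by case/negP: ht; apply/andP; split; lra.
have ct : continuous (fun s => F (par a b d s t)).
  move=> s; apply: (continuous_comp (f := fun s => par a b d s t)); last exact: cF.
  apply: cvgD; last exact: cvg_cst.
  by apply: cvgD; [exact: cvg_cst|apply: cvgZr_tmp; exact: cvg_id].
rewrite /Rintegral fineK; last first.
  apply: integrable_fin_num => //.
  apply: continuous_compact_integrable; first exact: segment_compact.
  exact: continuous_subspaceT.
rewrite [RHS]integral_mkcond; apply: eq_integral => s _.
rewrite !patchE /= /G ptPhi /=.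
congr (if _ then _ else _); apply/idP/idP; rewrite !inE/= in_itv/=.
  by case=> [/= h1 h2 h3]; apply/andP; split=> //; lra.
by move=> /andP[h1 h2]; split => /=; lra.
Qed.

End Tri.
End TriangleIntegral.

(** * Differentiation and Green's formula *)

Section Derivatives.
Variable R : realType.
Local Notation plane := (plane R).
Implicit Types (F : plane -> R) (x y v a : plane).

Lemma is_deriveP (V W : normedModType R) (f : V -> W) (a v : V) (l : W) :
  (h^-1 *: (f (h *: v + a) - f a)) @[h --> 0^'] --> l -> is_derive a v f l.
Proof.
move=> h; apply: DeriveDef; first by apply/cvg_ex; exists l.
by apply: cvg_lim => //; exact: norm_hausdorff.
Qed.

(** The two difference quotients are the same function of the step, so one-variable theorems apply
    to directional derivatives. *)
Lemma is_derive_line F x v s l :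
  is_derive (s *: v + x) v F l <-> is_derive s 1 (fun r : R => F (r *: v + x)) l.
Proof.
have E : (fun h : R => h^-1 *: ((F \o shift (s *: v + x)) (h *: v) - F (s *: v + x))) =
  (fun h : R => h^-1 *: (((fun r => F (r *: v + x)) \o shift s) (h *: 1) - F (s *: v + x))).
  by apply/funext => h /=; rewrite addrA -scalerDl [h *: 1]mulr1.
have D1 : derivable F (s *: v + x) v = derivable (fun r : R => F (r *: v + x)) s 1 :=
  congr1 (fun q : R -> R => cvg (q @ 0^')) E.
have D2 : 'D_v F (s *: v + x) = 'D_1 (fun r : R => F (r *: v + x)) s :=
  congr1 (fun q : R -> R => lim (q @ 0^')) E.
split=> -[h1 h2]; apply: DeriveDef.
- by rewrite -D1.
- by rewrite -D2.
- by rewrite D1.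
- by rewrite D2.
Qed.

Lemma FTC (f F : R -> R) (a b : R) : a <= b -> continuous f ->
  (forall z : R, is_derive z 1 F (f z)) ->
  \int[@lebesgue_measure R]_(z in `[a, b]) f z = F b - F a.
Proof.
rewrite le_eqVlt => /predU1P[<-|ab] cf dF.
  by rewrite set_itv1 Rintegral_set1 subrr.
have cF : continuous F by move=> z; apply/differentiable_continuous/derivable1_diffP; exact: ex_derive.
rewrite /Rintegral (continuous_FTC2 (F := F))//.
- exact: continuous_subspaceT.
- split; first by move=> x _; exact: ex_derive.
  + by apply: cvg_at_right_filter; exact: cF.
  + by apply: cvg_at_left_filter; exact: cF.
- by move=> x _; rewrite derive1E derive_val.
Qed.

(** The intermediate point is given by a fraction [s] of the step, so positive and negative steps
    are treated alike. *)
Lemma mvt_plane F x (i : 'I_2) (r : R) :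
  (forall y, derivable F y (delta_mx i 0)) -> exists2 s, 0 <= s <= 1 &
  F (r *: delta_mx i 0 + x) - F x = r * partial i F ((s * r) *: delta_mx i 0 + x).
Proof.
move=> dF; set e := delta_mx i 0.
have dk (s : R) : is_derive s 1 (fun s : R => F (s *: e + x)) (partial i F (s *: e + x)).
  by apply/is_derive_line; apply: derivableP.
have dg (s : R) : is_derive s 1 (fun s : R => F ((s * r) *: e + x))
    (partial i F ((s * r) *: e + x) * r).
  apply: (@is_derive1_comp R (fun s : R => F (s *: e + x)) (fun s => s * r)).
  by apply: is_derive_eq; rewrite scaler0 add0r [_ *: _]mulr1.
have cg : {within `[0, 1], continuous (fun s : R => F ((s * r) *: e + x))}.
  apply: continuous_subspaceT => t.
  by apply/differentiable_continuous/derivable1_diffP; exact: ex_derive.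
have [s] := MVT_segment ler01 (fun s _ => dg s) cg.
rewrite in_itv/= mul1r mul0r scale0r add0r subr0 mulr1 => s01 E.
by exists s => //; rewrite E mulrC.
Qed.

(** [Cn] records derivatives along the axes, while Green's formula needs the direction of a side.
    The increment is split into two axis-parallel steps; the mean value theorem handles each, and
    continuity of the partial derivatives gives the limit. *)
Lemma Cn1_is_derive F x a : Cn 1 F ->
  is_derive x a F (a 0 0 * partial 0 F x + a 1 0 * partial 1 F x).
Proof.
move=> [cF dF]; apply: is_deriveP.
have [d0 c0] := dF 0; have [d1 c1] := dF 1.
have /choice[s hs] : forall h : R, exists s : R, 0 <= s <= 1 /\
   F (h *: a + x) - F ((h * a 1 0) *: delta_mx 1 0 + x) = (h * a 0 0) *
      partial 0 F ((s * (h * a 0 0)) *: delta_mx 0 0 + ((h * a 1 0) *: delta_mx 1 0 + x)).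
  move=> h; have [s s01 E] := mvt_plane ((h * a 1 0) *: delta_mx 1 0 + x) (h * a 0 0) d0.
  exists s; split => //; rewrite -E; congr (F _ - _).
  by apply: planeP; rewrite !mxE /=; ring.
have /choice[t ht] : forall h : R, exists s : R, 0 <= s <= 1 /\
   F ((h * a 1 0) *: delta_mx 1 0 + x) - F x = (h * a 1 0) *
      partial 1 F ((s * (h * a 1 0)) *: delta_mx 1 0 + x).
  by move=> h; have [s' s01 E] := mvt_plane x (h * a 1 0) d1; exists s'.
suff H : (a 0 0 * partial 0 F ((s h * (h * a 0 0)) *: delta_mx 0 0 + ((h * a 1 0) *: delta_mx 1 0 + x))
    + a 1 0 * partial 1 F ((t h * (h * a 1 0)) *: delta_mx 1 0 + x)) @[h --> 0^'] -->
    (a 0 0 * partial 0 F x + a 1 0 * partial 1 F x).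
  apply: cvg_trans H; apply: near_eq_cvg; near=> h.
  have h0 : h != 0 by near: h; exact: nbhs_dnbhs_neq.
  have [_ E1] := hs h; have [_ E2] := ht h.
  apply: (mulfI h0); rewrite -[h^-1 *: _]/(h^-1 * _) mulVKf//.
  rewrite -[F _ - F x](subrKA (F ((h * a 1 0) *: delta_mx 1 0 + x))) E1 E2; ring.
have bdd (u : R -> R) (r : R) : (forall h, 0 <= u h <= 1) -> (u h * (h * r)) @[h --> 0^'] --> (0 : R).
  move=> hu; apply/cvgrPdist_lt => e e0; near=> h.
  rewrite sub0r normrN normrM (@le_lt_trans _ _ (`|h * r|))//.
    by rewrite ler_piMl// ger0_norm; case/andP: (hu h).
  (* Adding 1 keeps the divisor positive when [r] is 0. *)
  rewrite normrM (@le_lt_trans _ _ (`|h| * (`|r| + 1)))//.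
    by rewrite ler_wpM2l// lerDl.
  rewrite -ltr_pdivlMr; last by rewrite ltr_wpDl.
  near: h; apply: dnbhs0_lt; apply: divr_gt0 => //; by rewrite ltr_wpDl.
have lim0 (r : R) : (h * r) @[h --> (0:R)^'] --> (0 : R).
  have := bdd (fun=> 1) r; under eq_fun do rewrite mul1r.
  by apply=> _; rewrite ler01 lexx.
have lim1 : ((h * a 1 0) *: delta_mx 1 0 + x) @[h --> (0:R)^'] --> x.
  rewrite -[X in _ --> X]add0r -(scale0r (delta_mx 1 0 : plane)).
  by apply: cvgD; [apply: cvgZr_tmp; exact: lim0|exact: cvg_cst].
have lim2 : ((s h * (h * a 0 0)) *: delta_mx 0 0 + ((h * a 1 0) *: delta_mx 1 0 + x))
    @[h --> (0:R)^'] --> x.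
  rewrite -[X in _ --> X]add0r -(scale0r (delta_mx 0 0 : plane)).
  by apply: cvgD => //; apply: cvgZr_tmp; apply: bdd => h; exact: (hs h).1.
have lim3 : ((t h * (h * a 1 0)) *: delta_mx 1 0 + x) @[h --> (0:R)^'] --> x.
  rewrite -[X in _ --> X]add0r -(scale0r (delta_mx 1 0 : plane)).
  apply: cvgD; last exact: cvg_cst.
  by apply: cvgZr_tmp; apply: bdd => h; exact: (ht h).1.
apply: cvgD; apply: cvgM; try exact: cvg_cst.
- by apply: (cvg_comp _ (partial 0 F) lim2); exact: c0.
- by apply: (cvg_comp _ (partial 1 F) lim3); exact: c1.
Unshelve. all: by end_near.
Qed.

End Derivatives.

Section Smoothness.
Variable R : realType.
Local Notation plane := (plane R).
Implicit Types (F G : plane -> R) (x v a b d : plane).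

Lemma contD F G : continuous F -> continuous G -> continuous (fun x => F x + G x).
Proof. by move=> cF cG x; apply: (@continuousD _ _ _ F G); [exact: cF|exact: cG]. Qed.

Lemma contM F G : continuous F -> continuous G -> continuous (fun x => F x * G x).
Proof. by move=> cF cG x; apply: (@continuousM _ _ F G); [exact: cF|exact: cG]. Qed.

Lemma Cn_continuous n F : Cn n F -> continuous F.
Proof. by case: n => [|n] // []. Qed.

Lemma CnS n F : Cn n.+1 F -> Cn n F.
Proof.
elim: n F => [|n IH] F; first by case.
by move=> [cF dF]; split => // i; have [d1 d2] := dF i; split => //; exact: IH.
Qed.

Lemma Cn_partial n F i : Cn n.+1 F -> Cn n (partial i F).
Proof. by move=> [_ /(_ i)[]]. Qed.

Lemma Cn_derivable n F (i : 'I_2) x : Cn n.+1 F -> derivable F x (delta_mx i 0).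
Proof. by move=> [_ /(_ i)[]]. Qed.

Lemma Cn_is_partial n F i x : Cn n.+1 F -> is_derive x (delta_mx i 0) F (partial i F x).
Proof. by move=> /Cn_derivable h; apply: derivableP. Qed.
Arguments Cn_derivable {n F} i x _.
Arguments Cn_is_partial {n F} i x _.
Arguments Cn_partial {n F} i _.

Lemma partialE F (dF : plane -> R) i :
  (forall x, is_derive x (delta_mx i 0) F (dF x)) -> partial i F = dF.
Proof. by move=> h; apply/funext => x; rewrite /partial derive_val. Qed.

Lemma Cn_build n F (dF : 'I_2 -> plane -> R) : continuous F ->
  (forall i x, is_derive x (delta_mx i 0) F (dF i x)) ->
  (forall i, Cn n (dF i)) -> Cn n.+1 F.
Proof.
move=> cF h1 h2; split => // i; rewrite (partialE (h1 i)); split => // x.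
Qed.

Lemma CnD n F G : Cn n F -> Cn n G -> Cn n (fun x => F x + G x).
Proof.
elim: n F G => [|n IH] F G hF hG.
  exact: contD (Cn_continuous hF) (Cn_continuous hG).
apply: (Cn_build (dF := fun i x => partial i F x + partial i G x)).
- exact: contD (Cn_continuous hF) (Cn_continuous hG).
- by move=> i x; apply: is_deriveD; [exact: Cn_is_partial _ _ hF|exact: Cn_is_partial _ _ hG].
- by move=> i; apply: IH; exact: Cn_partial.
Qed.

Lemma CnM n F G : Cn n F -> Cn n G -> Cn n (fun x => F x * G x).
Proof.
elim: n F G => [|n IH] F G hF hG.
  exact: contM (Cn_continuous hF) (Cn_continuous hG).
apply: (Cn_build (dF := fun i x => F x * partial i G x + G x * partial i F x)).
- exact: contM (Cn_continuous hF) (Cn_continuous hG).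
- by move=> i x; apply: is_deriveM; [exact: Cn_is_partial _ _ hF|exact: Cn_is_partial _ _ hG].
- move=> i; apply: CnD; apply: IH.
  + exact: CnS hF.
  + exact: Cn_partial _ hG.
  + exact: CnS hG.
  + exact: Cn_partial _ hF.
Qed.

Lemma Cn_cst n (r : R) : Cn n (fun=> r : R).
Proof.
elim: n r => [|n IH] r; first exact: cst_continuous.
apply: (Cn_build (dF := fun i x => 0)) => //; exact: cst_continuous.
Qed.

Lemma is_derive_coord (i : 'I_2) x v : is_derive x v (fun y : plane => y i 0) (v i 0).
Proof.
apply: is_deriveP; apply: cvg_near_cst; near=> h.
have h0 : h != 0 by near: h; exact: nbhs_dnbhs_neq.
by rewrite !mxE addrK -[_ *: _]/(h^-1 * _) mulKf.
Unshelve. all: by end_near.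
Qed.

Lemma Cn_coord n (i : 'I_2) : Cn n (fun x : plane => x i 0).
Proof.
case: n => [|n]; first exact: coord_continuous.
apply: (Cn_build (dF := fun j x => (delta_mx j 0 : plane) i 0)).
- exact: coord_continuous.
- by move=> j x; exact: is_derive_coord.
- by move=> j; exact: Cn_cst.
Qed.

Lemma is_derive_translate F w x v l :
  is_derive (w + x) v F l -> is_derive x v (fun y => F (w + y)) l.
Proof.
have E : (fun h : R => h^-1 *: ((F \o shift (w + x)) (h *: v) - F (w + x))) =
  (fun h : R => h^-1 *: (((fun y => F (w + y)) \o shift x) (h *: v) - F (w + x))).
  by apply/funext => h /=; rewrite addrCA.
have D1 : derivable F (w + x) v = derivable (fun y => F (w + y)) x v :=
  congr1 (fun q : R -> R => cvg (q @ 0^')) E.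
have D2 : 'D_v F (w + x) = 'D_v (fun y => F (w + y)) x :=
  congr1 (fun q : R -> R => lim (q @ 0^')) E.
by move=> [h1 h2]; apply: DeriveDef; [rewrite -D1|rewrite -D2].
Qed.

(** The mixed second difference with step [h] is symmetric in the two directions. The mean value
    theorem, applied twice in either order, writes it as [h * h] times one of the mixed derivatives
    at a point that tends to [x]. *)
Lemma schwarz F : Cn 2 F -> partial 0 (partial 1 F) = partial 1 (partial 0 F).
Proof.
move=> hF; apply/funext => x.
have diff2 (i j : 'I_2) (h : R) : exists s t, [/\ 0 <= s <= 1, 0 <= t <= 1 &
    F (h *: delta_mx i 0 + (h *: delta_mx j 0 + x)) - F (h *: delta_mx i 0 + x)
    - (F (h *: delta_mx j 0 + x) - F x) = h * h *
    partial j (partial i F) ((t * h) *: delta_mx j 0 + ((s * h) *: delta_mx i 0 + x))].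
  pose g y := F (h *: delta_mx j 0 + y) - F y.
  have dg y : is_derive y (delta_mx i 0) g (partial i F (h *: delta_mx j 0 + y) - partial i F y).
    apply: is_deriveB; last exact: Cn_is_partial _ _ hF.
    by apply: is_derive_translate; exact: Cn_is_partial _ _ hF.
  have [s s01] := @mvt_plane R g x i h (fun y => @ex_derive _ _ _ _ _ _ _ (dg y)).
  rewrite (partialE dg).
  have [t t01 ->] := @mvt_plane R (partial i F) ((s * h) *: delta_mx i 0 + x) j h
    (fun y => Cn_derivable j y (Cn_partial i hF)).
  by move=> E; exists s, t; split => //; rewrite -mulrA -E /g (addrCA (h *: delta_mx j 0)).
have lim (i j : 'I_2) (s t : R -> R) : (forall h, 0 <= s h <= 1) -> (forall h, 0 <= t h <= 1) ->
   partial j (partial i F) ((t h * h) *: delta_mx j 0 + ((s h * h) *: delta_mx i 0 + x))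
   @[h --> (0:R)^'] --> partial j (partial i F) x.
  move=> hs ht.
  have bdd (u : R -> R) : (forall h, 0 <= u h <= 1) -> (u h * h) @[h --> 0^'] --> (0 : R).
    move=> hu; apply/cvgrPdist_lt => e e0; near=> h.
    rewrite sub0r normrN normrM (@le_lt_trans _ _ `|h|)//.
      by rewrite ler_piMl// ger0_norm; case/andP: (hu h).
    by near: h; exact: dnbhs0_lt.
  apply: (@cvg_comp _ _ _ (fun h => (t h * h) *: delta_mx j 0 + ((s h * h) *: delta_mx i 0 + x))
    (partial j (partial i F)) _ (nbhs x)).
    suff : ((t h * h) *: delta_mx j 0 + ((s h * h) *: delta_mx i 0 + x)) @[h --> (0:R)^'] --> x by [].
    rewrite -[X in _ --> X]add0r -(scale0r (delta_mx j 0 : plane)).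
    apply: cvgD; first by apply: cvgZr_tmp; exact: bdd.
    rewrite -[X in _ --> X]add0r -(scale0r (delta_mx i 0 : plane)).
    by apply: cvgD; [apply: cvgZr_tmp; exact: bdd|exact: cvg_cst].
  exact: (Cn_continuous (Cn_partial j (Cn_partial i hF))).
have /choice[s1 /choice[t1 h1]] := diff2 1 0.
have /choice[s2 /choice[t2 h2]] := diff2 0 1.
have l1 := @lim 1 0 s1 t1 (fun h => let: And3 a _ _ := h1 h in a) (fun h => let: And3 _ a _ := h1 h in a).
have l2 := @lim 0 1 s2 t2 (fun h => let: And3 a _ _ := h2 h in a) (fun h => let: And3 _ a _ := h2 h in a).
apply: (cvg_unique _ l1); first exact: norm_hausdorff.
apply: cvg_trans l2; apply: near_eq_cvg; near=> h.
have h0 : h != 0 by near: h; exact: nbhs_dnbhs_neq.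
have [_ _ E1] := h1 h; have [_ _ E2] := h2 h.
apply: (mulfI (mulf_neq0 h0 h0)).
move: E2; rewrite (addrCA (h *: delta_mx 0 0)) => E2.
apply: (etrans (esym E2)); apply: (etrans _ E1).
have swp (p q r t : R) : p - q - (r - t) = p - r - (q - t) by ring.
exact: swp.
Unshelve. all: by end_near.
Qed.

(** Parametrised over [[0, 1]], without the length of the segment; the factors [det2] in front of it
    supply length and normal component together. *)
Definition line_int (F : plane -> R) (p q : plane) : R :=
  \int[@lebesgue_measure R]_(t in `[0, 1]) F (p + t *: (q - p)).

Lemma line_continuous F (p w : plane) : continuous F -> continuous (fun t : R => F (p + t *: w)).
Proof.
move=> cF t; apply: (continuous_comp (f := fun t : R => p + t *: w)); last exact: cF.
by apply: cvgD; [exact: cvg_cst|apply: cvgZr_tmp; exact: cvg_id].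
Qed.

Lemma continuous_integrable (f : R -> R) (a b : R) : continuous f ->
  (@lebesgue_measure R).-integrable `[a, b] (EFin \o f).
Proof.
move=> cf; apply: continuous_compact_integrable; first exact: segment_compact.
exact: continuous_subspaceT.
Qed.

(** A derivative along the side from [a] to [b] integrates exactly in that direction, so only the
    other two sides contribute. *)
Lemma green_tri a b d F : det2 (b - a) (d - a) != 0 -> Cn 1 F ->
  plane_int (tri a b d)
    (fun x => (b - a) 0 0 * partial 0 F x + (b - a) 1 0 * partial 1 F x) =
  `|det2 (b - a) (d - a)| * (line_int F b d - line_int F a d).
Proof.
move=> D0 hF; rewrite plane_int_tri//; last first.
  by apply: contD; apply: contM; try exact: cst_continuous;
   exact: (Cn_continuous (Cn_partial _ hF)).
congr (_ * _); rewrite /line_int -RintegralB//; last 2 first.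
- by apply: continuous_integrable; apply: line_continuous; exact: Cn_continuous hF.
- by apply: continuous_integrable; apply: line_continuous; exact: Cn_continuous hF.
apply: eq_Rintegral => t; rewrite inE/= in_itv/= => /andP[t0 t1].
pose y := a + t *: (d - a).
have parE s : par a b d s t = s *: (b - a) + y by rewrite /par /y addrCA addrA.
pose g x := (b - a) 0 0 * partial 0 F x + (b - a) 1 0 * partial 1 F x.
have cg : continuous g.
  by apply: contD; apply: contM; try exact: cst_continuous;
   exact: (Cn_continuous (Cn_partial _ hF)).
have cgs : continuous (fun s => g (par a b d s t)).
  rewrite (_ : (fun s => _) = (fun s => g (y + s *: (b - a)))); first exact: line_continuous.
  by apply/funext => s; rewrite parE addrC.
have dgs (s : R) : is_derive s 1 (fun s => F (par a b d s t)) (g (par a b d s t)).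
  rewrite (_ : (fun s => F _) = (fun s => F (s *: (b - a) + y))); last first.
    by apply/funext => s'; rewrite parE.
  by rewrite parE; apply/is_derive_line; exact: Cn1_is_derive.
have t1' : 0 <= 1 - t by lra.
rewrite (FTC t1' cgs dgs); congr (F _ - F _); rewrite parE /y; apply: planeP; rewrite !mxE; ring.
Qed.

End Smoothness.

(** * Smooth test functions *)

Section Bump.
Variable R : realType.
Local Notation plane := (plane R).

(** The factor [y ^- n] closes the family under differentiation ([is_derive_flat]), so smoothness
    follows by induction for all exponents together. *)
Definition flat (n : nat) (y : R) : R :=
  if 0 < y then y ^- n * expR (- y^-1) else 0.

Lemma flat_ge0 n y : 0 <= flat n y.
Proof.
by rewrite /flat; case: ifP => // y0; rewrite mulr_ge0 ?expR_ge0// invr_ge0 exprn_ge0// ltW.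
Qed.

Lemma flat_le0 n y : y <= 0 -> flat n y = 0.
Proof. by rewrite /flat leNgt => /negbTE ->. Qed.

Lemma flat0_gt0 y : 0 < y -> 0 < flat 0 y.
Proof. by move=> y0; rewrite /flat y0 mulr_gt0 ?expR_gt0// invr_gt0 exprn_gt0. Qed.

Lemma flat0_le1 y : flat 0 y <= 1.
Proof.
rewrite /flat; case: ifP => // y0; rewrite expr0 invr1 mul1r -expR0 ler_expR.
by rewrite oppr_le0 invr_ge0 ltW.
Qed.

(** From [expR x >= (x / (n + 2)) ^+ (n + 2)] at [x = 1 / y]. This is one power more than
    [flat n.+1] consumes, and the factor [y] left over gives the limit at 0. *)
Let flat_bound n y : 0 < y -> flat n.+1 y <= (n.+2%:R ^+ n.+2) * y.
Proof.
move=> y0; rewrite /flat y0.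
have k0 : (0 : R) < n.+2%:R by rewrite ltr0n.
have h : (y^-1 / n.+2%:R) ^+ n.+2 <= expR (y^-1).
  rewrite -{2}(divfK (lt0r_neq0 k0) y^-1) expRM_natr.
  apply: lerXn2r; rewrite ?nnegrE ?expR_ge0//; first by rewrite divr_ge0// invr_ge0 ltW.
  by apply: le_trans (expR_ge1Dx _); rewrite lerDr ler01.
have h2 : expR (- y^-1) <= (y * n.+2%:R) ^+ n.+2.
  rewrite expRN -[leRHS]invrK lef_pV2 ?posrE ?expR_gt0 ?invr_gt0 ?exprn_gt0 ?mulr_gt0//.
  by move: h; rewrite -invfM exprVn.
apply: le_trans (ler_wpM2l _ h2) _; first by rewrite invr_ge0 exprn_ge0// ltW.
rewrite exprMn mulrA [y ^+ n.+2]exprSr mulKf ?expf_neq0 ?lt0r_neq0//.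
by rewrite mulrC.
Qed.

Lemma is_derive_flat n (y : R) :
  is_derive y 1 (flat n) (- n%:R * flat n.+1 y + flat n.+2 y).
Proof.
have [y0|y0|->] := ltrgtP y 0.
- rewrite !flat_le0 1?ltW// mulr0 addr0.
  apply: (@near_eq_is_derive _ _ _ (cst 0)).
  by near=> z; rewrite flat_le0// ltW//; near: z; exact: lt_nbhsl.
- have y1 : y != 0 by rewrite gt_eqF.
  rewrite /flat y0.
  apply: (@near_eq_is_derive _ R^o R^o (fun y : R => y ^- n * expR (- y^-1))).
    by near=> z; rewrite ifT//; near: z; exact: lt_nbhsr.
  have d1 : is_derive y 1 (fun z : R => z^-1) (- y ^- 2).
    by apply: is_derive_eq; [exact: (is_deriveV (f := id))|rewrite [_ *: _]mulr1].
  have d2 : is_derive y 1 (fun z : R => expR (- z^-1)) (expR (- y^-1) * y ^- 2).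
    by apply: (is_derive1_comp (f := expR)); apply: is_derive_eq; rewrite opprK.
  have d3 : is_derive y 1 (fun z : R => z ^- n) (- (y ^+ n) ^- 2 * (n%:R * y ^+ n.-1)).
    apply: (is_deriveV (f := fun z : R => z ^+ n)); first by rewrite expf_neq0.
    apply: DeriveDef; first exact: exprn_derivable.
    by rewrite exp_derive -![_ *: _]/(_ * _) mulr1.
  apply: (is_derive_eq (is_deriveM d3 d2)).
  rewrite -![_ *: _]/(_ * _); case: n d3 => [|n] _ /=.
    by rewrite !expr0 !mul0r expr1 expr2; field.
  have yn : y ^+ n != 0 by rewrite expf_neq0.
  by rewrite !exprS !expr0; field; rewrite yn y1.
- rewrite !flat_le0// mulr0 addr0; apply: is_deriveP.
  (* At 0 the difference quotient of [flat n] is [flat n.+1] itself. *)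
  have H h : h^-1 *: (flat n (h *: 1 + 0) - flat n 0) = flat n.+1 h.
    rewrite (flat_le0 _ (lexx 0)) subr0 addr0 [h *: _]mulr1 -[_ *: _]/(_ * _) /flat.
    by case: ifP => h0; rewrite ?mulr0// mulrA -invfM -exprS.
  under eq_fun do rewrite H.
  apply/cvgrPdist_lt => e e0; near=> h.
  rewrite sub0r normrN ger0_norm ?flat_ge0//.
  have [h0|h0] := ltP 0 h; last by rewrite flat_le0.
  have k0 : (0 : R) < n.+2%:R ^+ n.+2 by rewrite exprn_gt0.
  apply: le_lt_trans (flat_bound _ h0) _.
  rewrite mulrC -ltr_pdivlMr//; apply: le_lt_trans (ler_norm _) _.
  by near: h; apply: dnbhs0_lt; rewrite divr_gt0.
Unshelve. all: by end_near.
Qed.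

Definition affine_fun (l : plane -> R) : Prop :=
  exists p q r, forall x : plane, l x = p * x 0 0 + q * x 1 0 + r.

Lemma Cn_affine n l : affine_fun l -> Cn n l.
Proof.
move=> [p [q [r h]]]; rewrite (_ : l = (fun x => p * x 0 0 + q * x 1 0 + r)).
  by apply: CnD; [apply: CnD; apply: CnM|]; (exact: Cn_cst || exact: Cn_coord).
exact/funext.
Qed.

Lemma is_derive_comp_affine (f : R -> R) (df : R -> R) (p q r : R) (i : 'I_2) (x : plane) :
  (forall y : R, is_derive y 1 f (df y)) ->
  is_derive x (delta_mx i 0) (fun x : plane => f (p * x 0 0 + q * x 1 0 + r))
   (df (p * x 0 0 + q * x 1 0 + r) *
      (p * (delta_mx i 0 : plane) 0 0 + q * (delta_mx i 0 : plane) 1 0)).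
Proof.
move=> hf; set e : plane := delta_mx i 0.
rewrite -[X in is_derive X](_ : 0 *: e + x = x); last by rewrite scale0r add0r.
apply/is_derive_line => /=.
rewrite (_ : (fun r0 : R => _) = (fun s : R =>
   f (s * (p * e 0 0 + q * e 1 0) + (p * x 0 0 + q * x 1 0 + r)))); last first.
  by apply/funext => s; congr f; rewrite !mxE; ring.
apply: (is_derive1_comp (f := f)
  (g := fun s : R => s * (p * e 0 0 + q * e 1 0) + (p * x 0 0 + q * x 1 0 + r))).
  by rewrite /= mul0r add0r; exact: hf.
by apply: is_derive_eq; rewrite scaler0 add0r [_ *: _]mulr1 addr0.
Qed.

Lemma Cn_flat n m l : affine_fun l -> Cn n (fun x => flat m (l x)).
Proof.
move=> [p [q [r h]]].
rewrite (_ : (fun x => flat m (l x)) = (fun x : plane => flat m (p * x 0 0 + q * x 1 0 + r))); last first.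
  by apply/funext => x; rewrite h.
have cont k : continuous (fun x : plane => flat k (p * x 0 0 + q * x 1 0 + r)).
  move=> x; apply: (continuous_comp (f := fun x : plane => p * x 0 0 + q * x 1 0 + r)).
    by apply: (@Cn_continuous _ 0); apply: Cn_affine; exists p, q, r.
  apply/differentiable_continuous/derivable1_diffP; by case: (is_derive_flat k (p * x 0 0 + q * x 1 0 + r)).
elim: n m => [|n IH] m; first exact: cont.
apply: Cn_build (cont m) _ _.
  by move=> i x; apply: is_derive_comp_affine; exact: is_derive_flat.
move=> i; apply: CnM; last exact: Cn_cst.
by apply: CnD; [apply: CnM; [exact: Cn_cst|exact: IH]|exact: IH].
Qed.

Lemma test_function_closed (D C : set plane) (f : plane -> R) :
  smooth f -> closed C -> C `<=` D° -> (forall x, f x != 0 -> C x) -> test_function D f.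
Proof.
move=> sf cC CD fC; split => // x; rewrite closureE => h; apply: CD; apply: h; split => //.
Qed.

End Bump.

(** * Barycentric coordinates and the split *)

Lemma ord2_cases (i : 'I_2) : i = 0 \/ i = 1.
Proof. by case: i => [[|[|//]] hi]; [left|right]; apply: val_inj. Qed.

Lemma ord3P (P : 'I_3 -> Prop) : P 0 -> P 1 -> P 2%:R -> forall k, P k.
Proof.
move=> h0 h1 h2 [[|[|[|]]]//= h]; [move: h0|move: h1|move: h2];
  by congr P; apply: val_inj.
Qed.

Lemma ordS3 (k : 'I_3) : ordS (ordS (ordS k)) = k.
Proof. by move: k; apply: ord3P; apply: val_inj. Qed.

Lemma ordS_neq (k : 'I_3) : [/\ (ordS k == k) = false, (ordS (ordS k) == k) = false,
  (k == ordS k) = false, (k == ordS (ordS k)) = false &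
  ((ordS (ordS k) == ordS k) = false) /\ ((ordS k == ordS (ordS k)) = false)].
Proof. by move: k; apply: ord3P. Qed.

Lemma ordS_cases (k l : 'I_3) : [\/ l = k, l = ordS k | l = ordS (ordS k)].
Proof.
by move: k l; apply: ord3P; apply: ord3P;
  ((by apply: Or31; apply: val_inj) || (by apply: Or32; apply: val_inj) ||
   (by apply: Or33; apply: val_inj)).
Qed.

Lemma ordS_all (P : 'I_3 -> Prop) k : P k -> P (ordS k) -> P (ordS (ordS k)) -> forall l, P l.
Proof. by move=> h0 h1 h2 l; case: (ordS_cases k l) => ->. Qed.

(** The expansion may start at any [k]: the formulas below are relative to one vertex or edge and
    its two cyclic successors. *)
Lemma sum3 (V : nmodType) (F : 'I_3 -> V) k :
  \sum_l F l = F k + F (ordS k) + F (ordS (ordS k)).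
Proof.
rewrite !big_ord_recl big_ord0 addr0.
have e0 : ord0 = 0 :> 'I_3 by apply: val_inj.
have e1 : lift ord0 ord0 = 1 :> 'I_3 by apply: val_inj.
have e2 : lift ord0 (lift ord0 ord0) = 2%:R :> 'I_3 by apply: val_inj.
have s0 : ordS 0 = 1 :> 'I_3 by apply: val_inj.
have s1 : ordS 1 = 2%:R :> 'I_3 by apply: val_inj.
have s2 : ordS 2%:R = 0 :> 'I_3 by apply: val_inj.
rewrite e0 e1 e2; move: k; apply: ord3P; rewrite ?s0 ?s1 ?s2 ?s0 ?s1.
- by rewrite addrA.
- by rewrite addrC.
- by rewrite addrA addrC addrA.
Qed.

Section Barycentric.
Variable R : realType.
Local Notation plane := (plane R).
Variable v : 'I_3 -> plane.

(** Twice the signed area of the triangle. *)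
Definition area : R := det2 (v 1 - v 0) (v 2%:R - v 0).

Lemma nondegenerateE : nondegenerate v = (area != 0).
Proof.
rewrite /nondegenerate /area; congr (_ != 0).
set a := v 1 - v 0; set b := v 2%:R - v 0.
have e (i j : 'I_2) : i = j :> nat -> i = j by exact: val_inj.
have el i : row_mx a b i 0 = a i 0.
  by rewrite -(row_mxEl a b i 0); congr (row_mx a b i _); apply: val_inj.
have er i : row_mx a b i 1 = b i 0.
  by rewrite -(row_mxEr a b i 0); congr (row_mx a b i _); apply: val_inj.
rewrite /det2 -!el -!er; move: (row_mx a b) => N.
rewrite (expand_det_row _ 0) !big_ord_recl big_ord0 /cofactor !det_mx11 !mxE addr0.
rewrite -[ord0]/(0 : 'I_2) (e (lift 0 0) 1)// (e (lift 1 0) 0)// /= expr0 expr1; ring.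
Qed.

Lemma areaE k : area = det2 (v (ordS k) - v k) (v (ordS (ordS k)) - v k).
Proof.
have s0 : ordS 0 = 1 :> 'I_3 by apply: val_inj.
have s1 : ordS 1 = 2%:R :> 'I_3 by apply: val_inj.
have s2 : ordS 2%:R = 0 :> 'I_3 by apply: val_inj.
by rewrite /area /det2; move: k; apply: ord3P; rewrite ?s0 ?s1 ?s2 ?s0 ?s1 !mxE; ring.
Qed.

(* The barycentric coordinates of [v]. *)
Definition lam (k : 'I_3) (x : plane) : R :=
  det2 (v (ordS (ordS k)) - v (ordS k)) (x - v (ordS k)) / area.

Hypothesis hv : area != 0.

Lemma lam_affine k : affine_fun (lam k).
Proof.
rewrite /lam /det2; set a := v (ordS (ordS k)); set b := v (ordS k).
exists (- (a - b) 1 0 / area), ((a - b) 0 0 / area),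
  (((a - b) 1 0 * b 0 0 - (a - b) 0 0 * b 1 0) / area).
by move=> x; rewrite !mxE; field.
Qed.

Lemma lam_par l a b d s t :
  lam l (par a b d s t) = (1 - s - t) * lam l a + s * lam l b + t * lam l d.
Proof. by rewrite /lam /det2 /par !mxE; field. Qed.

Lemma lam_sum k x : lam k x + lam (ordS k) x + lam (ordS (ordS k)) x = 1.
Proof.
have := hv; rewrite (areaE k) /lam (areaE k) /det2 ordS3 !mxE => h; by field.
Qed.

Lemma lam_sumE x : \sum_l lam l x = 1.
Proof. by rewrite (sum3 _ 0) lam_sum. Qed.

Lemma lam_pt k x : x = lam k x *: v k + lam (ordS k) x *: v (ordS k) +
  lam (ordS (ordS k)) x *: v (ordS (ordS k)).
Proof.
have := hv; rewrite (areaE k) /lam (areaE k) /det2 ordS3 => h.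
by apply: planeP; rewrite !mxE; move: h; rewrite !mxE => h; field.
Qed.

Lemma lam_ptE x : x = \sum_l lam l x *: v l.
Proof. by rewrite (sum3 _ 0) -lam_pt. Qed.

Lemma lam_v1 k : lam k (v k) = 1.
Proof.
have := hv; rewrite (areaE k) /lam (areaE k) /det2 !mxE => h; by field.
Qed.

Lemma lam_v2 k : lam k (v (ordS k)) = 0.
Proof. by rewrite /lam /det2 !mxE; field. Qed.

Lemma lam_v3 k : lam k (v (ordS (ordS k))) = 0.
Proof. by rewrite /lam /det2 !mxE; field. Qed.

Lemma lam_v4 k : lam (ordS k) (v k) = 0.
Proof. by rewrite -{2}(ordS3 k) lam_v3. Qed.

Lemma lam_v5 k : lam (ordS (ordS k)) (v k) = 0.
Proof. by rewrite -{2}(ordS3 k) lam_v2. Qed.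

Definition lam_vE := (lam_v1, lam_v2, lam_v3, lam_v4, lam_v5).

Lemma lam_v k l : lam k (v l) = (k == l)%:R.
Proof.
have [n1 n2 n3 n4 [n5 n6]] := ordS_neq k.
by case: (ordS_cases k l) => ->; rewrite lam_vE ?eqxx ?n3 ?n4.
Qed.

Lemma lam_inj x y : (forall l, lam l x = lam l y) -> x = y.
Proof. by move=> h; rewrite (lam_ptE x) (lam_ptE y); apply: eq_bigr => l _; rewrite h. Qed.

Lemma lam_comb l (t : 'I_3 -> R) (w : 'I_3 -> plane) : \sum_i t i = 1 ->
  lam l (\sum_i t i *: w i) = \sum_i t i * lam l (w i).
Proof.
rewrite !(sum3 _ 0) => t1; rewrite -[X in lam l X](_ : par (w 0) (w (ordS 0)) (w (ordS (ordS 0)))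
  (t (ordS 0)) (t (ordS (ordS 0))) = _).
  by rewrite lam_par -t1; ring.
have -> : t 0 = 1 - t (ordS 0) - t (ordS (ordS 0)) by rewrite -t1; ring.
by apply: planeP; rewrite !mxE; ring.
Qed.

Lemma hull_lam x : hull v x <-> forall l, 0 <= lam l x.
Proof.
split=> [[t [t0 t1 ->]] l|h]; last by exists (lam ^~ x); split => //; [exact: lam_sumE|exact: lam_ptE].
by rewrite lam_comb//; apply: sumr_ge0 => i _; rewrite lam_v mulr_ge0.
Qed.

Lemma hull_tri (w : 'I_3 -> plane) k : hull w = tri (w k) (w (ordS k)) (w (ordS (ordS k))).
Proof.
apply/seteqP; split => [x [t [t0 t1 ->]]|x [s [t [s0 t0 st ->]]]].
  move: t1; rewrite !(sum3 _ k) => t1.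
  exists (t (ordS k)), (t (ordS (ordS k))); split => //.
    by rewrite -t1 -addrA lerDr.
  have -> : t k = 1 - t (ordS k) - t (ordS (ordS k)) by rewrite -t1; ring.
  by apply: planeP; rewrite !mxE; ring.
have [n1 n2 n3 n4 [n5 n6]] := ordS_neq k.
exists (fun l => if l == k then 1 - s - t else if l == ordS k then s else t); split.
- by move=> i; case: ifP => _; [lra|case: ifP].
- by rewrite (sum3 _ k) !eqxx n1 n2 n5; ring.
- by rewrite (sum3 _ k) !eqxx n1 n2 n5; apply: planeP; rewrite !mxE; ring.
Qed.

Lemma lam_continuous l : continuous (lam l).
Proof. by apply: (@Cn_continuous _ 0); apply: Cn_affine; exact: lam_affine. Qed.

(** If [lam l x = 0], then moving from [x] away from [v l] makes [lam l] negative at once, so [x] is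
    not interior. Conversely, finitely many strict inequalities define an open set. *)
Lemma hull_interior x : (hull v)° x <-> forall l, 0 < lam l x.
Proof.
split.
  move=> h l; rewrite lt_neqAle.
  have h0 := (hull_lam _).1 (interior_subset h).
  rewrite h0 andbT; apply/eqP => e.
  pose p (t : R) := x + t *: (x - v l).
  have cp : p t @[t --> (0 : R)] --> x.
    rewrite -[X in _ --> X]addr0 -(scale0r (x - v l)).
    by apply: cvgD; [exact: cvg_cst|apply: cvgZr_tmp; exact: cvg_id].
  have [d /= d0 hd] := (@nbhs_ballP _ _ _ _).1 (cp _ h).
  have := hd (d / 2); rewrite /= /ball /= sub0r normrN gtr0_norm; last by rewrite divr_gt0.
  have -> : d / 2 < d by lra.
  move=> /(_ isT) /hull_lam /(_ l).
  have -> : p (d / 2) = par x x (v l) 0 (- (d / 2)).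
    by rewrite /p /par scale0r addr0 scaleNr -scalerN opprB.
  by rewrite lam_par -e lam_v1; lra.
move=> h; rewrite (_ : hull v = \bigcap_l [set x | 0 <= lam l x]); last first.
  by apply/seteqP; split=> y; [move=> /hull_lam hy l _; exact: hy|move=> hy; apply/hull_lam => l; exact: hy].
have ho l : nbhs x [set y | 0 < lam l y].
  have hl : nbhs (lam l x) [set z | 0 < z] by exact: lt_nbhsr.
  exact: (@lam_continuous l x _ hl).
rewrite /interior /=.
have H : nbhs x ([set y | 0 < lam 0 y] `&` ([set y | 0 < lam 1 y] `&` [set y | 0 < lam 2%:R y])).
  by apply: filterI => //; apply: filterI.
by apply: filterS H => y [h0 [h1 h2]]; move=> + _; apply: ord3P; exact: ltW.
Qed.

Lemma closed_lam_ge l (r : R) : closed [set x | r <= lam l x].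
Proof.
rewrite (_ : [set x | _] = lam l @^-1` [set y | r <= y]) //.
by apply: closed_comp; [move=> x _; exact: lam_continuous|exact: closed_ge].
Qed.

Lemma closed_hull : closed (hull v).
Proof.
rewrite (_ : hull v = \bigcap_l [set x | 0 <= lam l x]); last first.
  by apply/seteqP; split=> y; [move=> /hull_lam hy l _; exact: hy|move=> hy; apply/hull_lam => l; exact: hy].
by apply: closed_bigI => l _; exact: closed_lam_ge.
Qed.

End Barycentric.

Section Split.
Variable R : realType.
Local Notation plane := (plane R).
Variables (v : 'I_3 -> plane) (c : plane).
Hypothesis hv : area v != 0.
Hypothesis hc : forall l, 0 < lam v l c.
Local Notation lam := (lam v).
Local Notation K := (K v c).

Lemma K_tri k : K k = tri c (v (ordS k)) (v (ordS (ordS k))).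
Proof.
by have [n1 n2 _ _ _] := ordS_neq k; rewrite /K (hull_tri _ k) eqxx n1 n2.
Qed.

Lemma K_tri' k : K k = tri c (v (ordS (ordS k))) (v (ordS k)).
Proof.
rewrite K_tri; apply/seteqP; split => x [s [t [s0 t0 st ->]]]; exists t, s;
  by rewrite (addrC t s); split => //; rewrite /par addrAC.
Qed.

Lemma area_K k : det2 (v (ordS k) - c) (v (ordS (ordS k)) - c) = lam k c * area v.
Proof. by rewrite /lam /det2 !mxE; field. Qed.

Lemma area_K_neq0 k : det2 (v (ordS k) - c) (v (ordS (ordS k)) - c) != 0.
Proof. by rewrite area_K mulf_neq0// gt_eqF. Qed.

Lemma area_K_neq0' k : det2 (v (ordS (ordS k)) - c) (v (ordS k) - c) != 0.
Proof.
have := area_K_neq0 k; rewrite -oppr_eq0; congr (_ != 0); rewrite /det2; ring.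
Qed.

(** [K k] is the part of [T] where the ratio [lam l x / lam l c] is smallest at [l = k]; the
    inequalities are cleared of denominators. *)
Lemma K_lam k x : K k x <-> [/\ 0 <= lam k x,
  lam (ordS k) c * lam k x <= lam (ordS k) x * lam k c &
  lam (ordS (ordS k)) c * lam k x <= lam (ordS (ordS k)) x * lam k c].
Proof.
have [n1 n2 n3 n4 [n5 n6]] := ordS_neq k.
have ck := hc k; split.
  rewrite K_tri => -[s [t [s0 t0 st ->]]]; rewrite !(lam_par hv) !(lam_v hv) !eqxx ?n1 ?n2 ?n3 ?n4 ?n5 ?n6.
  rewrite !mulr0 !addr0 !mulr1; split.
  - by apply: mulr_ge0; [lra|exact: ltW].
  - rewrite -subr_ge0 (_ : _ - _ = s * lam k c); last by ring.
    by rewrite mulr_ge0// ltW.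
  - rewrite -subr_ge0 (_ : _ - _ = t * lam k c); last by ring.
    by rewrite mulr_ge0// ltW.
move=> [h0 h1 h2]; rewrite K_tri.
(* [m] is the barycentric coordinate of [x] at [c] in the triangle [K k]. The other two are what
   remains of [lam] after subtracting [m] times its value at [c]. *)
pose m := lam k x / lam k c.
have E : lam k x = m * lam k c by rewrite /m divfK// gt_eqF.
exists (lam (ordS k) x - lam (ordS k) c * m), (lam (ordS (ordS k)) x - lam (ordS (ordS k)) c * m).
have m0 : 0 <= m by rewrite divr_ge0// ltW.
have S1 := lam_sum hv k x; have S2 := lam_sum hv k c.
have S3 : 1 - (lam (ordS k) x - lam (ordS k) c * m) -
   (lam (ordS (ordS k)) x - lam (ordS (ordS k)) c * m) = m.
  have S2m : m * lam k c + m * lam (ordS k) c + m * lam (ordS (ordS k)) c = m.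
    by rewrite -!mulrDr S2 mulr1.
  clearbody m; lra.
clearbody m.
split.
- by rewrite subr_ge0 -(ler_pM2r ck) -mulrA -E.
- by rewrite subr_ge0 -(ler_pM2r ck) -mulrA -E.
- lra.
apply: (lam_inj hv); apply: (ordS_all (k := k)); rewrite (lam_par hv) !(lam_v hv) ?eqxx ?n3 ?n4 ?n5 ?n6 ?mulr1n ?mulr0n S3.
- by rewrite E; ring.
- by ring.
- by ring.
Qed.

Lemma K_sub k : K k `<=` T v.
Proof.
move=> x /K_lam [h0 h1 h2]; apply/(hull_lam hv); apply: (ordS_all (k := k)) => //.
- by rewrite -(pmulr_lge0 _ (hc k)); apply: le_trans h1; rewrite mulr_ge0// ltW.
- by rewrite -(pmulr_lge0 _ (hc k)); apply: le_trans h2; rewrite mulr_ge0// ltW.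
Qed.

Lemma T_cover x : T v x -> exists k, K k x.
Proof.
move=> /(hull_lam hv) h.
pose m l := lam l x / lam l c.
have [k hk] : exists k, forall l, m k <= m l.
  by case: (@arg_minP _ R 'I_3 0 xpredT m isT) => k _ hk; exists k => l; exact: hk.
exists k; apply/K_lam; split => //.
- by have := hk (ordS k); rewrite /m ler_pdivrMr// mulrAC ler_pdivlMr// [X in X <= _]mulrC.
- by have := hk (ordS (ordS k)); rewrite /m ler_pdivrMr// mulrAC ler_pdivlMr// [X in X <= _]mulrC.
Qed.

Lemma K_closed k : closed (K k).
Proof.
pose w := fun j => if j == k then c else v j.
have [n1 n2 _ _ _] := ordS_neq k.
apply: (@closed_hull _ w); rewrite (areaE _ k) /w eqxx n1 n2; exact: area_K_neq0.
Qed.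

Lemma edge_K j (t : R) : 0 <= t <= 1 ->
  K (ordS j) (c + t *: (v j - c)) /\ K (ordS (ordS j)) (c + t *: (v j - c)).
Proof.
move=> /andP[t0 t1]; split.
- rewrite K_tri; exists 0, t; split; rewrite ?add0r ?ordS3//.
  by rewrite /par scale0r addr0.
- rewrite K_tri; exists t, 0; split; rewrite ?addr0 ?ordS3//.
  by rewrite /par scale0r addr0.
Qed.

(** The two memberships bound the ratios for [ordS j] and [ordS (ordS j)] by each other, so they are
    equal; with common value [r] the point has parameter [1 - r]. *)
Lemma K_edge j x : K (ordS j) x -> K (ordS (ordS j)) x ->
  exists2 t, 0 <= t <= 1 & x = c + t *: (v j - c).
Proof.
move=> /K_lam; rewrite ordS3 => -[h0 h1 h2] /K_lam; rewrite ordS3 => -[h3 h4 h5].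
have [n1 n2 n3 n4 [n5 n6]] := ordS_neq j.
have c0 := hc j; have c1 := hc (ordS j); have c2 := hc (ordS (ordS j)).
pose r := lam (ordS j) x / lam (ordS j) c.
have E1 : lam (ordS j) x = r * lam (ordS j) c by rewrite /r divfK// gt_eqF.
have E2 : lam (ordS (ordS j)) x = r * lam (ordS (ordS j)) c.
  apply: (mulfI (lt0r_neq0 c1)).
  have -> : lam (ordS j) c * lam (ordS (ordS j)) x = lam (ordS (ordS j)) c * lam (ordS j) x.
    by apply/le_anti/andP; split; [rewrite [X in _ <= X]mulrC|rewrite [X in _ <= X]mulrC].
  by rewrite E1; ring.
have S1 := lam_sum hv j x; have S2 := lam_sum hv j c.
have r0 : 0 <= r by rewrite divr_ge0// ltW.
have h2' : r * lam j c <= lam j x.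
  by rewrite -(ler_pM2r c1) mulrAC -E1 mulrC.
exists (1 - r).
  apply/andP; split; last lra.
  rewrite subr_ge0 -S1 E1 E2; apply: le_trans (_ : r * 1 <= _); first by rewrite mulr1.
  by rewrite -S2 mulrDr mulrDr !lerD2r.
rewrite (_ : c + _ = par c (v j) c (1 - r) 0); last by rewrite /par scale0r addr0.
apply: (lam_inj hv); apply: (ordS_all (k := j)); rewrite (lam_par hv) !(lam_v hv) ?eqxx ?n1 ?n2 ?n3 ?n4 ?n5 ?n6 ?mulr1n ?mulr0n.
- have -> : lam j x = 1 - lam (ordS j) x - lam (ordS (ordS j)) x by rewrite -S1; ring.
  have -> : lam j c = 1 - lam (ordS j) c - lam (ordS (ordS j)) c by rewrite -S2; ring.
  by rewrite E1 E2; ring.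
- by rewrite E1; ring.
- by rewrite E2; ring.
Qed.

Lemma continuous_edge (W : topologicalType) (u : 'I_3 -> plane -> W) j (t : R) :
  continuous_on_T v c u -> 0 <= t <= 1 ->
  u (ordS j) (c + t *: (v j - c)) = u (ordS (ordS j)) (c + t *: (v j - c)).
Proof.
move=> [g [_ hg]] t01; have [h1 h2] := edge_K j t01.
by rewrite -(hg _ _ h1) (hg _ _ h2).
Qed.

(** The pasting lemma for three closed pieces; by [K_edge] agreement on the segments is agreement on
    all overlaps. *)
Lemma continuous_glue (W : topologicalType) (u : 'I_3 -> plane -> W) :
  (forall k, continuous (u k)) ->
  (forall j (t : R), 0 <= t <= 1 ->
    u (ordS j) (c + t *: (v j - c)) = u (ordS (ordS j)) (c + t *: (v j - c))) ->
  continuous_on_T v c u.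
Proof.
move=> cu agree.
have agree2 k l x : K k x -> K l x -> u k x = u l x.
  case: (ordS_cases k l) => -> // hk hl.
  - have := @K_edge (ordS (ordS k)) x; rewrite !ordS3 => /(_ hk hl)[t t01 ->].
    by have := agree (ordS (ordS k)) t t01; rewrite !ordS3.
  - have := @K_edge (ordS k) x; rewrite !ordS3 => /(_ hl hk)[t t01 ->].
    by have := agree (ordS k) t t01; rewrite !ordS3.
(* Off [T] the value [u 0 x] is a default. *)
pose g x := if pselect (exists k, K k x) is left h then u (projT1 (cid h)) x else u 0 x.
have gE k x : K k x -> g x = u k x.
  move=> hk; rewrite /g; case: pselect => [h|[]]; last by exists k.
  by apply: agree2 => //; exact: projT2 (cid h).
exists g; split; last exact: gE.
have Kg k : {within K k, continuous g}.
  apply: (@subspace_eq_continuous _ _ _ (u k)); last exact: continuous_subspaceT.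
  by move=> x; rewrite inE => h; apply: esym; exact: gE.
rewrite (_ : T v = K 0 `|` (K 1 `|` K 2%:R)).
  by apply: withinU_continuous => //; [exact: K_closed|apply: closedU; exact: K_closed|
    apply: withinU_continuous => //; exact: K_closed].
apply/seteqP; split => x; last by move=> [|[|]]; exact: K_sub.
by move=> /T_cover [k]; move: k; apply: ord3P; [left|right; left|right; right].
Qed.

End Split.

(** * Green's formula on the split *)

Section SplitIntegral.
Variable R : realType.
Local Notation plane := (plane R).
Variables (v : 'I_3 -> plane) (c : plane).
Hypothesis hv : area v != 0.
Hypothesis hc : forall l, 0 < lam v l c.
Local Notation lam := (lam v).
Local Notation K := (K v c).
Local Notation pw_int := (pw_int v c).

Lemma integrable_K k (f : plane -> R) : continuous f -> plane_integrable (K k) f.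
Proof. by move=> cf; rewrite K_tri; apply: integrable_tri => //; exact: area_K_neq0. Qed.

Lemma measurable_K k : measurable (@pt R @^-1` K k : set (measurableTypeR R * measurableTypeR R)).
Proof. by rewrite K_tri; apply: measurable_tri; exact: area_K_neq0. Qed.

Lemma plane_intD k (f g : plane -> R) : continuous f -> continuous g ->
  plane_int (K k) (fun x => f x + g x) = plane_int (K k) f + plane_int (K k) g.
Proof.
move=> cf cg; rewrite /plane_int RintegralD//.
- exact: measurable_K.
- exact: integrable_K.
- exact: integrable_K.
Qed.

Lemma plane_intZ k (r : R) (f : plane -> R) : continuous f ->
  plane_int (K k) (fun x => r * f x) = r * plane_int (K k) f.
Proof.
move=> cf; rewrite /plane_int RintegralZl//.
- exact: measurable_K.
- exact: integrable_K.
Qed.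

Lemma eq_pw_int (f g : 'I_3 -> plane -> R) : (forall k x, K k x -> f k x = g k x) ->
  pw_int f = pw_int g.
Proof.
move=> h; apply: eq_bigr => k _; apply: eq_Rintegral => p; rewrite inE /= => hp; exact: h.
Qed.

Lemma pw_intD (f g : 'I_3 -> plane -> R) :
  (forall k, continuous (f k)) -> (forall k, continuous (g k)) ->
  pw_int (fun k x => f k x + g k x) = pw_int f + pw_int g.
Proof. by move=> cf cg; rewrite -big_split; apply: eq_bigr => k _; exact: plane_intD. Qed.

Lemma pw_intZ (r : R) (f : 'I_3 -> plane -> R) : (forall k, continuous (f k)) ->
  pw_int (fun k x => r * f k x) = r * pw_int f.
Proof. by move=> cf; rewrite mulr_sumr; apply: eq_bigr => k _; exact: plane_intZ. Qed.

Lemma line_int0 (F : plane -> R) p q :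
  (forall t : R, 0 <= t <= 1 -> F (p + t *: (q - p)) = 0) -> line_int F p q = 0.
Proof.
move=> h; transitivity (\int[@lebesgue_measure R]_(t in `[0, 1]) (0 : R)).
  by apply: eq_Rintegral => t; rewrite inE/= in_itv/= => /h.
by rewrite Rintegral_cst// mul0r.
Qed.

(** The sign of [area], that is, the orientation of the vertices. *)
Definition orient : R := `|area v| / area v.

Lemma orient_neq0 : orient != 0.
Proof. by rewrite /orient mulf_neq0// ?invr_eq0// normr_eq0. Qed.

(** The function vanishes on the outer edge, so [green_tri] along each of the two inner sides leaves
    a single segment integral. The axis vector is then expanded in these two directions, with
    coefficients [p] and [q]. *)
Lemma green_K k i (F : plane -> R) : Cn 1 F ->
  (forall x, lam k x = 0 -> F x = 0) ->
  plane_int (K k) (partial i F) = - orient *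
   (det2 (delta_mx i 0) (v (ordS (ordS k)) - c) * line_int F c (v (ordS (ordS k)))
   - det2 (delta_mx i 0) (v (ordS k) - c) * line_int F c (v (ordS k))).
Proof.
move=> hF F0.
set a := v (ordS k); set b := v (ordS (ordS k)); set e : plane := delta_mx i 0.
have D0 := area_K_neq0 hv hc k; have D1 := area_K_neq0' hv hc k.
have G1 := green_tri D0 hF; have G2 := green_tri D1 hF.
rewrite -K_tri in G1; rewrite -K_tri' in G2; rewrite -/a -/b in G1 G2 D0 D1.
have bd (p q : plane) : lam k p = 0 -> lam k q = 0 -> line_int F p q = 0.
  move=> hp hq; apply: line_int0 => t t01; apply: F0.
  rewrite (_ : p + _ = par p q q t 0); last by rewrite /par scale0r addr0.
  by rewrite (lam_par hv) hp hq; ring.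
rewrite (bd a b) in G1; rewrite ?(lam_v2 hv, lam_v3 hv)//.
rewrite (bd b a) in G2; rewrite ?(lam_v2 hv, lam_v3 hv)//.
rewrite !sub0r in G1 G2.
set D := det2 (a - c) (b - c) in G1 D0.
have D2 : det2 (b - c) (a - c) = - D by rewrite /D /det2; ring.
rewrite D2 normrN in G2.
pose p := det2 e (b - c) / D; pose q := det2 (a - c) e / D.
have E0 : e 0 0 = p * (a - c) 0 0 + q * (b - c) 0 0.
  by rewrite /p /q; move: D0; rewrite /D /det2 => D0; field.
have E1 : e 1 0 = p * (a - c) 1 0 + q * (b - c) 1 0.
  by rewrite /p /q; move: D0; rewrite /D /det2 => D0; field.
have cp j : continuous (partial j F) by exact: (Cn_continuous (Cn_partial _ hF)).
have PE : partial i F = (fun x => p * ((a - c) 0 0 * partial 0 F x + (a - c) 1 0 * partial 1 F x)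
    + q * ((b - c) 0 0 * partial 0 F x + (b - c) 1 0 * partial 1 F x)).
  apply/funext => x.
  have -> : partial i F x = e 0 0 * partial 0 F x + e 1 0 * partial 1 F x.
    have [_ H] := Cn1_is_derive x e hF; exact: H.
  by rewrite E0 E1; ring.
have cc (r s : R) : continuous (fun x => r * partial 0 F x + s * partial 1 F x).
  by apply: contD; apply: contM => //; exact: cst_continuous.
rewrite PE plane_intD; last 2 first.
- by apply: contM; [exact: cst_continuous|exact: cc].
- by apply: contM; [exact: cst_continuous|exact: cc].
rewrite !plane_intZ// G1 G2 /p /q.
have nD : `|D| / D = orient.
  rewrite /D area_K// normrM (gtr0_norm (hc k)) /orient; field.
  by rewrite hv gt_eqF.
rewrite (_ : det2 (a - c) e = - det2 e (a - c)); last by rewrite /det2; ring.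
by rewrite -nD; field.
Qed.

(** The segment from [c] to [v j] borders the pieces [ordS j] and [ordS (ordS j)], which contribute
    with opposite signs; hence the difference of the two traces. *)
Lemma pw_green i (F : 'I_3 -> plane -> R) : (forall k, Cn 1 (F k)) ->
  (forall k x, lam k x = 0 -> F k x = 0) ->
  pw_int (fun k => partial i (F k)) = - orient * \sum_j det2 (delta_mx i 0) (v j - c) *
    (line_int (F (ordS j)) c (v j) - line_int (F (ordS (ordS j))) c (v j)).
Proof.
move=> hF F0; rewrite /pw_int.
under eq_bigr => k _ do rewrite (green_K i (hF k) (F0 k)).
rewrite -mulr_sumr; congr (_ * _); rewrite !(sum3 _ 0) !ordS3.
by move: (line_int _ _ _) (line_int _ _ _) (line_int _ _ _) (line_int _ _ _) (line_int _ _ _) (line_int _ _ _)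
  (det2 _ _) (det2 _ _) (det2 _ _) => *; ring.
Qed.

Lemma pw_green0 i (F : 'I_3 -> plane -> R) : (forall k, Cn 1 (F k)) ->
  (forall k x, lam k x = 0 -> F k x = 0) ->
  (forall j (t : R), 0 <= t <= 1 ->
    F (ordS j) (c + t *: (v j - c)) = F (ordS (ordS j)) (c + t *: (v j - c))) ->
  pw_int (fun k => partial i (F k)) = 0.
Proof.
move=> hF F0 ag; rewrite pw_green// big1 ?mulr0// => j _.
rewrite (_ : line_int (F (ordS j)) _ _ = line_int (F (ordS (ordS j))) c (v j)) ?subrr ?mulr0//.
by apply: eq_Rintegral => t; rewrite inE/= in_itv/= => /ag.
Qed.

(** The support lies in the interior of [T], so a test function vanishes on the whole line through
    an edge, which is what [green_K] asks for. *)
Lemma test_function0 (f : plane -> R) k x : test_function (T v) f -> lam k x = 0 -> f x = 0.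
Proof.
move=> [_ h] hx; apply/eqP; apply: contraT => fx.
have /(hull_interior hv) /(_ k) : (T v)° x by apply: h; exact: subset_closure.
by rewrite hx ltxx.
Qed.

End SplitIntegral.

(** * Distributional sven of piecewise smooth fields *)

(* [ring] compares atoms up to conversion, which unfolds [partial] down to limits. *)
Ltac gen_partial :=
  repeat match goal with |- context [partial ?i ?f ?x] => generalize (partial i f x) end.

Section SplitDistribution.
Variable R : realType.
Local Notation plane := (plane R).
Variables (v : 'I_3 -> plane) (c : plane).
Hypothesis hv : area v != 0.
Hypothesis hc : forall l, 0 < lam v l c.
Local Notation lam := (lam v).
Local Notation pw_int := (pw_int v c).

Definition edge_agree (f : 'I_3 -> plane -> R) : Prop :=
  forall j (t : R), 0 <= t <= 1 ->
    f (ordS j) (c + t *: (v j - c)) = f (ordS (ordS j)) (c + t *: (v j - c)).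

Lemma partialM (f g : plane -> R) i x : Cn 1 f -> Cn 1 g ->
  partial i (fun y => f y * g y) x = f x * partial i g x + g x * partial i f x.
Proof.
move=> hf hg; have H y : is_derive y (delta_mx i 0 : plane) (fun y => f y * g y) (f y * partial i g y + g y * partial i f y).
  by apply: is_deriveM; [exact: Cn_is_partial _ _ hf|exact: Cn_is_partial _ _ hg].
by rewrite (partialE H).
Qed.

Lemma partialB (f g : plane -> R) i x : Cn 1 f -> Cn 1 g ->
  partial i (fun y => f y - g y) x = partial i f x - partial i g x.
Proof.
move=> hf hg; have H y : is_derive y (delta_mx i 0 : plane) (fun y => f y - g y) (partial i f y - partial i g y).
  by apply: is_deriveB; [exact: Cn_is_partial _ _ hf|exact: Cn_is_partial _ _ hg].
by rewrite (partialE H).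
Qed.

Lemma CnB n (f g : plane -> R) : Cn n f -> Cn n g -> Cn n (fun x => f x - g x).
Proof.
move=> hf hg; rewrite (_ : (fun x => _) = (fun x => f x + (-1) * g x)).
  by apply: CnD => //; apply: CnM => //; exact: Cn_cst.
by apply/funext => x; rewrite mulN1r.
Qed.

Lemma partial_off_support (phi : plane -> R) i x :
  ~ closure [set x | phi x != 0] x -> partial i phi x = 0.
Proof.
move=> nx; have nb : nbhs x [set y | phi y = 0].
  have : open (~` closure [set x | phi x != 0]) by apply: closed_openC; exact: closed_closure.
  rewrite openE => /(_ x nx); apply: filterS => y hy.
  by apply/eqP; apply: contraT => h; case: hy; apply: subset_closure.
rewrite /partial; suff H : is_derive x (delta_mx i 0 : plane) phi (0 : R) by rewrite derive_val.
apply: (@near_eq_is_derive R plane R (fun=> 0 : R)).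
  by near=> y; apply/esym; near: y.
Unshelve. all: by end_near.
Qed.

Local Opaque partial.

Lemma test_function_partial (phi : plane -> R) i :
  test_function (T v) phi -> test_function (T v) (partial i phi).
Proof.
move=> [sphi hphi]; split; first by move=> n; exact: Cn_partial _ (sphi n.+1).
apply: (subset_trans _ hphi); rewrite [X in _ `<=` X](closure_id _).1; last exact: closed_closure.
move=> x; apply: closure_subset => y /eqP hy; apply: contrapT => ny.
by apply: hy; apply: partial_off_support => h; apply: ny.
Qed.

(** The common shape of the two integrations by parts below: [a1] to [a4] are derivatives of
    products that match across the segments, while [a5] and [a6] leave room for factors that
    jump. *)
Lemma pw_int_comb (h a1 a2 a3 a4 a5 a6 : 'I_3 -> plane -> R) :
  (forall k, continuous (h k)) -> (forall k, continuous (a1 k)) ->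
  (forall k, continuous (a2 k)) -> (forall k, continuous (a3 k)) ->
  (forall k, continuous (a4 k)) -> (forall k, continuous (a5 k)) ->
  (forall k, continuous (a6 k)) ->
  pw_int a1 = 0 -> pw_int a2 = 0 -> pw_int a3 = 0 -> pw_int a4 = 0 ->
  pw_int (fun k x => h k x + ((a1 k x + a2 k x) +
    ((-1) * (a3 k x + a4 k x) + (-1) * (a5 k x + a6 k x)))) =
  pw_int h - (pw_int a5 + pw_int a6).
Proof.
move=> ch c1 c2 c3 c4 c5 c6 i1 i2 i3 i4.
have cA (f g : 'I_3 -> plane -> R) : (forall k, continuous (f k)) -> (forall k, continuous (g k)) ->
  forall k, continuous (fun x => f k x + g k x) by move=> *; apply: contD.
have cN (f : 'I_3 -> plane -> R) : (forall k, continuous (f k)) ->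
    forall k, continuous (fun x => (-1) * f k x).
  by move=> cf k; apply: contM => //; exact: cst_continuous.
have c12 := cA _ _ c1 c2; have c34 := cA _ _ c3 c4; have c56 := cA _ _ c5 c6.
rewrite (pw_intD hv hc ch (cA _ _ c12 (cA _ _ (cN _ c34) (cN _ c56)))).
rewrite (pw_intD hv hc c12 (cA _ _ (cN _ c34) (cN _ c56))) (pw_intD hv hc (cN _ c34) (cN _ c56)).
rewrite (pw_intZ hv hc _ c34) (pw_intZ hv hc _ c56).
rewrite (pw_intD hv hc c1 c2) (pw_intD hv hc c3 c4) (pw_intD hv hc c5 c6) i1 i2 i3 i4; ring.
Qed.

(* The values of [a] only enter through Green's formula, so [sven (def a) = 0]
   needs the continuity of [a] but not that of its curl. *)
Lemma sven_dist_def (a : 'I_3 -> plane -> 'cV[R]_2) (phi : plane -> R) :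
  (forall i k n, Cn n (fun x => a k x i 0)) ->
  (forall i, edge_agree (fun k x => a k x i 0)) ->
  test_function (T v) phi -> sven_dist v c (def a) phi = 0.
Proof.
move=> sa aga hphi; have sphi n : Cn n phi := hphi.1 n.
have sd i j n : Cn n (partial i (partial j phi)).
  by apply: Cn_partial; apply: Cn_partial.
have vd i j k x : lam k x = 0 -> partial i (partial j phi) x = 0.
  by move=> h; apply: (test_function0 hv _ h); do 2 apply: test_function_partial.
have [F FE] : exists F : 'I_2 -> 'I_2 -> 'I_2 -> 'I_3 -> plane -> R,
  forall l i j k, F l i j k = fun x => a k x l 0 * partial i (partial j phi) x.
  by exists (fun l i j k x => a k x l 0 * partial i (partial j phi) x).
have sF l i j k n : Cn n (F l i j k) by rewrite FE; apply: CnM.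
have G (m l i j : 'I_2) : pw_int (fun k => partial m (F l i j k)) = 0.
  apply: (pw_green0 hv hc) => //.
  - by move=> k x hx; rewrite FE (vd _ _ _ _ hx) mulr0.
  - by move=> e t t01; rewrite !FE (aga l e t t01).
have cF m l i j k : continuous (partial m (F l i j k)).
  exact: (Cn_continuous (Cn_partial m (sF l i j k 1))).
(* The integrand is a sum of four derivatives: the third derivatives of [phi] that the product rule
   creates cancel in pairs. *)
rewrite /sven_dist (eq_pw_int (g := fun k x =>
   0 * phi x + ((partial 0 (F 0 1 1 k) x + partial 1 (F 1 0 0 k) x) +
   ((-1) * (partial 1 (F 0 0 1 k) x + partial 0 (F 1 1 0 k) x) +
    (-1) * (0 * phi x + 0 * phi x))))).
  have c0 (k : 'I_3) : continuous (fun x => 0 * phi x).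
    by apply: contM; [exact: cst_continuous|exact: (Cn_continuous (sphi 0))].
  have z0 : pw_int (fun=> fun x => 0 * phi x) = 0.
    by rewrite (pw_intZ hv hc 0 (f := fun=> phi)) ?mul0r// => k; exact: (@Cn_continuous _ 0).
  rewrite (pw_int_comb c0 (cF 0 0 1 1) (cF 1 1 0 0) (cF 1 0 0 1) (cF 0 1 1 0) c0 c0
    (G 0 0 1 1) (G 1 1 0 0) (G 1 0 0 1) (G 0 1 1 0)).
  by rewrite z0; ring.
move=> k x _; rewrite !mxE.
have dM m l i j : partial m (F l i j k) x = a k x l 0 * partial m (partial i (partial j phi)) x +
    partial i (partial j phi) x * partial m (fun y => a k y l 0) x.
  by rewrite FE; exact: partialM m x (sa l k 1) (sd i j 1).
have S1 : partial 0 (partial 1 (partial 1 phi)) x = partial 1 (partial 0 (partial 1 phi)) x.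
  exact: (congr1 (fun h : plane -> R => h x) (schwarz (Cn_partial 1 (sphi 3)))).
have S2 : partial 1 (partial 0 (partial 0 phi)) x = partial 0 (partial 1 (partial 0 phi)) x.
  exact: (esym (congr1 (fun h : plane -> R => h x) (schwarz (Cn_partial 0 (sphi 3))))).
have S3 : partial 0 (partial 1 phi) x = partial 1 (partial 0 phi) x.
  exact: (congr1 (fun h : plane -> R => h x) (schwarz (sphi 2))).
generalize (dM 0 0 1 1) (dM 1 1 0 0) (dM 1 0 0 1) (dM 0 1 1 0); move: S1 S2 S3; clear.
gen_partial.
by move=> *; subst; field.
Qed.

Definition jump (f : 'I_3 -> plane -> R) (j : 'I_3) (x : plane) : R :=
  f (ordS j) x - f (ordS (ordS j)) x.

Lemma line_intZ r (F : plane -> R) p q : continuous F ->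
  line_int (fun x => r * F x) p q = r * line_int F p q.
Proof.
move=> cF; rewrite /line_int RintegralZl//.
by apply: continuous_integrable; exact: line_continuous.
Qed.

Lemma line_intB (F G : plane -> R) p q : continuous F -> continuous G ->
  line_int (fun x => F x - G x) p q = line_int F p q - line_int G p q.
Proof.
move=> cF cG; rewrite /line_int RintegralB//;
by apply: continuous_integrable; exact: line_continuous.
Qed.

(** For the entries [p], [q], [r] in positions 00, 11, 01, sven is the divergence of the field with
    components [partial 0 q - partial 1 r] and [partial 1 p - partial 0 r]. This is the jump of its
    normal component across the [j]-th segment, times the length of the segment. *)
Definition conormal (p q r : 'I_3 -> plane -> R) (j : 'I_3) (x : plane) : R :=
  (v j - c) 1 0 * (jump (fun k => partial 0 (q k)) j x - jump (fun k => partial 1 (r k)) j x) -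
  (v j - c) 0 0 * (jump (fun k => partial 1 (p k)) j x - jump (fun k => partial 0 (r k)) j x).

Definition sven_piece (p q r : plane -> R) (x : plane) : R :=
  partial 1 (partial 1 p) x + partial 0 (partial 0 q) x
  - partial 1 (partial 0 r) x - partial 0 (partial 1 r) x.

(** Two integrations by parts. The first leaves no terms on the segments because [u] is continuous;
    the second leaves the jumps of the first derivatives. The boundary of [T] contributes nothing,
    since test functions vanish near it. *)
Lemma sven_dist_formula (u : 'I_3 -> plane -> 'M[R]_2) (phi : plane -> R) :
  (forall i j k n, Cn n (fun x => u k x i j)) ->
  (forall k x, u k x 1 0 = u k x 0 1) ->
  (forall i j, edge_agree (fun k x => u k x i j)) ->
  test_function (T v) phi ->
  let p k x := u k x 0 0 in let q k x := u k x 1 1 in let r k x := u k x 0 1 in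
  sven_dist v c u phi = pw_int (fun k x => sven_piece (p k) (q k) (r k) x * phi x) +
    orient v * \sum_j line_int (fun x => conormal p q r j x * phi x) c (v j).
Proof.
move=> su sym agu hphi p q r; have sphi n : Cn n phi := hphi.1 n.
have sd i n : Cn n (partial i phi) by apply: Cn_partial.
have v0 k x : lam k x = 0 -> phi x = 0 by move=> h; apply: (test_function0 hv _ h).
have v1 i k x : lam k x = 0 -> partial i phi x = 0.
  by move=> h; apply: (test_function0 hv _ h); apply: test_function_partial.
have sp k n : Cn n (p k) by apply: su.
have sq k n : Cn n (q k) by apply: su.
have sr k n : Cn n (r k) by apply: su.
pose z0 k x := partial 0 (q k) x - partial 1 (r k) x.
pose z1 k x := partial 1 (p k) x - partial 0 (r k) x.
have sz0 k n : Cn n (z0 k) by apply: CnB; apply: Cn_partial.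
have sz1 k n : Cn n (z1 k) by apply: CnB; apply: Cn_partial.
have G (f : 'I_3 -> plane -> R) m i : (forall k n, Cn n (f k)) -> edge_agree f ->
    pw_int (fun k => partial m (fun x => f k x * partial i phi x)) = 0.
  move=> sf ag; apply: (pw_green0 hv hc).
  - by move=> k; apply: CnM.
  - by move=> k x hx; rewrite (v1 _ _ _ hx) mulr0.
  - by move=> e t t01; rewrite (ag e t t01).
have cP (f g : 'I_3 -> plane -> R) m : (forall k n, Cn n (f k)) -> (forall k n, Cn n (g k)) ->
    forall k, continuous (partial m (fun x => f k x * g k x)).
  move=> sf sg k; have H : Cn 1 (fun x => f k x * g k x) by apply: CnM.
  exact: (Cn_continuous (Cn_partial m H)).
have csv k : continuous (fun x => sven_piece (p k) (q k) (r k) x * phi x).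
  apply: contM; last exact: (Cn_continuous (sphi 0)).
  apply: (@Cn_continuous _ 0); apply: CnB; first apply: CnB; first apply: CnD;
    by do 2 apply: Cn_partial.
pose dp i (k : 'I_3) := partial i phi.
have sdp i k n : Cn n (dp i k) by exact: sd.
have [A1 EA1] : exists f : 'I_3 -> plane -> R, f = (fun k => partial 1 (fun x => p k x * dp 1 k x)).
  exact: (ex_intro _ _ erefl).
have [A2 EA2] : exists f : 'I_3 -> plane -> R, f = (fun k => partial 0 (fun x => q k x * dp 0 k x)).
  exact: (ex_intro _ _ erefl).
have [A3 EA3] : exists f : 'I_3 -> plane -> R, f = (fun k => partial 0 (fun x => r k x * dp 1 k x)).
  exact: (ex_intro _ _ erefl).
have [A4 EA4] : exists f : 'I_3 -> plane -> R, f = (fun k => partial 1 (fun x => r k x * dp 0 k x)).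
  exact: (ex_intro _ _ erefl).
have [A5 EA5] : exists f : 'I_3 -> plane -> R, f = (fun k => partial 1 (fun x => z1 k x * phi x)).
  exact: (ex_intro _ _ erefl).
have [A6 EA6] : exists f : 'I_3 -> plane -> R, f = (fun k => partial 0 (fun x => z0 k x * phi x)).
  exact: (ex_intro _ _ erefl).
have c1 k : continuous (A1 k) by rewrite EA1; apply: cP.
have c2 k : continuous (A2 k) by rewrite EA2; apply: cP.
have c3 k : continuous (A3 k) by rewrite EA3; apply: cP.
have c4 k : continuous (A4 k) by rewrite EA4; apply: cP.
have c5 k : continuous (A5 k) by rewrite EA5; apply: (cP z1 (fun=> phi)).
have c6 k : continuous (A6 k) by rewrite EA6; apply: (cP z0 (fun=> phi)).
rewrite /sven_dist (eq_pw_int (g := fun k x =>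
   sven_piece (p k) (q k) (r k) x * phi x +
  ((A1 k x + A2 k x) + ((-1) * (A3 k x + A4 k x) + (-1) * (A5 k x + A6 k x))))); last first.
  move=> k x _.
  have dM m (f g : plane -> R) : (forall n, Cn n f) -> (forall n, Cn n g) ->
      partial m (fun x => f x * g x) x = f x * partial m g x + g x * partial m f x.
    by move=> hf hg; rewrite (partialM m x (hf 1) (hg 1)).
  have dB m (f g : plane -> R) : (forall n, Cn n f) -> (forall n, Cn n g) ->
      partial m (fun x => f x - g x) x = partial m f x - partial m g x.
    by move=> hf hg; rewrite (partialB m x (hf 1) (hg 1)).
  have D1 := dM 1 _ _ (sp k) (sdp 1 k); have D2 := dM 0 _ _ (sq k) (sdp 0 k).
  have D3 := dM 0 _ _ (sr k) (sdp 1 k); have D4 := dM 1 _ _ (sr k) (sdp 0 k).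
  have D5 := dM 1 _ _ (sz1 k) sphi; have D6 := dM 0 _ _ (sz0 k) sphi.
  have D7 := dB 1 _ _ (fun n => Cn_partial 1 (sp k n.+1)) (fun n => Cn_partial 0 (sr k n.+1)).
  have D8 := dB 0 _ _ (fun n => Cn_partial 0 (sq k n.+1)) (fun n => Cn_partial 1 (sr k n.+1)).
  have F1 : A1 k x = (p k) x * partial 1 (dp 1 k) x + (dp 1 k) x * partial 1 (p k) x.
    by rewrite EA1; exact: D1.
  have F2 : A2 k x = (q k) x * partial 0 (dp 0 k) x + (dp 0 k) x * partial 0 (q k) x.
    by rewrite EA2; exact: D2.
  have F3 : A3 k x = (r k) x * partial 0 (dp 1 k) x + (dp 1 k) x * partial 0 (r k) x.
    by rewrite EA3; exact: D3.
  have F4 : A4 k x = (r k) x * partial 1 (dp 0 k) x + (dp 0 k) x * partial 1 (r k) x.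
    by rewrite EA4; exact: D4.
  have F5 : A5 k x = z1 k x * partial 1 phi x +
     phi x * (partial 1 (partial 1 (p k)) x - partial 1 (partial 0 (r k)) x).
    by rewrite EA5 -D7; exact: D5.
  have F6 : A6 k x = z0 k x * partial 0 phi x +
     phi x * (partial 0 (partial 0 (q k)) x - partial 0 (partial 1 (r k)) x).
    by rewrite EA6 -D8; exact: D6.
  rewrite F1 F2 F3 F4 F5 F6 sym /sven_piece /z0 /z1 /dp -/(p k x) -/(q k x) -/(r k x).
  by gen_partial => *; ring.
have i1 : pw_int A1 = 0 by rewrite EA1; apply: G => //; exact: agu.
have i2 : pw_int A2 = 0 by rewrite EA2; apply: G => //; exact: agu.
have i3 : pw_int A3 = 0 by rewrite EA3; apply: G => //; exact: agu.
have i4 : pw_int A4 = 0 by rewrite EA4; apply: G => //; exact: agu.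
rewrite (pw_int_comb csv c1 c2 c3 c4 c5 c6 i1 i2 i3 i4); congr (_ + _).
have gz (z : 'I_3 -> plane -> R) m : (forall k n, Cn n (z k)) ->
    pw_int (fun k => partial m (fun x => z k x * phi x)) =
    - orient v * \sum_j det2 (delta_mx m 0) (v j - c) *
      line_int (fun x => jump z j x * phi x) c (v j).
  move=> sz; rewrite (pw_green hv hc); last 2 first.
  - by move=> k; apply: CnM.
  - by move=> k x hx; rewrite (v0 _ _ hx) mulr0.
  congr (_ * _); apply: eq_bigr => j _; congr (_ * _); rewrite -line_intB.
  - by congr line_int; apply/funext => x; rewrite /jump mulrBl.
  - exact: (contM (Cn_continuous (sz (ordS j) 0)) (Cn_continuous (sphi 0))).
  - exact: (contM (Cn_continuous (sz (ordS (ordS j)) 0)) (Cn_continuous (sphi 0))).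
have i5 : pw_int A5 = - orient v * \sum_j det2 (delta_mx 1 0) (v j - c) *
    line_int (fun x => jump z1 j x * phi x) c (v j) by rewrite EA5; exact: (gz z1 1 sz1).
have i6 : pw_int A6 = - orient v * \sum_j det2 (delta_mx 0 0) (v j - c) *
    line_int (fun x => jump z0 j x * phi x) c (v j) by rewrite EA6; exact: (gz z0 0 sz0).
rewrite i5 i6 -mulrDr -big_split -mulNr opprK; congr (_ * _).
apply: eq_bigr => j _ /=.
have cJ (z : 'I_3 -> plane -> R) : (forall k n, Cn n (z k)) -> continuous (fun x => jump z j x * phi x).
  move=> sz; apply: (@Cn_continuous _ 0); apply: CnM => //; exact: CnB.
have -> : det2 (delta_mx 1 0) (v j - c) = - (v j - c) 0 0.
  by rewrite /det2 mxE [X in _ - X * _]mxE /=; ring.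
have -> : det2 (delta_mx 0 0) (v j - c) = (v j - c) 1 0.
  by rewrite /det2 mxE [X in _ - X * _]mxE /=; ring.
rewrite mulNr addrC -!line_intZ; [|exact: cJ|exact: cJ].
rewrite -line_intB; last 2 first.
- by apply: contM; [exact: cst_continuous|exact: cJ].
- by apply: contM; [exact: cst_continuous|exact: cJ].
congr line_int; apply/funext => x; rewrite /conormal /jump /z0 /z1.
by gen_partial => *; ring.
Qed.

End SplitDistribution.

(** * Test functions that concentrate on a segment or inside a piece *)

Section Concentration.
Variable R : realType.
Local Notation plane := (plane R).
Local Notation leb := (@lebesgue_measure R).
Local Notation leb2 := (@lebesgue_measure R \x @lebesgue_measure R)%E.
Local Notation mR := (measurableTypeR R).

(** The primitive is squeezed between 0 and the full integral, so it is 0 on the open interval, and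
    so is its derivative [f]. *)
Lemma continuous_int0 (f : R -> R) : continuous f -> (forall t, 0 <= f t) ->
  \int[leb]_(t in `[0, 1]) f t = 0 -> forall t, 0 < t < 1 -> f t = 0.
Proof.
move=> cf f0 I0 t /andP[t0 t1].
have intf a b : leb.-integrable `[a, b] (EFin \o f) by apply: continuous_integrable.
pose G x := \int[leb]_(s in `[0, x]) f s.
have G0 x : 0 < x < 1 -> G x = 0.
  move=> /andP[x0 x1]; apply/eqP; rewrite eq_le; apply/andP; split; last first.
    by apply: Rintegral_ge0 => s _.
  have := @Rintegral_itvB R f (BLeft 0) (BRight 1) x (intf 0 1).
  rewrite !bnd_simp (ltW x0) (ltW x1) => /(_ isT isT) E.
  rewrite -subr_ge0 sub0r; apply: (@le_trans _ _ (\int[leb]_(s in `]x, 1]) f s)).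
    by apply: Rintegral_ge0 => s _.
  by rewrite -E I0 sub0r.
have [_ <-] := continuous_FTC1_closed t1 (intf 0 1) t0 (cf t).
suff H : is_derive t 1 G (0 : R) by rewrite derive1E derive_val.
apply: (@near_eq_is_derive R R^o R^o (fun=> 0 : R)).
near=> s; symmetry; apply: G0; apply/andP; split; near: s; [exact: lt_nbhsr|exact: lt_nbhsl].
Unshelve. all: by end_near.
Qed.

(** An affine change of variables of determinant -1 turns the affine form into the second
    coordinate, and the axis [y = 0] is null by Tonelli. *)
Lemma line_negligible (a b e : R) : (a != 0) || (b != 0) ->
  leb2 [set p : mR * mR | a * p.1 + b * p.2 + e = 0] = 0%E.
Proof.
move=> ab; set A := [set p | _].
have mA : measurable A.
  rewrite (_ : A = (fun p : mR * mR => (a * p.1 + b * p.2 + e : mR)) @^-1` [set 0]) //.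
  by rewrite -[X in measurable X]setTI; apply: (@measurable_affine R).
pose n := a ^+ 2 + b ^+ 2.
have n0 : n != 0.
  apply: lt0r_neq0; rewrite /n; case/orP: ab => h.
    by rewrite ltr_pwDl ?sqr_ge0// lt_neqAle sqr_ge0 eq_sym sqrf_eq0 h.
  by rewrite ltr_wpDl ?sqr_ge0// lt_neqAle sqr_ge0 eq_sym sqrf_eq0 h.
have D : - b * (b / n) - (a / n) * a = -1.
  by move: n0; rewrite /n => n0; field.
rewrite -[A]setIT -integral_indic//.
rewrite (@ge0_integral_affine2 R (- b) (a / n) (- e * a / n) a (b / n) (- e * b / n)).
- rewrite [X in (_ * X)%E](_ : _ = 0%E) ?mule0//.
  rewrite (eq_integral (fun p : mR * mR => (\1_([set 0] : set mR) p.2)%:E)); last first.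
    move=> [x y] _ /=; rewrite !indicE; congr ((_ : bool)%:R%:E).
    have E : a * (- b * x + a / n * y + - e * a / n) + b * (a * x + b / n * y + - e * b / n) + e = y.
      by move: n0; rewrite /n => n0; field.
    by apply/idP/idP; rewrite !inE /A /= E.
  rewrite fubini_tonelli1; last 2 first.
  - apply/measurable_EFinP; apply: measurableT_comp; last exact: measurable_snd.
    exact: measurable_indic.
  - by move=> p; rewrite lee_fin.
  apply: integral0_eq => x _; rewrite /fubini_F /=.
  rewrite integral_indic// setIT; exact: lebesgue_measure_set1.
- by rewrite D oppr_eq0 oner_neq0.
- by apply/measurable_EFinP; exact: measurable_indic.
- by move=> p; rewrite lee_fin.
Qed.

(** Dominated convergence: the functions are uniformly bounded and, at each point off one line,
    eventually 0. *)
Lemma plane_int_concentrate (D : set plane) (f : plane -> R) (phi : nat -> plane -> R)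
    (M a b e : R) : measurable (@pt R @^-1` D : set (mR * mR)) ->
  plane_integrable D f -> (forall n, continuous (phi n)) -> (a != 0) || (b != 0) ->
  (forall n (x : plane), `|phi n x| <= M) ->
  (forall x : plane, a * x 0 0 + b * x 1 0 + e != 0 -> \forall n \near \oo, phi n x = 0) ->
  plane_int D (fun x => f x * phi n x) @[n --> \oo] --> 0.
Proof.
move=> mD intf cphi ab phiM phi0.
have mphi n : measurable_fun (@pt R @^-1` D : set (mR * mR)) (fun p => (phi n (pt p))).
  by apply: measurable_funTS; exact: measurable_continuous_pt.
have mf : measurable_fun (@pt R @^-1` D : set (mR * mR)) (fun p => (f (pt p))).
  by apply/measurable_EFinP; case/integrableP: intf.
suff H : (\int[leb2]_(p in @pt R @^-1` D) ((f (pt p) * phi n (pt p))%:E) @[n --> \oo] --> 0)%E.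
  by apply: fine_cvg.
have M0 : 0 <= M by apply: le_trans (phiM 0%N 0).
have := @dominated_convergence _ _ _ leb2 (@pt R @^-1` D : set (mR * mR)) mD
  (fun n p => (f (pt p) * phi n (pt p))%:E) (cst 0%E)
  (fun p => (M%:E * `|(f (pt p))%:E|)%E).
case.
- by move=> n; apply/measurable_EFinP; apply: measurable_funM.
- exact: measurable_cst.
- exists [set p : mR * mR | a * p.1 + b * p.2 + e = 0]; split.
  + rewrite (_ : [set _ | _] = (fun p : mR * mR => (a * p.1 + b * p.2 + e : mR)) @^-1` [set 0]) //.
    by rewrite -[X in measurable X]setTI; apply: (@measurable_affine R).
  + exact: line_negligible.
  + move=> p /= hp; apply: contrapT => /eqP hp0; apply: hp => Dp.
    apply: cvg_near_cst; have := phi0 (pt p); rewrite !mxE /= => /(_ hp0).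
    by apply: filterS => n ->; rewrite mulr0.
- by apply: integrableZl => //; exact: integrable_abse.
- apply: aeW => p n Dp; rewrite /= lee_fin normrM mulrC.
  by rewrite ler_wpM2r.
by move=> _ _; rewrite integral0.
Qed.

End Concentration.

Section Bumps.
Variable R : realType.
Local Notation plane := (plane R).
Local Notation leb := (@lebesgue_measure R).

Definition bump (a b y : R) : R := flat 0 (y - a) * flat 0 (b - y).

Lemma bump_ge0 a b y : 0 <= bump a b y.
Proof. by rewrite mulr_ge0 ?flat_ge0. Qed.

Lemma bump_le1 a b y : bump a b y <= 1.
Proof. by rewrite mulr_ile1 ?flat_ge0 ?flat0_le1. Qed.

Lemma bump_gt0 a b y : a < y -> y < b -> 0 < bump a b y.
Proof. by move=> h1 h2; rewrite mulr_gt0// flat0_gt0 ?subr_gt0. Qed.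

Lemma bump_out a b y : (y <= a) || (b <= y) -> bump a b y = 0.
Proof.
rewrite /bump => /orP[] h; first by rewrite flat_le0 ?subr_le0// mul0r.
by rewrite [flat 0 (b - y)]flat_le0 ?subr_le0// mulr0.
Qed.

Lemma bump_neq0 a b y : bump a b y != 0 -> a < y < b.
Proof.
move=> h; rewrite !ltNge; apply/andP; split; apply: contra h => h; apply/eqP/bump_out;
by rewrite h ?orbT.
Qed.

Lemma affine_comb (l1 l2 : plane -> R) (p q r : R) : affine_fun l1 -> affine_fun l2 ->
  affine_fun (fun x => p * l1 x + q * l2 x + r).
Proof.
move=> [a1 [b1 [e1 h1]]] [a2 [b2 [e2 h2]]].
exists (p * a1 + q * a2), (p * b1 + q * b2), (p * e1 + q * e2 + r).
by move=> x; rewrite h1 h2; ring.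
Qed.

Lemma Cn_bump n (a b : R) (l : plane -> R) : affine_fun l -> Cn n (fun x => bump a b (l x)).
Proof.
move=> hl; apply: CnM; apply: Cn_flat.
- have [p [q [r h]]] := hl; exists p, q, (r - a) => x; rewrite h; ring.
- have [p [q [r h]]] := hl; exists (- p), (- q), (b - r) => x; rewrite h; ring.
Qed.

Lemma continuous_affine (l : plane -> R) : affine_fun l -> continuous l.
Proof. by move=> hl; exact: (Cn_continuous (Cn_affine 0 hl)). Qed.

Lemma closed_affine_itv (l : plane -> R) (a b : R) : affine_fun l ->
  closed [set x | a <= l x <= b].
Proof.
move=> hl; rewrite (_ : [set x | _] = l @^-1` [set` `[a, b]]).
  by apply: closed_comp; [move=> x _; exact: continuous_affine|exact: itv_closed].
by apply/seteqP; split => x /=; rewrite in_itv.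
Qed.

Lemma flat_continuous n : continuous (@flat R n).
Proof.
by move=> y; apply/differentiable_continuous/derivable1_diffP; case: (is_derive_flat n y).
Qed.

Lemma bump_continuous (a b : R) : continuous (bump a b).
Proof.
move=> y; apply: (@continuousM _ R^o (fun y => flat 0 (y - a)) (fun y => flat 0 (b - y))).
- apply: (continuous_comp (f := fun y : R => y - a)); last exact: flat_continuous.
  by apply: cvgB; [exact: cvg_id|exact: cvg_cst].
- apply: (continuous_comp (f := fun y : R => b - y)); last exact: flat_continuous.
  by apply: cvgB; [exact: cvg_cst|exact: cvg_id].
Qed.

Lemma bump_int_gt0 (a b : R) : 0 <= a -> a < b -> b <= 1 ->
  0 < \int[leb]_(t in `[0, 1]) bump a b t.
Proof.
move=> a0 ab b1; rewrite lt_neqAle Rintegral_ge0 ?andbT; last by move=> *; exact: bump_ge0.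
apply/eqP => /esym I0; have := continuous_int0 (@bump_continuous a b) (bump_ge0 a b) I0.
move=> /(_ ((a + b) / 2)); have := @bump_gt0 a b ((a + b) / 2).
move=> h1 h2; have : 0 < bump a b ((a + b) / 2) by apply: h1; lra.
by rewrite h2 ?ltxx//; apply/andP; split; lra.
Qed.

Variables (v : 'I_3 -> plane) (c : plane).
Hypothesis hv : area v != 0.
Hypothesis hc : forall l, 0 < lam v l c.
Local Notation lam := (lam v).
Local Notation K := (K v c).

(** A product of bumps in the coordinates [s] and [t] of [K k] belonging to its two outer vertices.
    On the other pieces one of these coordinates is at most 0. It serves to read off the value of a
    piecewise constant sven on [K k]. *)
Lemma bump_K k : exists phi, [/\ test_function (T v) phi,
  forall l x, l != k -> K l x -> phi x = 0 & 0 < plane_int (K k) phi].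
Proof.
have [n1 n2 n3 n4 [n5 n6]] := ordS_neq k.
have c0 := hc k; have c1 := hc (ordS k); have c2 := hc (ordS (ordS k)).
pose co l x := 1 * lam l x + (- (lam l c / lam k c)) * lam k x + 0.
have aco l : affine_fun (co l) by apply: affine_comb; exact: lam_affine.
have coK l x : co l x * lam k c = lam l x * lam k c - lam l c * lam k x.
  by rewrite /co; field; rewrite gt_eqF.
pose s := co (ordS k); pose t := co (ordS (ordS k)).
have st x : lam k x = lam k c * (1 - s x - t x).
  have E1 := lam_sum hv k x; have E2 := lam_sum hv k c.
  have : (s x + t x) * lam k c = lam k c - lam k x.
    rewrite mulrDl !coK.
    have -> : lam (ordS (ordS k)) x = 1 - lam k x - lam (ordS k) x by lra.
    have -> : lam (ordS (ordS k)) c = 1 - lam k c - lam (ordS k) c by lra.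
    by ring.
  by move=> E; rewrite (_ : 1 - s x - t x = 1 - (s x + t x)); [rewrite mulrBr mulr1 [lam k c * _]mulrC E; ring|ring].
(* What matters is [0 < a < b] and [2 * b < 1]: then [s], [t] and [1 - s - t] are positive on the
   support. *)
pose a : R := 1 / 8; pose b : R := 1 / 4.
pose phi x := bump a b (s x) * bump a b (t x).
exists phi; split.
- apply: (@test_function_closed _ _ ([set x | a <= s x <= b] `&` [set x | a <= t x <= b])).
  + by move=> n; apply: CnM; apply: Cn_bump; exact: aco.
  + by apply: closedI; apply: closed_affine_itv; exact: aco.
  + move=> x [/= /andP[s1 s2] /andP[t1 t2]]; apply/(hull_interior hv).
    move: s1 s2 t1 t2; rewrite /a /b => s1 s2 t1 t2.
    have lk : 0 < lam k x by rewrite st mulr_gt0//; lra.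
    apply: (ordS_all (k := k)) => //.
    * have := coK (ordS k) x => E; have : 0 < lam (ordS k) x * lam k c.
        have : 0 < s x * lam k c by rewrite mulr_gt0//; lra.
        by rewrite E => h; have := mulr_gt0 c1 lk; lra.
      by rewrite pmulr_lgt0.
    * have := coK (ordS (ordS k)) x => E; have : 0 < lam (ordS (ordS k)) x * lam k c.
        have : 0 < t x * lam k c by rewrite mulr_gt0//; lra.
        by rewrite E => h; have := mulr_gt0 c2 lk; lra.
      by rewrite pmulr_lgt0.
  + by move=> x; rewrite mulf_eq0 negb_or => /andP[/bump_neq0/andP[h1 h2] /bump_neq0/andP[h3 h4]];
      split; rewrite /= !ltW.
- move=> l x lk; case: (ordS_cases k l) lk => -> lk; first by rewrite eqxx in lk.
  + move=> /(K_lam hv hc) [_ _]; rewrite ordS3 => h.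
    rewrite /phi bump_out ?mul0r//; apply/orP; left.
    suff : s x * lam k c <= 0 by rewrite pmulr_lle0// /a; lra.
    by rewrite coK; have := h; rewrite mulrC [X in _ <= X]mulrC; lra.
  + move=> /(K_lam hv hc) [_]; rewrite ordS3 => h _.
    rewrite /phi [bump a b (t x)]bump_out ?mulr0//; apply/orP; left.
    suff : t x * lam k c <= 0 by rewrite pmulr_lle0// /a; lra.
    by rewrite coK; have := h; rewrite mulrC [X in _ <= X]mulrC; lra.
pose B := \int[leb]_(t in `[0, 1]) bump a b t.
have B0 : 0 < B by apply: bump_int_gt0; rewrite /a /b; lra.
rewrite K_tri plane_int_tri//; [|exact: area_K_neq0|]; last first.
  have h : Cn 0 phi by apply: CnM; apply: Cn_bump; exact: aco.
  exact: (Cn_continuous h).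
apply: mulr_gt0; first by rewrite normr_gt0 area_K_neq0.
(* For [t'] below [b] the range [[0, 1 - t']] contains the support of the bump in [s], so the double
   integral factors. *)
rewrite (_ : Rintegral _ _ _ = B * B) ?mulr_gt0//.
have cb : leb.-integrable `[0, 1] (EFin \o bump a b).
  by apply: continuous_integrable; exact: bump_continuous.
transitivity (\int[leb]_(t in `[0, 1]) (B * bump a b t)); last by rewrite RintegralZl.
apply: eq_Rintegral => t'; rewrite inE /= in_itv /= => /andP[t0 t1].
have phiE s' : phi (par c (v (ordS k)) (v (ordS (ordS k))) s' t') = bump a b s' * bump a b t'.
  rewrite /phi; congr (bump a b _ * bump a b _); rewrite /s /t /co !(lam_par hv) !(lam_v hv) ?eqxx ?n3 ?n4 ?n5 ?n6 ?mulr1n ?mulr0n;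
  by field; rewrite gt_eqF.
under eq_Rintegral => s' _ do rewrite phiE.
rewrite RintegralZr//; last by apply: continuous_integrable; exact: bump_continuous.
have [->|/bump_neq0/andP[_ tb]] := eqVneq (bump a b t') 0; first by rewrite !mulr0.
congr (_ * _); apply/eqP; rewrite -subr_eq0 -oppr_eq0 opprB.
have := @Rintegral_itvB R (bump a b) (BLeft 0) (BRight 1) (1 - t') cb.
rewrite !bnd_simp => ->; [|lra|lra].
apply/eqP; transitivity (\int[leb]_(s in `](1 - t'), 1]) (0 : R)).
  apply: eq_Rintegral => s'; rewrite inE /= in_itv /= => /andP[h1 h2].
  by apply: bump_out; apply/orP; right; move: tb; rewrite /b; lra.
by rewrite Rintegral_cst// mul0r.
Qed.

End Bumps.

Section EdgeJump.
Variable R : realType.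
Local Notation plane := (plane R).
Local Notation mR := (measurableTypeR R).
Variables (v : 'I_3 -> plane) (c : plane).
Hypothesis hv : area v != 0.
Hypothesis hc : forall l, 0 < lam v l c.
Local Notation lam := (lam v).
Local Notation K := (K v c).
Local Notation pw_int := (pw_int v c).

Lemma affine_lam (l : plane -> R) x : affine_fun l ->
  l x = lam 0 x * l (v 0) + lam (ordS 0) x * l (v (ordS 0)) +
    lam (ordS (ordS 0)) x * l (v (ordS (ordS 0))).
Proof.
move=> [p [q [r h]]]; rewrite !h {1 2}(lam_pt hv 0 x) !mxE.
rewrite -[r in LHS]mulr1 -(lam_sum hv 0 x); ring.
Qed.

Lemma bump_norm (a b y : R) : `|bump a b y| <= 1.
Proof. by rewrite ger0_norm ?bump_ge0// bump_le1. Qed.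

(* Test functions concentrating at a point of the edge separate the line integrals
   from the area integrals. *)
Lemma edge_jump_zero (f : plane -> R) (q : 'I_3 -> R) (J : 'I_3 -> plane -> R) (rho : R) :
  plane_integrable (T v) f -> (forall j, affine_fun (J j)) -> rho != 0 ->
  (forall phi, test_function (T v) phi ->
    pw_int (fun k x => q k * phi x) + rho * \sum_j line_int (fun x => J j x * phi x) c (v j) =
    plane_int (T v) (fun x => f x * phi x)) ->
  forall j, J j c = 0 /\ J j (v j) = 0.
Proof.
move=> intf aJ rho0 E j.
have [n1 n2 n3 n4 [n5 n6]] := ordS_neq j.
have c0 := hc j; have c1 := hc (ordS j); have c2 := hc (ordS (ordS j)).
set j' := ordS j in n1 n3 n5 n6 c1 *; set j'' := ordS j' in n2 n4 n5 n6 c2 *.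
have S2 : lam j c + lam j' c + lam j'' c = 1 by exact: lam_sum.
pose w := lam j' c + lam j'' c.
have w0 : 0 < w by rewrite /w addr_gt0.
have cw : lam j c = 1 - w by rewrite /w -S2; ring.
(* [s] runs from 0 at [c] to 1 at [v j] along the segment, and [r] is a transverse coordinate that
   vanishes on the line through them. *)
pose s x := w^-1 * lam j x + 0 * lam j x + (- (lam j c / w)).
pose r x := 1 * lam j'' x + lam j'' c * s x + (- lam j'' c).
have as_ : affine_fun s by apply: affine_comb; exact: lam_affine.
have ar : affine_fun r by apply: affine_comb => //; exact: lam_affine.
have sE x : lam j x = lam j c + s x * w by rewrite /s; field; rewrite gt_eqF.
have rE x : lam j'' x = lam j'' c * (1 - s x) + r x by rewrite /r; ring.
have rE' x : lam j' x = lam j' c * (1 - s x) - r x.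
  have -> : lam j' x = 1 - lam j x - lam j'' x by rewrite -(lam_sum hv j x) -/j' -/j''; ring.
  by rewrite sE rE cw /w; ring.
(* The offset makes [N n * lam j' c] and [N n * lam j'' c] at least 8. As [1 - s] is at least 1/4 on
   the support, the resulting 2 outweighs [N n * r], of modulus at most 1, and the support stays
   inside [T]. *)
pose nu0 : R := 8 / lam j' c + 8 / lam j'' c.
pose N n : R := n%:R + nu0.
have N1 n : 8 <= N n * lam j' c.
  rewrite /N /nu0 !mulrDl (divfK (lt0r_neq0 c1)).
  have h1 : 0 <= n%:R * lam j' c by rewrite mulr_ge0// ltW.
  have h2 : 0 <= 8 / lam j'' c * lam j' c by apply: mulr_ge0; [apply: divr_ge0; [exact: ler0n|exact: ltW]|exact: ltW].
  lra.
have N2 n : 8 <= N n * lam j'' c.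
  rewrite /N /nu0 !mulrDl (divfK (lt0r_neq0 c2)).
  have h1 : 0 <= n%:R * lam j'' c by rewrite mulr_ge0// ltW.
  have h2 : 0 <= 8 / lam j' c * lam j'' c by apply: mulr_ge0; [apply: divr_ge0; [exact: ler0n|exact: ltW]|exact: ltW].
  lra.
have N0 n : 0 < N n.
  by have := N1 n; have := c1; move: (N n) (lam j' c) => x y; nra.
pose a : R := 1 / 4; pose b : R := 3 / 4.
(* The factor [J j] makes the line integral that of a square against nonnegative bumps; the strip
   narrows around the segment as [n] grows. *)
pose phi n x := J j x * (bump a b (s x) * bump (-1) 1 (N n * r x)).
have aNr n : affine_fun (fun x => N n * r x).
  have [p1 [p2 [p3 h]]] := ar; exists (N n * p1), (N n * p2), (N n * p3) => x; rewrite h; ring.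
have sphi n : smooth (phi n).
  by move=> m; apply: CnM; [exact: Cn_affine|apply: CnM; exact: Cn_bump].
have supp n x : a <= s x <= b -> -1 <= N n * r x <= 1 -> forall l, 0 < lam l x.
  rewrite /a /b => /andP[s1 s2] /andP[r1 r2]; apply: (ordS_all (k := j)); rewrite -?/j' -?/j''.
  - rewrite sE; have : 0 < s x * w by rewrite mulr_gt0//; lra.
    by lra.
  - rewrite rE' -(pmulr_rgt0 _ (N0 n)) mulrBr mulrA.
    have : 8 * (1 - s x) <= N n * lam j' c * (1 - s x) by apply: ler_wpM2r => //; lra.
    by lra.
  - rewrite rE -(pmulr_rgt0 _ (N0 n)) mulrDr mulrA.
    have : 8 * (1 - s x) <= N n * lam j'' c * (1 - s x) by apply: ler_wpM2r => //; lra.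
    by lra.
have tphi n : test_function (T v) (phi n).
  apply: (@test_function_closed _ _ ([set x | a <= s x <= b] `&` [set x | -1 <= N n * r x <= 1])) => //.
  - by apply: closedI; apply: closed_affine_itv.
  - by move=> x [/= h1 h2]; apply/(hull_interior hv); exact: supp h1 h2.
  - move=> x; rewrite mulf_eq0 negb_or => /andP[_]; rewrite mulf_eq0 negb_or.
    move=> /andP[/bump_neq0/andP[h1 h2] /bump_neq0/andP[h3 h4]].
    by split; rewrite /= !ltW.
pose M := `|J j (v 0)| + `|J j (v (ordS 0))| + `|J j (v (ordS (ordS 0)))|.
have phiM n x : `|phi n x| <= M.
  have M0 : 0 <= M by rewrite /M !addr_ge0.
  rewrite /phi normrM.
  have [->|h] := eqVneq (bump a b (s x) * bump (-1) 1 (N n * r x)) 0; first by rewrite normr0 mulr0.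
  have := h; rewrite mulf_eq0 negb_or => /andP[/bump_neq0/andP[h1 h2] /bump_neq0/andP[h3 h4]].
  have lx l : 0 < lam l x by apply: (supp n); rewrite !ltW.
  have lx1 l : lam l x <= 1.
    have : lam l x + lam (ordS l) x + lam (ordS (ordS l)) x = 1 by exact: lam_sum.
    by have := lx (ordS l); have := lx (ordS (ordS l)); lra.
  rewrite -[X in _ <= X]mulr1; apply: ler_pM => //; last first.
    by rewrite normrM mulr_ile1// ?bump_norm.
  rewrite (affine_lam x (aJ j)) /M; apply: le_trans (ler_normD _ _) _; apply: lerD.
    apply: le_trans (ler_normD _ _) _; apply: lerD; rewrite normrM ler_piMl// ger0_norm// ltW//.
  by rewrite normrM ler_piMl// ger0_norm// ltW.
have [p1 [p2 [p3 rp]]] := ar.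
have pn0 : (p1 != 0) || (p2 != 0).
  rewrite -negb_and; apply/negP => /andP[/eqP p10 /eqP p20].
  have e1 : r c = p3 by rewrite rp p10 p20; ring.
  have e2 : r (v j'') = p3 by rewrite rp p10 p20; ring.
  have sc : s c = 0 by rewrite /s; field; rewrite gt_eqF.
  have sv : s (v j'') = - (lam j c / w) by rewrite /s (lam_v hv) n4 mulr0n; ring.
  have rc : r c = 0 by rewrite /r sc; ring.
  have rv : r (v j'') = lam j' c / w.
    rewrite /r sv (lam_v hv) eqxx mulr1n cw /w; field.
    by rewrite -/w gt_eqF.
  have : 0 < r (v j'') by rewrite rv divr_gt0.
  by rewrite e2 -e1 rc ltxx.
have phi0 (x : plane) : p1 * x 0 0 + p2 * x 1 0 + p3 != 0 -> \forall n \near \oo, phi n x = 0.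
  rewrite -rp => rx; near=> n.
  rewrite /phi [bump (-1) _ _]bump_out ?mulr0//.
  have h : `|r x|^-1 <= N n.
    apply: le_trans (_ : n%:R <= _); last by rewrite lerDl addr_ge0// divr_ge0// ltW.
    by near: n; exact: nbhs_infty_ger.
  have {h} h : 1 <= N n * `|r x|.
    by rewrite -(mulVf (_ : `|r x| != 0)) ?normr_eq0// ler_wpM2r.
  have [r0|r0] := leP 0 (r x).
    by apply/orP; right; move: h; rewrite ger0_norm.
  by apply/orP; left; move: h; rewrite ltr0_norm// mulrN; lra.
have cphi n : continuous (phi n) by exact: (Cn_continuous (sphi n 0)).
have mT : measurable (@pt R @^-1` (T v) : set (mR * mR)).
  by rewrite /T (hull_tri v 0); apply: measurable_tri; rewrite -areaE.
have L1 := plane_int_concentrate mT intf cphi pn0 phiM phi0.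
have intq k : plane_integrable (K k) (fun=> q k).
  by apply: integrable_K => //; exact: cst_continuous.
have L2 k := plane_int_concentrate (measurable_K hv hc k) (intq k) cphi pn0 phiM phi0.
(* The line integral is independent of [n] because [r] is 0 on the [j]-th segment; on the other two
   segments [s] is at most 0 and the bump in [s] vanishes. *)
pose kappa := line_int (fun x => J j x * (J j x * (bump a b (s x) * bump (-1) 1 0))) c (v j).
have Ek n : \sum_l line_int (fun x => J l x * phi n x) c (v l) = kappa.
  rewrite (sum3 _ j) -/j' -/j''.
  have zz l : l != j -> line_int (fun x => J l x * phi n x) c (v l) = 0.
    move=> lj; apply: line_int0 => t /andP[t0 t1].
    rewrite /phi [bump a _ _]bump_out ?mul0r ?mulr0//; apply/orP; left.
    rewrite (_ : c + _ = par c (v l) c t 0); last by rewrite /par scale0r addr0.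
    rewrite /s (lam_par hv) (lam_v hv) eq_sym (negbTE lj) mulr0n.
    have h0 : 0 <= t * lam j c / w by apply: divr_ge0; [apply: mulr_ge0|]; rewrite // ltW.
    apply: (@le_trans _ _ (- (t * lam j c / w))); last by rewrite /a; lra.
    by rewrite le_eqVlt; apply/orP; left; apply/eqP; ring.
  rewrite (zz j') ?n1// (zz j'') ?n2// !addr0; apply: eq_Rintegral => t _.
  set x := _ + _; rewrite /phi.
  have -> : r x = 0; last by rewrite mulr0.
  have xE : x = par c (v j) c t 0 by rewrite /par scale0r addr0.
  rewrite /r /s xE !(lam_par hv) !(lam_v hv) eqxx n2 mulr1n mulr0n cw; field.
  by rewrite gt_eqF.
have L3 : pw_int (fun k x => q k * phi n x) @[n --> \oo] --> 0.
  pose A k n := plane_int (K k) (fun x => q k * phi n x).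
  have -> : (fun n => pw_int (fun k x => q k * phi n x)) =
     (fun n => A 0 n + A (ordS 0) n + A (ordS (ordS 0)) n).
    by apply/funext => n; rewrite /Defs.pw_int (sum3 _ 0).
  have := cvgD (cvgD (L2 0) (L2 (ordS 0))) (L2 (ordS (ordS 0))).
  by rewrite !addr0; exact.
have kap0 : kappa = 0.
  have H : (fun n => plane_int (T v) (fun x => f x * phi n x) - pw_int (fun k x => q k * phi n x))
     = (fun=> rho * kappa).
    by apply/funext => n; rewrite -(E _ (tphi n)) Ek; ring.
  have L4 := cvgB L1 L3; rewrite subr0 in L4.
  have L5 : (rho * kappa : R) @[n --> \oo] --> (0 : R) by rewrite -H; exact: L4.
  have e : rho * kappa = 0.
    by apply: (cvg_unique _ _ L5); [exact: norm_hausdorff|exact: cvg_cst].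
  by move/eqP: e; rewrite mulf_eq0 (negbTE rho0) => /eqP.
have sline t : s (c + t *: (v j - c)) = t.
  rewrite (_ : c + _ = par c (v j) c t 0); last by rewrite /par scale0r addr0.
  by rewrite /s (lam_par hv) (lam_v hv) eqxx mulr1n cw; field; rewrite gt_eqF.
have b10 : 0 < bump (-1) 1 (0 : R) by apply: bump_gt0; lra.
pose g t := J j (c + t *: (v j - c)).
have g0 t : a < t < b -> g t = 0.
  move=> /andP[at_ tb].
  pose G t := J j (c + t *: (v j - c)) * (J j (c + t *: (v j - c)) *
     (bump a b (s (c + t *: (v j - c))) * bump (-1) 1 0)).
  have cG : continuous G.
    apply: (line_continuous (F := fun x => J j x * (J j x * (bump a b (s x) * bump (-1) 1 0)))).
    apply: (@Cn_continuous _ 0); apply: CnM; first exact: Cn_affine.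
    apply: CnM; first exact: Cn_affine.
    by apply: CnM; [exact: Cn_bump|exact: Cn_cst].
  have G0 t' : 0 <= G t'
    by rewrite /G mulrA; apply: mulr_ge0; [rewrite -expr2; exact: sqr_ge0|apply: mulr_ge0; exact: bump_ge0].
  have := continuous_int0 cG G0 kap0 (t := t); rewrite /G sline => H.
  have t01 : 0 < t < 1 by move: at_ tb; rewrite /a /b => h1 h2; apply/andP; split; lra.
  have /eqP := H t01; rewrite [_ == 0]mulf_eq0 [X in _ || X]mulf_eq0 [bump a b t * _ == 0]mulf_eq0 (gt_eqF b10) (gt_eqF (bump_gt0 at_ tb)) !orbF orbb.
  by move=> /eqP.
have [a1 [a2 [a3 hJ]]] := aJ j.
have gaff t : g t = J j c + t * (J j (v j) - J j c) by rewrite /g !hJ !mxE; ring.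
(* Two zeros inside the range of the bump force the affine function [g] to vanish, in particular at
   0 and 1, which stand for [c] and [v j]. *)
have e1 : g (3 / 8) = 0 by apply: g0; rewrite /a /b; apply/andP; split; lra.
have e2 : g (5 / 8) = 0 by apply: g0; rewrite /a /b; apply/andP; split; lra.
by rewrite !gaff in e1 e2; split; lra.
Unshelve. all: by end_near.
Qed.

End EdgeJump.

(** * Unisolvence from explicit solvability *)

Section Unisolvence.
Variables (R : realType) (V : lmodType R) (A : set V).
Hypothesis A0_ : A 0.
Hypothesis Acomb : forall (a : R) u v, A u -> A v -> A (a *: u + v).

Lemma subspace_sum (I : Type) (r : seq I) (k : I -> R) (b : I -> V) :
  (forall i, A (b i)) -> A (\sum_(i <- r) k i *: b i).
Proof.
by move=> hb; elim/big_rec : _ => // i u _ hu; apply: Acomb.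
Qed.

(** Elements of [dual A] act on the subtype, which carries no vector space structure; partial sums
    are repacked as members of [A] before the linearity clause of [dual] applies. *)
Lemma dual_sum (g : A -> R^o) (I : Type) (r : seq I) (k : I -> R) (b : I -> A) (u : A) :
  dual A g -> val u = \sum_(i <- r) k i *: val (b i) -> g u = \sum_(i <- r) k i * g (b i).
Proof.
move=> hg; elim: r u => [|i r IH] u.
  rewrite !big_nil => u0; have := hg 1 u u u; rewrite scale1r u0 addr0 => /(_ erefl).
  by rewrite mul1r => /eqP; rewrite eq_sym -subr_eq0 addrK => /eqP.
rewrite !big_cons => E.
have hA : A (\sum_(j <- r) k j *: val (b j)).
  by apply: subspace_sum => j; exact: set_valP.
pose w : A := SigSub (mem_set hA).
by rewrite (hg (k i) (b i) w u) ?(IH w).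
Qed.

Variables (I : finType) (l : I -> V -> R).
Hypothesis llin : forall i (a : R) u v, A u -> A v -> l i (a *: u + v) = a * l i u + l i v.
Hypothesis linj : forall u, A u -> (forall i, l i u = 0) -> u = 0.
Hypothesis lsurj : forall k : I -> R, exists2 u, A u & forall i, l i u = k i.

Let l0 i : l i 0 = 0.
Proof.
have := llin i 1 A0_ A0_; rewrite scale1r addr0 mul1r => /eqP.
by rewrite eq_sym -subr_eq0 addrK => /eqP.
Qed.

Let lsum (J : Type) (r : seq J) (k : J -> R) (b : J -> V) i : (forall j, A (b j)) ->
  l i (\sum_(j <- r) k j *: b j) = \sum_(j <- r) k j * l i (b j).
Proof.
move=> hb; elim: r => [|j r IH]; first by rewrite !big_nil l0.
by rewrite !big_cons llin// ?IH//; exact: subspace_sum.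
Qed.

(** Surjectivity yields a family [b] biorthogonal to [l], and injectivity makes every [u] equal to
    its expansion along [b]. So [b] is a basis of [A] and [l] is its dual basis. *)
Lemma unisolvent_of_bij n : #|I| = n -> has_dim A n /\ unisolvent A l.
Proof.
move=> cI.
have /choice[b hb] : forall j, exists u, A u /\ forall i, l i u = (i == j)%:R.
  by move=> j; have [u hu hl] := lsurj (fun i => (i == j)%:R); exists u.
have bA j : A (b j) by case: (hb j).
have lb i j : l i (b j) = (i == j)%:R by case: (hb j).
have lcomb (k : I -> R) i : l i (\sum_j k j *: b j) = k i.
  rewrite lsum// (bigD1 i)//= lb eqxx mulr1 big1 ?addr0// => j ji.
  by rewrite lb eq_sym (negbTE ji) mulr0.
have expand u : A u -> u = \sum_j l j u *: b j.
  move=> hu; have hs : A (\sum_j l j u *: b j) by exact: subspace_sum.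
  apply/eqP; rewrite -subr_eq0; apply/eqP; rewrite addrC -scaleN1r; apply: linj; first exact: Acomb.
  by move=> i; rewrite llin// lcomb mulN1r addNr.
split.
- have card n' : n' = #|I| -> has_dim A n'.
    move=> ->; exists (fun i => b (enum_val i)).
    have E (d : {ffun 'I_#|I| -> R}) : \sum_i d i *: b (enum_val i) =
        \sum_j (fun j => d (enum_rank j)) j *: b j.
      rewrite (reindex (@enum_rank I)) /=; last by exists enum_val => i _; rewrite ?enum_valK ?enum_rankK.
      by apply: eq_bigr => j _; rewrite enum_rankK.
    split=> [d d' /=|].
      rewrite !E => H; apply/ffunP => i.
      have := congr1 (l (enum_val i)) H.
      by rewrite !(lcomb (fun j => _ (enum_rank j))) enum_valK.
    apply/seteqP; split=> [_ [d _ <-]|u hu]; first by rewrite E; exact: subspace_sum.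
    exists [ffun i => l (enum_val i) u] => //; rewrite E [RHS]expand//.
    by apply: eq_bigr => j _; rewrite ffunE enum_rankK.
  exact: card.
- pose B j : A := SigSub (mem_set (bA j)).
  split=> [d d' /= H|].
    apply/ffunP => i; have := congr1 (fun g : A -> R^o => g (B i)) H.
    have ev (k : {ffun I -> R}) : (\sum_j k j *: (fun u : A => l j (val u) : R^o) : A -> R^o) (B i) = k i.
      rewrite fct_sumE (bigD1 i)//= big1 ?addr0 => [|j ji].
        by rewrite -[LHS]/(k i * l i (b i)) lb eqxx mulr1.
      by rewrite -[LHS]/(k j * l j (b i)) lb (negbTE ji) mulr0.
    by rewrite !ev.
  apply/seteqP; split=> [_ [d _ <-]|g hg].
    move=> a u v w E; rewrite /= !fct_sumE.
    rewrite mulr_sumr -big_split; apply: eq_bigr => j _ /=.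
    rewrite -[LHS]/(d j * l j (val w)) E llin; [|exact: set_valP|exact: set_valP].
    by rewrite mulrDr mulrCA.
  exists [ffun j => g (B j)] => //; apply/funext => u /=; rewrite fct_sumE.
  rewrite (@dual_sum g I (index_enum I) (fun j => l j (val u)) B u hg).
    by apply: eq_bigr => j _; rewrite ffunE -[LHS]/(g (B j) * l j (val u)) mulrC.
  by apply: expand; exact: set_valP.
Qed.

End Unisolvence.

(** * Continuous piecewise quadratics and A0 *)

Section Quadratics.
Variable R : realType.
Local Notation plane := (plane R).
Implicit Types (f g : plane -> R) (x w : plane).

Lemma poly0P f : poly_fun 0 f <-> exists r, forall x, f x = r.
Proof.
split=> [[k h]|[r h]].
  by exists (k 0%N 0%N) => x; rewrite h !big_mkcond !big_ord_recl !big_ord0 /= big_mkcond big_ord_recl big_ord0 /= !expr0 !mulr1 !addr0.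
exists (fun _ _ => r) => x; rewrite h !big_ord_recl !big_ord0 big_mkcond !big_ord_recl !big_ord0 /= !expr0; ring.
Qed.

Lemma poly1P f : poly_fun 1 f <-> affine_fun f.
Proof.
split=> [[k h]|[p [q [r h]]]].
  exists (k 1%N 0%N), (k 0%N 1%N), (k 0%N 0%N) => x; rewrite h !big_ord_recl !big_ord0.
  by rewrite !(big_mkcond (fun _ => (_ <= _)%N)) !big_ord_recl !big_ord0 /= /bump /= !expr0 !expr1; ring.
exists (fun i j => match i, j with 0%N, 0%N => r | 1%N, 0%N => p | 0%N, 1%N => q | _, _ => 0 end) => x.
rewrite h !big_ord_recl !big_ord0.
by rewrite !(big_mkcond (fun _ => (_ <= _)%N)) !big_ord_recl !big_ord0 /= /bump /= !expr0 !expr1; ring.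
Qed.

Lemma poly2P f : poly_fun 2 f <-> exists r p q s t u, forall x,
  f x = r + p * x 0 0 + q * x 1 0 + s * x 0 0 ^+ 2 + t * (x 0 0 * x 1 0) + u * x 1 0 ^+ 2.
Proof.
split=> [[k h]|[r [p [q [s [t [u h]]]]]]].
  exists (k 0%N 0%N), (k 1%N 0%N), (k 0%N 1%N), (k 2 0%N), (k 1%N 1%N), (k 0%N 2) => x.
  rewrite h !big_ord_recl !big_ord0.
  by rewrite !(big_mkcond (fun _ => (_ <= _)%N)) !big_ord_recl !big_ord0 /= /bump /= !expr0 !expr1; ring.
exists (fun i j => match i, j with 0%N, 0%N => r | 1%N, 0%N => p | 0%N, 1%N => q
  | 2, 0%N => s | 1%N, 1%N => t | 0%N, 2 => u | _, _ => 0 end) => x.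
rewrite h !big_ord_recl !big_ord0.
by rewrite !(big_mkcond (fun _ => (_ <= _)%N)) !big_ord_recl !big_ord0 /= /bump /= !expr0 !expr1; ring.
Qed.

Lemma poly2D f g : poly_fun 2 f -> poly_fun 2 g -> poly_fun 2 (fun x => f x + g x).
Proof.
move=> /poly2P[r [p [q [s [t [u h]]]]]] /poly2P[r' [p' [q' [s' [t' [u' h']]]]]].
apply/poly2P; exists (r + r'), (p + p'), (q + q'), (s + s'), (t + t'), (u + u') => x.
rewrite h h'; ring.
Qed.

Lemma poly2Z k f : poly_fun 2 f -> poly_fun 2 (fun x => k * f x).
Proof.
move=> /poly2P[r [p [q [s [t [u h]]]]]].
apply/poly2P; exists (k * r), (k * p), (k * q), (k * s), (k * t), (k * u) => x.
rewrite h; ring.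
Qed.

Lemma poly2M f g : affine_fun f -> affine_fun g -> poly_fun 2 (fun x => f x * g x).
Proof.
move=> [p [q [r h]]] [p' [q' [r' h']]]; apply/poly2P.
exists (r * r'), (r * p' + r' * p), (r * q' + r' * q), (p * p'), (p * q' + p' * q), (q * q') => x.
rewrite h h'; ring.
Qed.

Lemma poly2_affine f : affine_fun f -> poly_fun 2 f.
Proof.
move=> [p [q [r h]]]; apply/poly2P; exists r, p, q, 0, 0, 0 => x; rewrite h; ring.
Qed.

Lemma poly2_sum (I : Type) (r : seq I) (F : I -> plane -> R) :
  (forall i, poly_fun 2 (F i)) -> poly_fun 2 (fun x => \sum_(i <- r) F i x).
Proof.
move=> hF; elim: r => [|i r IH].
  by apply/poly2P; exists 0, 0, 0, 0, 0, 0 => x; rewrite big_nil; ring.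
have := poly2D (hF i) IH; congr poly_fun; apply/funext => x; by rewrite big_cons.
Qed.

(** On quadratics the symmetric difference quotient with step 1 is exact, so later statements about
    derivatives become algebraic identities between values. *)
Lemma poly2_derive f x w : poly_fun 2 f -> is_derive x w f ((f (x + w) - f (x - w)) / 2).
Proof.
move=> /poly2P[r [p [q [s [t [u h]]]]]]; apply: is_deriveP.
(* [Q] is the quadratic part of [f] at [w]; the forward quotient with step [a] exceeds the symmetric
   one by [a * Q]. *)
pose Q := s * w 0 0 ^+ 2 + t * (w 0 0 * w 1 0) + u * w 1 0 ^+ 2.
have H : ((f (x + w) - f (x - w)) / 2 + a * Q) @[a --> (0 : R)^'] --> (f (x + w) - f (x - w)) / 2.
  have H2 : (a * Q) @[a --> (0 : R)^'] --> 0 * Q.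
    by apply: cvgM; [apply: cvg_within_filter; exact: cvg_id|exact: cvg_cst].
  by rewrite -[X in _ --> X]addr0 -[X in _ --> _ + X](mul0r Q); apply: cvgD => //; exact: cvg_cst.
apply: cvg_trans H; apply: near_eq_cvg; near=> a.
have a0 : a != 0 by near: a; exact: nbhs_dnbhs_neq.
by apply: (mulfI a0); rewrite -[_ *: _]/(_ * _) mulVKf// !h !mxE /Q; field.
Unshelve. all: by end_near.
Qed.

Lemma poly2_derive_val f x w : poly_fun 2 f -> 'D_w f x = (f (x + w) - f (x - w)) / 2.
Proof. by move=> h; have [_ ->] := poly2_derive x w h. Qed.

Lemma poly2_partial f x i : poly_fun 2 f ->
  partial i f x = (f (x + delta_mx i 0) - f (x - delta_mx i 0)) / 2.
Proof. exact: poly2_derive_val. Qed.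

Lemma poly2_partial_affine f i : poly_fun 2 f -> affine_fun (partial i f).
Proof.
move=> hf; have /poly2P[r [p [q [s [t [u h]]]]]] := hf.
pose e : plane := delta_mx i 0.
exists (2 * s * e 0 0 + t * e 1 0), (t * e 0 0 + 2 * u * e 1 0), (p * e 0 0 + q * e 1 0) => x.
by rewrite poly2_partial// !h -/e !mxE; field.
Qed.

Lemma poly2_Cn f n : poly_fun 2 f -> Cn n f.
Proof.
move=> /poly2P[r [p [q [s [t [u h]]]]]].
rewrite (_ : f = (fun x => r + p * x 0 0 + q * x 1 0 + s * (x 0 0 * x 0 0) +
  t * (x 0 0 * x 1 0) + u * (x 1 0 * x 1 0))).
  have h0 := @Cn_coord R n 0; have h1 := @Cn_coord R n 1; have hc := @Cn_cst R n.
  by apply: CnD; [apply: CnD; [apply: CnD; [apply: CnD; [apply: CnD|]|]|]|];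
    rewrite //; apply: CnM => //; apply: CnM.
by apply/funext => x; rewrite h.
Qed.

End Quadratics.

Section ScalarFamily.
Variable R : realType.
Local Notation plane := (plane R).
Variables (v : 'I_3 -> plane) (c : plane).
Hypothesis hv : area v != 0.
Hypothesis hc : forall l, 0 < lam v l c.
Local Notation lam := (lam v).

Definition evec (l : 'I_3) : plane := v (ordS (ordS l)) - v (ordS l).

Definition dlam (l : 'I_3) (w : plane) : R := det2 (evec l) w / area v.

Lemma lamD l x w : lam l (x + w) = lam l x + dlam l w.
Proof. by rewrite /lam /dlam /evec /det2 !mxE; ring. Qed.

Lemma lamB l x w : lam l (x - w) = lam l x - dlam l w.
Proof. by rewrite /lam /dlam /evec /det2 !mxE; ring. Qed.

Lemma dlam_sum k w : dlam k w + dlam (ordS k) w + dlam (ordS (ordS k)) w = 0.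
Proof. by rewrite /dlam /evec /det2 !ordS3 !mxE; ring. Qed.

Lemma cneq0 l : lam l c != 0. Proof. by rewrite gt_eqF. Qed.

Definition mu (k : 'I_3) (x : plane) : R := lam k x / lam k c.

(** The hierarchical form of a quadratic: [a l] is its value at [v l], and [b l] weighs the bubble
    of the edge opposite to [v l]. *)
Definition Pol (a b : 'I_3 -> R) (x : plane) : R :=
  \sum_l (a l * lam l x + b l * (lam (ordS l) x * lam (ordS (ordS l)) x)).

(* Vanishes on the boundary of [T], and is differentiable at [c] because there
   the jump of its gradient cancels against that of [mu]. *)
Definition Bub (k l : 'I_3) (x : plane) : R :=
  mu k x * (lam l x - lam l c / 2 * mu k x).

Definition Sf (a b g : 'I_3 -> R) (e : R) (k : 'I_3) (x : plane) : R :=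
  Pol a b x + \sum_l g l * Bub k l x + e * (mu k x * mu k x).

Lemma mu_affine k : affine_fun (mu k).
Proof.
have [p [q [r h]]] := lam_affine hv k.
by exists (p / lam k c), (q / lam k c), (r / lam k c) => x; rewrite /mu h; ring.
Qed.

Lemma Pol_poly2 a b : poly_fun 2 (Pol a b).
Proof.
apply: poly2_sum => l; apply: poly2D; apply: poly2Z.
  by apply: poly2_affine; exact: lam_affine.
by apply: poly2M; exact: lam_affine.
Qed.

Lemma Bub_poly2 k l : poly_fun 2 (Bub k l).
Proof.
apply: poly2M; first exact: mu_affine.
have [p [q [r h]]] := mu_affine k; have [p' [q' [r' h']]] := lam_affine hv l.
by exists (p' - lam l c / 2 * p), (q' - lam l c / 2 * q), (r' - lam l c / 2 * r) => x;
  rewrite h h'; ring.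
Qed.

Lemma Sf_poly2 a b g e k : poly_fun 2 (Sf a b g e k).
Proof.
apply: poly2D; first apply: poly2D; first exact: Pol_poly2.
- by apply: poly2_sum => l; apply: poly2Z; exact: Bub_poly2.
- by apply: poly2Z; apply: poly2M; exact: mu_affine.
Qed.

(** [b l] is minus the quadratic part of [f] at the edge vector opposite to [v l]; it measures the
    deviation of [f] from linear interpolation along that edge. *)
Lemma quad_bary f : poly_fun 2 f -> exists a b, forall x, f x = Pol a b x.
Proof.
move=> /poly2P[r [p [q [s [t [u h]]]]]].
pose X l := v l 0 0; pose Y l := v l 1 0.
pose a l := r + p * X l + q * Y l + s * X l ^+ 2 + t * (X l * Y l) + u * Y l ^+ 2.
pose b l := - (s * (X (ordS l) - X (ordS (ordS l))) ^+ 2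
  + t * ((X (ordS l) - X (ordS (ordS l))) * (Y (ordS l) - Y (ordS (ordS l))))
  + u * (Y (ordS l) - Y (ordS (ordS l))) ^+ 2).
exists a, b => x; rewrite h /Pol (sum3 _ 0) !ordS3.
have E0 := congr1 (fun y : plane => y 0 0) (lam_pt hv 0 x).
have E1 := congr1 (fun y : plane => y 1 0) (lam_pt hv 0 x).
rewrite !mxE in E0 E1; rewrite E0 E1 /a /b !ordS3 /X /Y.
have L : lam 0 x = 1 - lam (ordS 0) x - lam (ordS (ordS 0)) x by rewrite -(lam_sum hv 0 x); ring.
rewrite L; ring.
Qed.

Lemma lam_line l j t : lam l (c + t *: (v j - c)) = (1 - t) * lam l c + t * (l == j)%:R.
Proof.
rewrite (_ : c + _ = par c (v j) c t 0); last by rewrite /par scale0r addr0.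
by rewrite (lam_par hv) (lam_v hv); ring.
Qed.

Lemma mu_line k j t : k != j -> mu k (c + t *: (v j - c)) = 1 - t.
Proof.
by move=> kj; rewrite /mu lam_line (negbTE kj) mulr0n mulr0 addr0 mulfK// cneq0.
Qed.

Lemma ordS_neqs (j : 'I_3) : ordS j != j /\ ordS (ordS j) != j.
Proof. by have [n1 n2 _ _ _] := ordS_neq j; rewrite n1 n2. Qed.

Lemma Sf_edge_agree a b g e : edge_agree v c (Sf a b g e).
Proof.
move=> j t _; have [h1 h2] := ordS_neqs j.
rewrite /Sf !mu_line//; congr (_ + _ + _); apply: eq_bigr => l _.
by rewrite /Bub !mu_line.
Qed.

Lemma mu_v k l : k != l -> mu k (v l) = 0.
Proof. by move=> kl; rewrite /mu (lam_v hv) (negbTE kl) mul0r. Qed.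

Lemma affine_line0 (l : plane -> R) (p q : plane) :
  affine_fun l -> l (p + (1 / 2) *: (q - p)) = (l p + l q) / 2.
Proof. by move=> [a [b [e h]]]; rewrite !h !mxE; field. Qed.

Lemma affine_eq3 (f g : plane -> R) k : affine_fun f -> affine_fun g ->
  f c = g c -> f (v (ordS k)) = g (v (ordS k)) ->
  f (v (ordS (ordS k))) = g (v (ordS (ordS k))) -> f =1 g.
Proof.
move=> hf hg h0 h1 h2.
have E (f' : plane -> R) : affine_fun f' -> f' (v k) =
   (f' c - lam (ordS k) c * f' (v (ordS k)) - lam (ordS (ordS k)) c * f' (v (ordS (ordS k)))) / lam k c.
  move=> [a [b [e h]]]; have S := lam_sum hv k c.
  have P0 := congr1 (fun y : plane => y 0 0) (lam_pt hv k c).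
  have P1 := congr1 (fun y : plane => y 1 0) (lam_pt hv k c).
  rewrite !mxE in P0 P1; apply: (mulIf (cneq0 k)); rewrite divfK ?cneq0// !h {1}P0 {1}P1.
  have Se : e * (lam k c + lam (ordS k) c + lam (ordS (ordS k)) c) = e by rewrite S mulr1.
  by rewrite -{2}Se; ring.
have hk : f (v k) = g (v k) by rewrite !E// h0 h1 h2.
have gen (f' : plane -> R) x : affine_fun f' -> f' x = lam k x * f' (v k) + lam (ordS k) x * f' (v (ordS k)) +
    lam (ordS (ordS k)) x * f' (v (ordS (ordS k))).
  move=> [a [b [e h]]]; have S := lam_sum hv k x.
  have P0 := congr1 (fun y : plane => y 0 0) (lam_pt hv k x).
  have P1 := congr1 (fun y : plane => y 1 0) (lam_pt hv k x).
  have Se : e * (lam k x + lam (ordS k) x + lam (ordS (ordS k)) x) = e by rewrite S mulr1.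
  rewrite !mxE in P0 P1; rewrite !h {1}P0 {1}P1 -{1}Se; ring.
by move=> x; rewrite (gen f)// (gen g)// hk h1 h2.
Qed.

(** One polynomial [Pol a b] matches all boundary values. Each remainder vanishes on its outer edge,
    so it is [mu k] times an affine [L k]. The [L k] agree along the segments, hence they are fixed
    by their values at [c] and at the vertices, which become [e] and [g]. *)
Lemma Sf_struct (f : 'I_3 -> plane -> R) : (forall k, poly_fun 2 (f k)) -> edge_agree v c f ->
  exists a b g e, forall k x, f k x = Sf a b g e k x.
Proof.
move=> hf ag.
have /choice[A /choice[B hAB]] : forall k, exists a b, forall x, f k x = Pol a b x.
  by move=> k; exact: quad_bary.
have Pv a b l : Pol a b (v l) = a l.
  by rewrite /Pol (sum3 _ l) !ordS3 !(lam_vE hv); ring.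
(* [a l] is read off one of the two pieces at [v l], and [b l] off the piece that contains edge
   [l]. *)
pose a l := A (ordS l) l; pose b l := B l l.
have e10 (j : 'I_3) : c + 1 *: (v j - c) = v j by rewrite scale1r addrC subrK.
have Aj j : A (ordS (ordS j)) j = a j.
  by have := ag j 1; rewrite ler01 lexx e10 !hAB !Pv => /(_ isT) <-.
have A1 k : A k (ordS k) = a (ordS k).
  by rewrite -Aj; congr (A _ _); rewrite !ordS3.
have A2 k : A k (ordS (ordS k)) = a (ordS (ordS k)).
  by rewrite /a ordS3.
(* On piece [k] what remains after subtracting [Pol a b] is divisible by [lam k]. *)
pose L k x := lam k c * ((A k k - a k) + (B k (ordS k) - b (ordS k)) * lam (ordS (ordS k)) x +
   (B k (ordS (ordS k)) - b (ordS (ordS k))) * lam (ordS k) x).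
have aL k : affine_fun (L k).
  have [p [q [r h]]] := lam_affine hv (ordS k); have [p' [q' [r' h']]] := lam_affine hv (ordS (ordS k)).
  rewrite /L; set x1 := A k k - a k; set x2 := B _ _ - _; set x3 := B _ _ - _.
  exists (lam k c * (x2 * p' + x3 * p)), (lam k c * (x2 * q' + x3 * q)), (lam k c * (x1 + x2 * r' + x3 * r)).
  by move=> x; rewrite h h'; ring.
have fL k x : f k x = Pol a b x + mu k x * L k x.
  rewrite hAB /Pol !(sum3 _ k) !ordS3 A1 A2 /L /mu.
  have -> : B k k = b k by [].
  by field; exact: cneq0.
(* From both sides [mu] is [1 - t] on the segment and cancels for [t < 1]. The endpoint [t = 1] is
   recovered below from [t = 1 / 2], because [L] is affine. *)
have Lag j (t : R) : 0 <= t < 1 -> L (ordS j) (c + t *: (v j - c)) = L (ordS (ordS j)) (c + t *: (v j - c)).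
  move=> /andP[t0 t1]; have [h1 h2] := ordS_neqs j.
  have t01 : 0 <= t <= 1 by rewrite t0 ltW.
  have := ag j t t01; rewrite !fL !mu_line// => /addrI; apply: mulfI.
  by rewrite subr_eq0 gt_eqF.
have e00 (j : 'I_3) : c + 0 *: (v j - c) = c by rewrite scale0r addr0.
have Lc j : L (ordS j) c = L (ordS (ordS j)) c.
  by have := Lag j 0; rewrite e00; apply; rewrite lexx ltr01.
have Lv j : L (ordS j) (v j) = L (ordS (ordS j)) (v j).
  have := Lag j (1 / 2); rewrite !affine_line0// -Lc => H.
  have h2 : 0 <= (1 / 2 : R) < 1 by apply/andP; split; lra.
  by have := H h2; lra.
pose g j := L (ordS j) (v j).
(* At [c] the [l]-th bubble divided by [mu k] already has the value [lam l c / 2], which is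
   subtracted here. *)
pose e := L 0 c - (\sum_l lam l c * g l) / 2.
have Lc0 k : L k c = L 0 c.
  have H0 := Lc 0; have H1 := Lc (ordS 0); have H2 := Lc (ordS (ordS 0)); rewrite !ordS3 in H0 H1 H2.
  by apply: (ordS_all (P := fun k => L k c = L 0 c) (k := 0)) => //; rewrite ?H0 ?H1.
exists a, b, g, e => k x; rewrite fL /Sf -addrA; congr (_ + _).
pose m x := L 0 c * mu k x + g (ordS k) * (lam (ordS k) x - lam (ordS k) c * mu k x) +
   g (ordS (ordS k)) * (lam (ordS (ordS k)) x - lam (ordS (ordS k)) c * mu k x).
have [n1 n2 n3 n4 [n5 n6]] := ordS_neq k.
have mc : mu k c = 1 by rewrite /mu divff ?cneq0.
have -> : L k x = m x.
  have am : affine_fun m.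
    have [p [q [r h]]] := lam_affine hv (ordS k); have [p' [q' [r' h']]] := lam_affine hv (ordS (ordS k)).
    have [p2 [q2 [r2 h2]]] := mu_affine k.
    rewrite /m; set x1 := L 0 c; set x2 := g _; set x3 := g _; set x4 := lam _ c; set x5 := lam _ c.
    exists (x1 * p2 + x2 * (p - x4 * p2) + x3 * (p' - x5 * p2)),
      (x1 * q2 + x2 * (q - x4 * q2) + x3 * (q' - x5 * q2)),
      (x1 * r2 + x2 * (r - x4 * r2) + x3 * (r' - x5 * r2)).
    by move=> y; rewrite h h' h2; ring.
  apply: (affine_eq3 (k := k)) => //.
  - by rewrite Lc0 /m mc; ring.
  - rewrite /m mu_v ?n3// !(lam_v hv) eqxx n5 mulr1n mulr0n.
    have := Lv (ordS k); rewrite ordS3 => <-.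
    by rewrite /g; ring.
  - rewrite /m mu_v ?n4// !(lam_v hv) eqxx n6 mulr1n mulr0n.
    by rewrite /g ordS3; ring.
rewrite /m /e /Bub !(sum3 _ k) /mu; field; exact: cneq0.
Qed.

End ScalarFamily.

Lemma continuous_mx (X : topologicalType) (R : realType) m n (f : X -> 'M[R]_(m, n)) :
  (forall i j, continuous (fun x => f x i j)) -> continuous f.
Proof.
move=> cf x A [P PM PA].
have H : \forall y \near x, forall i j, P i j (f y i j).
  by apply: filter_forall => i; apply: filter_forall => j; exact: cf (PM i j).
by apply: filterS H => y hy; apply: PA.
Qed.

(** * Piecewise quadratic vector fields with continuous curl *)

Section VectorFields.
Variable R : realType.
Local Notation plane := (plane R).
Variables (v : 'I_3 -> plane) (c : plane).
Hypothesis hv : area v != 0.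
Hypothesis hc : forall l, 0 < lam v l c.
Local Notation lam := (lam v).
Local Notation dlam := (dlam v).
Local Notation mu := (mu v c).
Local Notation Sf := (Sf v c).
Local Notation Pol := (Pol v).
Local Notation cneq0 := (cneq0 hc).

Definition dPol (a b : 'I_3 -> R) (w x : plane) : R :=
  \sum_l (a l * dlam l w + b l * (dlam (ordS l) w * lam (ordS (ordS l)) x +
                                  lam (ordS l) x * dlam (ordS (ordS l)) w)).

Definition dBub (k l : 'I_3) (w x : plane) : R :=
  dlam k w / lam k c * (lam l x - lam l c / 2 * mu k x) +
  mu k x * (dlam l w - lam l c / 2 * (dlam k w / lam k c)).

Definition dSf (a b g : 'I_3 -> R) (e : R) (k : 'I_3) (w x : plane) : R :=
  dPol a b w x + \sum_l g l * dBub k l w x + e * (2 * mu k x * (dlam k w / lam k c)).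

Lemma Sf_derive a b g e k w x : 'D_w (Sf a b g e k) x = dSf a b g e k w x.
Proof.
rewrite poly2_derive_val; last exact: (Sf_poly2 c hv).
rewrite /Sf /dSf /Pol /dPol !(sum3 _ 0) /Bub /dBub /mu !lamB !lamD.
by field; rewrite !cneq0.
Qed.

Lemma Sf_partial a b g e k i x : partial i (Sf a b g e k) x = dSf a b g e k (delta_mx i 0) x.
Proof. exact: Sf_derive. Qed.

Lemma dlam_v l i j : dlam l (v i - v j) = (l == i)%:R - (l == j)%:R.
Proof.
have := lamD v l (v j) (v i - v j).
by rewrite addrC subrK !(lam_v hv) => ->; ring.
Qed.

Lemma dlam_vc l i : dlam l (v i - c) = (l == i)%:R - lam l c.
Proof.
have := lamD v l c (v i - c).
by rewrite addrC subrK !(lam_v hv) => ->; ring.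
Qed.

Lemma dlamZ l (r : R) (x : plane) : dlam l (r *: x) = r * dlam l x.
Proof. by rewrite /dlam /det2 !mxE; ring. Qed.

Lemma dlamE l (w : plane) : dlam l w = w 0 0 * dlam l (delta_mx 0 0) + w 1 0 * dlam l (delta_mx 1 0).
Proof. by rewrite /dlam /det2 !mxE /=; ring. Qed.

(** The functions [mu (ordS j)] and [mu (ordS (ordS j))] coincide on the line through [c] and [v j],
    so their gradients differ by a multiple of its conormal. *)
Lemma kappaE j (w : plane) : dlam (ordS j) w / lam (ordS j) c -
   dlam (ordS (ordS j)) w / lam (ordS (ordS j)) c =
   det2 (v j - c) w / (lam (ordS j) c * lam (ordS (ordS j)) c * area v).
Proof.
have h1 := cneq0 (ordS j); have h2 := cneq0 (ordS (ordS j)).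
have h3 := mulf_neq0 (mulf_neq0 h1 h2) hv; apply: (mulIf h3); rewrite divfK//.
rewrite [LHS](_ : _ = (lam (ordS (ordS j)) c * (dlam (ordS j) w * area v) -
   lam (ordS j) c * (dlam (ordS (ordS j)) w * area v))); last by field; rewrite h1 h2.
have E l : dlam l w * area v = det2 (evec v l) w by rewrite /dlam divfK.
have P0 := congr1 (fun y : plane => y 0 0) (lam_pt hv j c).
have P1 := congr1 (fun y : plane => y 1 0) (lam_pt hv j c).
have S := lam_sum hv j c; rewrite !mxE in P0 P1.
have L : lam j c = 1 - lam (ordS j) c - lam (ordS (ordS j)) c by rewrite -S; ring.
by rewrite !E /evec /det2 !ordS3 !mxE P0 P1 L; ring.
Qed.

(** The [l]-th bubble contributes the jump of the gradient of [mu] times [lam l - lam l c * mu]. On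
    the [j]-th segment this factor is [t] for [l = j] and 0 otherwise. *)
Lemma dSf_jump a b g e j (t : R) w :
  dSf a b g e (ordS j) w (c + t *: (v j - c)) - dSf a b g e (ordS (ordS j)) w (c + t *: (v j - c)) =
  det2 (v j - c) w / (lam (ordS j) c * lam (ordS (ordS j)) c * area v) *
    (t * g j + 2 * e * (1 - t)).
Proof.
have [h1 h2] := ordS_neqs j; have [n1 n2 n3 n4 [n5 n6]] := ordS_neq j.
rewrite -kappaE /dSf /dBub !(mu_line hv hc)// !(sum3 _ j) !(lam_line _ hv) eqxx n1 n2.
by rewrite mulr1n mulr0n; field; rewrite !cneq0.
Qed.

(* The general element of [A0]. The coefficient of the [l]-th bubble is chosen so
   that its gradient jump across the edge from [c] to [v l] has no curl. *)
Definition AF (a b : 'I_3 -> plane) (om : 'I_3 -> R) : 'I_3 -> plane -> plane := fun k x =>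
  \col_i Sf (fun l => a l i 0) (fun l => b l i 0) (fun l => - om l * rot (v l - c) i 0) 0 k x.

Definition cPol (a b : 'I_3 -> plane) (x : plane) : R :=
  dPol (fun l => a l 1 0) (fun l => b l 1 0) (delta_mx 0 0) x -
  dPol (fun l => a l 0 0) (fun l => b l 0 0) (delta_mx 1 0) x.

Lemma Pol_derive a b w x : 'D_w (Pol a b) x = dPol a b w x.
Proof.
rewrite poly2_derive_val; last exact: Pol_poly2.
by rewrite /Pol /dPol !(sum3 _ 0) !lamB !lamD; field.
Qed.

Lemma dPol_affine a b i : affine_fun (dPol a b (delta_mx i 0)).
Proof.
have := poly2_partial_affine i (Pol_poly2 hv a b); congr affine_fun.
by apply/funext => x; exact: Pol_derive.
Qed.

Lemma cPol_affine a b : affine_fun (cPol a b).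
Proof.
rewrite /cPol; have [p [q [r h]]] := dPol_affine (fun l => a l 1 0) (fun l => b l 1 0) 0.
have [p' [q' [r' h']]] := dPol_affine (fun l => a l 0 0) (fun l => b l 0 0) 1.
by exists (p - p'), (q - q'), (r - r') => x; rewrite h h'; ring.
Qed.

Lemma AF_derive a b om k i w x : 'D_w (fun y => AF a b om k y i 0) x =
  dSf (fun l => a l i 0) (fun l => b l i 0) (fun l => - om l * rot (v l - c) i 0) 0 k w x.
Proof. by rewrite -Sf_derive; congr ('D_w _ x); apply/funext => y; rewrite mxE. Qed.

(** The curl of a scalar function times [rot d] is the derivative of the function along [d]. For
    [d = v l - c] the bubble yields a derivative that is continuous across the segments, which
    explains the direction chosen in [AF]. *)
Lemma dBub_radial k l x : dBub k l (v l - c) x = mu k x - lam l x.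
Proof.
rewrite /dBub !dlam_vc eqxx mulr1n /mu; have [->|kl] := eqVneq k l.
  by rewrite mulr1n; field; rewrite cneq0.
by rewrite mulr0n; field; rewrite cneq0.
Qed.

Lemma AF_curl a b om k x : curlT (AF a b om) k x = cPol a b x + \sum_l om l * (lam l x - mu k x).
Proof.
rewrite /curlT /partial !AF_derive /dSf !mul0r !addr0 /cPol.
rewrite opprD addrACA; congr (_ + _); rewrite -sumrB; apply: eq_bigr => l _.
have := dBub_radial k l x; rewrite {1}/dBub !(dlamE _ (v l - c)) => E.
by rewrite [RHS](_ : _ = - om l * (mu k x - lam l x)); [rewrite -E /dBub !mxE /=; ring|ring].
Qed.

Lemma A0_AF a b om : A0 v c (AF a b om).
Proof.
have cS a' b' g' k : continuous (Sf a' b' g' 0 k).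
  by apply: (@Cn_continuous _ 0); apply: poly2_Cn; exact: (Sf_poly2 c hv).
split.
- move=> k i; have := Sf_poly2 c hv (fun l => a l i 0) (fun l => b l i 0) (fun l => - om l * rot (v l - c) i 0) 0 k.
  by congr poly_fun; apply/funext => x; rewrite mxE.
- apply: (continuous_glue hv hc) => [k|j t t01].
    apply: continuous_mx => i j; rewrite ord1.
    by rewrite (_ : (fun x => _) = Sf (fun l => a l i 0) (fun l => b l i 0) (fun l => - om l * rot (v l - c) i 0) 0 k);
      [exact: cS|apply/funext => x; rewrite mxE].
  by apply/colP => i; rewrite !mxE; exact: (Sf_edge_agree hv hc).
- have ac := cPol_affine a b.
  apply: (continuous_glue hv hc) => [k|j t t01].
    have cD l : continuous (fun x => om l * (lam l x - mu k x)).
      apply: continuous_affine; have [p [q [r h]]] := lam_affine hv l.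
      have [p' [q' [r' h']]] := mu_affine c hv k.
      by exists (om l * (p - p')), (om l * (q - q')), (om l * (r - r')) => x; rewrite h h'; ring.
    rewrite (_ : curlT _ k = fun x => cPol a b x + (om 0 * (lam 0 x - mu k x) +
      om (ordS 0) * (lam (ordS 0) x - mu k x) + om (ordS (ordS 0)) * (lam (ordS (ordS 0)) x - mu k x))).
      by apply: contD; [exact: continuous_affine|apply: contD; first apply: contD; exact: cD].
    by apply/funext => x; rewrite AF_curl (sum3 _ 0).
  have [h1 h2] := ordS_neqs j.
  by rewrite !AF_curl !(mu_line hv hc).
Qed.

(** Continuity of the curl at parameter [t] of a segment is one equation, affine in [t]. At [t = 0]
    it makes the vector [e] orthogonal to every [v j - c], hence 0. At [t = 1] it makes [g j]
    orthogonal to [v j - c], hence a multiple of the rotated vector; up to sign [om j] is the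
    coefficient of that projection. *)
Lemma A0_struct u : A0 v c u -> exists a b om, u = AF a b om.
Proof.
move=> [hu cu cc].
have ag i : edge_agree v c (fun k x => u k x i 0).
  by move=> j t t01; rewrite (continuous_edge _ cu t01).
have /choice[a /choice[b /choice[g /choice[e E]]]] := fun i => Sf_struct hv hc (fun k => hu k i) (ag i).
pose d j := v j - c.
have cE k x : curlT u k x = dSf (a 1) (b 1) (g 1) (e 1) k (delta_mx 0 0) x -
   dSf (a 0) (b 0) (g 0) (e 0) k (delta_mx 1 0) x.
  rewrite /curlT -!Sf_partial; congr (partial _ _ x - partial _ _ x);
  by apply/funext => y; rewrite E.
have H j (t : R) : 0 <= t <= 1 ->
    d j 1 0 * (t * g 1 j + 2 * e 1 * (1 - t)) + d j 0 0 * (t * g 0 j + 2 * e 0 * (1 - t)) = 0.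
  move=> t01; have := continuous_edge j cc t01; rewrite !cE => /eqP.
  rewrite -subr_eq0 [X in X == 0](_ : _ =
    (dSf (a 1) (b 1) (g 1) (e 1) (ordS j) (delta_mx 0 0) (c + t *: (v j - c)) -
     dSf (a 1) (b 1) (g 1) (e 1) (ordS (ordS j)) (delta_mx 0 0) (c + t *: (v j - c))) -
    (dSf (a 0) (b 0) (g 0) (e 0) (ordS j) (delta_mx 1 0) (c + t *: (v j - c)) -
     dSf (a 0) (b 0) (g 0) (e 0) (ordS (ordS j)) (delta_mx 1 0) (c + t *: (v j - c)))); last by ring.
  rewrite !dSf_jump -/(d j); have h1 := cneq0 (ordS j); have h2 := cneq0 (ordS (ordS j)).
  have h3 := mulf_neq0 (mulf_neq0 h1 h2) hv.
  move=> /eqP h; apply: (mulIf (invr_neq0 h3)); rewrite mul0r -[RHS]oppr0 -[in RHS]h.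
  have -> : det2 (d j) (delta_mx 0 0) = - d j 1 0.
    by rewrite /det2 [X in _ * X - _]mxE [X in _ - _ * X]mxE /=; ring.
  have -> : det2 (d j) (delta_mx 1 0) = d j 0 0.
    by rewrite /det2 [X in _ * X - _]mxE [X in _ - _ * X]mxE /=; ring.
  by ring.
have He j : d j 1 0 * e 1 + d j 0 0 * e 0 = 0.
  have h01 : 0 <= (0 : R) <= 1 by apply/andP; split; lra.
  by have := H j _ h01; rewrite !mul0r subr0 => h; apply: (mulfI (_ : (2 : R) != 0)); [exact: lt0r_neq0|rewrite mulr0 -h; ring].
have Hg j : d j 1 0 * g 1 j + d j 0 0 * g 0 j = 0.
  have h01 : 0 <= (1 : R) <= 1 by apply/andP; split; lra.
  by have := H j _ h01 => h; rewrite -h; ring.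
have [e1 e0] : e 1 = 0 /\ e 0 = 0.
  have nz : d (ordS 0) 1 0 * d (ordS (ordS 0)) 0 0 - d (ordS 0) 0 0 * d (ordS (ordS 0)) 1 0 != 0.
    by have := area_K_neq0 hv hc 0; rewrite -oppr_eq0; congr (_ != 0); rewrite /det2 /d; ring.
  exact: (cramer0 nz (He _) (He _)).
have dn j : d j 0 0 * d j 0 0 + d j 1 0 * d j 1 0 != 0.
  have := area_K_neq0 hv hc (ordS (ordS j)); rewrite ordS3 -/(d j); apply: contraNneq => h.
  have h0 := sqr_ge0 (d j 0 0); have h1 := sqr_ge0 (d j 1 0).
  have /eqP : d j 0 0 ^+ 2 + d j 1 0 ^+ 2 = 0 by rewrite !expr2.
  by rewrite paddr_eq0// !sqrf_eq0 /det2 => /andP[/eqP-> /eqP->]; rewrite !mul0r subr0.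
exists (fun l => \col_i a i l), (fun l => \col_i b i l),
  (fun j => (g 0 j * d j 1 0 - g 1 j * d j 0 0) / (d j 0 0 * d j 0 0 + d j 1 0 * d j 1 0)).
apply/funext => k; apply/funext => x; apply/colP => i; rewrite mxE E.
have ei : e i = 0 by case: (ord2_cases i) => ->.
rewrite ei /Sf /Pol; congr (_ + _ + _).
  by apply: eq_bigr => l _; rewrite !mxE.
apply: eq_bigr => l _; congr (_ * _).
apply: (mulfI (dn l)); rewrite mulNr mulrN [RHS](_ : _ = - ((g 0 l * d l 1 0 - g 1 l * d l 0 0) * rot (v l - c) i 0)); last first.
  by field; exact: dn.
have -> : rot (v l - c) i 0 = if i == 0 then - d l 1 0 else d l 0 0 by rewrite mxE.
apply/eqP; rewrite -subr_eq0; apply/eqP.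
have := Hg l; have := dn l; case: (ord2_cases i) => -> dl h /=.
  by transitivity (d l 0 0 * (d l 1 0 * g 1 l + d l 0 0 * g 0 l)); [ring|rewrite h mulr0].
by transitivity (d l 1 0 * (d l 1 0 * g 1 l + d l 0 0 * g 0 l)); [ring|rewrite h mulr0].
Qed.

End VectorFields.

(** * Degrees of freedom on edges *)

Section QuadraticIntegral.
Variable R : realType.

Lemma is_derive_quad (A B C z : R) :
  is_derive z 1 (fun s : R => A * s + B / 2 * s ^+ 2 + C / 3 * s ^+ 3 : R^o) (A + B * z + C * z ^+ 2).
Proof.
pose p : {poly R} := A *: 'X + (B / 2) *: 'X^2 + (C / 3) *: 'X^3.
have := is_derive_poly p z.
rewrite (_ : horner p = fun s : R => A * s + B / 2 * s ^+ 2 + C / 3 * s ^+ 3); last first.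
  by apply/funext => s; rewrite !hornerE.
by move=> /is_derive_eq; apply; rewrite /p !poly.derivE !hornerE /=; field.
Qed.

Lemma int_quad (L A B C : R) (f : R -> R) : 0 <= L -> (forall s, f s = A + B * s + C * s ^+ 2) ->
  \int[@lebesgue_measure R]_(s in `[0, L]) f s = A * L + B / 2 * L ^+ 2 + C / 3 * L ^+ 3.
Proof.
move=> L0 h.
have cf : continuous f.
  move=> x; apply: differentiable_continuous; apply/derivable1_diffP.
  rewrite (_ : f = horner (A%:P + B *: 'X + C *: 'X^2)); first exact: derivable_horner.
  by apply/funext => s; rewrite h !hornerE.
have D (z : R) : is_derive z 1 (fun s : R => A * s + B / 2 * s ^+ 2 + C / 3 * s ^+ 3 : R^o) (f z).
  by rewrite h; exact: is_derive_quad.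
by rewrite (FTC L0 cf D); field.
Qed.

End QuadraticIntegral.

Section Edges.
Variable R : realType.
Local Notation plane := (plane R).
Variables (v : 'I_3 -> plane) (c : plane) (o : 'I_3 -> bool).
Hypothesis hv : area v != 0.
Local Notation lam := (lam v).
Local Notation dlam := (dlam v).
Local Notation tau := (tau v o).
Local Notation nu := (nu v o).
Local Notation len := (len v o).
Local Notation edge_pt := (edge_pt v o).
Local Notation tt := (tt v o).
Local Notation tn := (tn v o).

(* The endpoints of edge [e] are [v (vs e)] and [v (ve e)], in the direction of [tau e]. *)
Definition vs (e : 'I_3) : 'I_3 := if o e then ordS (ordS e) else ordS e.
Definition ve (e : 'I_3) : 'I_3 := if o e then ordS e else ordS (ordS e).

Lemma edge_startE e : edge_start v o e = v (vs e).
Proof. by rewrite /edge_start /vs; case: (o e). Qed.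

Lemma edge_endE e : edge_end v o e = v (ve e).
Proof. by rewrite /edge_end /ve; case: (o e). Qed.

Lemma dotvE (a b : plane) : dotv a b = a 0 0 * b 0 0 + a 1 0 * b 1 0.
Proof.
rewrite /dotv !big_ord_recl big_ord0 addr0.
have e1 : lift ord0 ord0 = 1 :> 'I_2 by apply: val_inj.
by rewrite e1.
Qed.

Lemma vs_neq e : [/\ (e == vs e) = false, (e == ve e) = false & (ve e == vs e) = false].
Proof.
by have [n1 n2 n3 n4 [n5 n6]] := ordS_neq e; rewrite /vs /ve; case: (o e); rewrite ?n1 ?n2 ?n3 ?n4 ?n5 ?n6.
Qed.

Lemma len_gt0 e : 0 < len e.
Proof.
have [n1 n2 n3] := vs_neq e.
rewrite /Defs.len /enorm sqrtr_gt0 edge_startE edge_endE dotvE -!expr2.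
rewrite lt_neqAle addr_ge0 ?sqr_ge0// andbT; apply/eqP => h.
have h0 := sqr_ge0 ((v (ve e) - v (vs e)) 0 0); have h1 := sqr_ge0 ((v (ve e) - v (vs e)) 1 0).
have /eqP := esym h; rewrite paddr_eq0// !sqrf_eq0 => /andP[/eqP z0 /eqP z1].
have z : v (ve e) - v (vs e) = 0 by apply: planeP; [rewrite z0 mxE|rewrite z1 mxE].
have := lam_v hv (ve e) (ve e); move/eqP: z; rewrite subr_eq0 => /eqP {1}->.
by rewrite (lam_v hv) n3 eqxx => /eqP; rewrite eq_sym oner_eq0.
Qed.

Lemma len_neq0 e : len e != 0.
Proof. by rewrite gt_eqF ?len_gt0. Qed.

Lemma tauE e : len e *: tau e = v (ve e) - v (vs e).
Proof. by rewrite /Defs.tau scalerA divff ?len_neq0// scale1r edge_startE edge_endE. Qed.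

Lemma tau1 e : tau e 0 0 ^+ 2 + tau e 1 0 ^+ 2 = 1.
Proof.
have h : len e ^+ 2 = dotv (v (ve e) - v (vs e)) (v (ve e) - v (vs e)).
  rewrite /Defs.len /enorm edge_startE edge_endE sqr_sqrtr// dotvE -!expr2.
  by rewrite addr_ge0 ?sqr_ge0.
have h0 : len e ^+ 2 != 0 by rewrite sqrf_eq0 len_neq0.
apply: (mulfI h0); rewrite mulr1 {2}h -tauE dotvE !mxE; ring.
Qed.

Lemma nuE e : nu e 0 0 = - tau e 1 0 /\ nu e 1 0 = tau e 0 0.
Proof. by rewrite /Defs.nu /rot !mxE. Qed.

Lemma edge_ptE e s : edge_pt e s = v (vs e) + s *: tau e.
Proof. by rewrite /Defs.edge_pt edge_startE. Qed.

Lemma edge_pt_len e : v (ve e) = v (vs e) + len e *: tau e.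
Proof. by rewrite tauE addrC subrK. Qed.

Lemma dlam_tau e l : dlam l (tau e) = ((l == ve e)%:R - (l == vs e)%:R) / len e.
Proof.
apply: (mulfI (len_neq0 e)); rewrite -dlamZ tauE dlam_v//.
by rewrite mulrC divfK// len_neq0.
Qed.

Lemma dlam_tau0 e : dlam e (tau e) = 0.
Proof. by have [n1 n2 _] := vs_neq e; rewrite dlam_tau n1 n2 subrr mul0r. Qed.

Lemma lam_edge e s : lam e (edge_pt e s) = 0.
Proof.
by have [n1 n2 _] := vs_neq e; rewrite edge_ptE lamD dlamZ dlam_tau0 mulr0 addr0 (lam_v hv) n1.
Qed.

Lemma edge_int_quad e (f : R -> R) A B C : (forall s, f s = A + B * s + C * s ^+ 2) ->
  edge_int v o e f = A * len e + B / 2 * len e ^+ 2 + C / 3 * len e ^+ 3.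
Proof.
by move=> h; apply: int_quad => //; exact/ltW/len_gt0.
Qed.

(** An affine function of mean zero on the edge is [q * (s - len e / 2)], so pairing with it
    annihilates constants and multiplies slopes by [q * len e ^+ 3 / 12]. *)
Lemma chi_moment chi e : is_chi v o chi -> exists2 z, z != 0 &
  forall f A B, (forall s, f s = A + B * s) -> edge_int v o e (fun s => f s * chi e s) = z * B.
Proof.
move=> /(_ e) [[p [q h]] [s0 hs0] h0].
have L0 := len_neq0 e.
have Ep : p = - q * len e / 2.
  have := h0; rewrite (@edge_int_quad e _ p q 0); last by move=> s; rewrite h; ring.
  by move=> E; apply: (mulfI L0); lra.
have q0 : q != 0.
  by apply: contraNneq hs0 => q0; rewrite h Ep q0; apply/eqP; field.
exists (q * len e ^+ 3 / 12%:R).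
  by rewrite !mulf_neq0// ?expf_neq0// invr_eq0 pnatr_eq0.
move=> f A B hf.
rewrite (@edge_int_quad e _ (A * p) (A * q + B * p) (B * q)); last by move=> s; rewrite hf h; ring.
by rewrite Ep; field.
Qed.

(** Everything the edge functionals see of a field: its two tangential components are affine along
    the edge, with derivative [B1] of the mixed one, and [G] is the constant normal derivative of
    the other. The data are additive, so [def a] and [w] can be treated apart. *)
Definition edge_data (e : 'I_3) (u : 'I_3 -> plane -> 'M[R]_2) (A0 A1 B0 B1 G : R) : Prop :=
  [/\ forall s, tt e u (edge_pt e s) = A0 + A1 * s,
      forall s, tn e u (edge_pt e s) = B0 + B1 * s,
      forall s, is_derive (edge_pt e s) (tau e) (tn e u : plane -> R^o) B1 &
      forall s, is_derive (edge_pt e s) (nu e) (tt e u : plane -> R^o) G].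

Lemma edge_dataD e u w A0 A1 B0 B1 G A0' A1' B0' B1' G' :
  edge_data e u A0 A1 B0 B1 G -> edge_data e w A0' A1' B0' B1' G' ->
  edge_data e (u + w) (A0 + A0') (A1 + A1') (B0 + B0') (B1 + B1') (G + G').
Proof.
move=> [h1 h2 h3 h4] [h1' h2' h3' h4'].
have Et : tt e (u + w) = tt e u \+ tt e w.
  by apply/funext => x; rewrite /Defs.tt /= mulmxDl !dotvE !mxE; ring.
have En : tn e (u + w) = tn e u \+ tn e w.
  by apply/funext => x; rewrite /Defs.tn /= mulmxDl !dotvE !mxE; ring.
split=> s; rewrite ?Et ?En /=.
- by rewrite h1 h1'; ring.
- by rewrite h2 h2'; ring.
- exact: (is_deriveD (h3 s) (h3' s)).
- exact: (is_deriveD (h4 s) (h4' s)).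
Qed.

Lemma dof_M_data (m : (R -> R^o) * R^o) e u A0 A1 B0 B1 G al be :
  edge_data e u A0 A1 B0 B1 G -> (forall s, m.1 s = al + be * s) ->
  dof_M v o m e u = m.2 * (A0 * len e + A1 * len e ^+ 2 / 2) + al * (len e * (B1 - G)) -
    be * (B0 * len e + G * len e ^+ 2 / 2).
Proof.
move=> [h1 h2 h3 h4] hm.
have hd s : derive1 m.1 s = be.
  rewrite derive1E; have -> : m.1 = (fun s : R => al + be * s : R^o) by apply/funext => t; rewrite hm.
  have := is_derive_poly (al%:P + be *: 'X) s.
  rewrite (_ : horner _ = fun s => al + be * s); last by apply/funext => t; rewrite !hornerE.
  by move=> [_ ->]; rewrite !poly.derivE !hornerE.
rewrite /dof_M (@edge_int_quad e _ (m.2 * A0 + B1 * al - B0 * be - G * al)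
  (m.2 * A1 + B1 * be - B1 * be - G * be) 0).
  by field.
move=> s; rewrite h1 h2 hm hd.
have -> : 'D_(tau e) (tn e u) (edge_pt e s) = B1 by have [_ ->] := h3 s.
have -> : 'D_(nu e) (tt e u) (edge_pt e s) = G by have [_ ->] := h4 s.
ring.
Qed.

Lemma dof_chi_data chi e : is_chi v o chi -> exists2 z, z != 0 &
  forall u A0 A1 B0 B1 G, edge_data e u A0 A1 B0 B1 G ->
    dof_tt v o chi e u = z * A1 /\ dof_tn v o chi e u = z * B1.
Proof.
move=> /(chi_moment e)[z z0 hz]; exists z => // u A0 A1 B0 B1 G [h1 h2 _ _].
by split; apply: (hz _ _ _).
Qed.

Lemma mulmx2E (A : 'M[R]_2) (w : plane) i : (A *m w) i 0 = A i 0 * w 0 0 + A i 1 * w 1 0.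
Proof.
rewrite !mxE !big_ord_recl big_ord0 addr0.
by have -> : lift ord0 ord0 = 1 :> 'I_2 by apply: val_inj.
Qed.

(** Along an edge [tt] of [def u] is the derivative of [u . tau], and [tn] is the derivative of
    [u . nu] minus half the curl. [4 / L ^+ 2] times the second difference [U2] is the second
    derivative of a quadratic. The last two equations rest on the fact that [B1 - G] is half the
    tangential derivative of the curl. *)
Lemma edge_data_def (u : 'I_3 -> plane -> 'cV[R]_2) e : (forall i, poly_fun 2 (fun x => u e x i 0)) ->
  let L := len e in let S := v (vs e) in let E := v (ve e) in
  let U2 := u e E + u e S - 2 *: u e (S + (L / 2) *: tau e) in
  let dw := curlT u e E - curlT u e S in
  exists A0 A1 B0 B1 G,
  [/\ edge_data e (def u) A0 A1 B0 B1 G,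
      A1 = 4 / L ^+ 2 * dotv (tau e) U2,
      B1 = 4 / L ^+ 2 * dotv (nu e) U2 - dw / (2 * L),
      A0 * L + A1 * L ^+ 2 / 2 = dotv (tau e) (u e E - u e S) &
      L * (B1 - G) = dw / 2 /\
      B0 * L + G * L ^+ 2 / 2 = dotv (nu e) (u e E - u e S) - L * curlT u e E / 2].
Proof.
move=> hu L S E U2 dw.
have L0 : L != 0 := len_neq0 e.
have [t Et] : exists t, t = tau e by exists (tau e).
have [n En] : exists n, n = nu e by exists (nu e).
have [n0 n1] := nuE e; have t1 := tau1 e; rewrite -En -Et in n0 n1 t1.
have EE : E = S + L *: t by rewrite Et; exact: edge_pt_len.
rewrite /U2 -Et -En.
have [r0 [p0 [q0 [s0 [m0 [k0 h0]]]]]] := (poly2P _).1 (hu 0).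
have [r1 [p1 [q1 [s1 [m1 [k1 h1]]]]]] := (poly2P _).1 (hu 1).
have D00 x : partial 0 (fun y => u e y 0 0) x = p0 + 2 * s0 * x 0 0 + m0 * x 1 0.
  by rewrite poly2_partial// !h0 !mxE /=; field.
have D10 x : partial 1 (fun y => u e y 0 0) x = q0 + m0 * x 0 0 + 2 * k0 * x 1 0.
  by rewrite poly2_partial// !h0 !mxE /=; field.
have D01 x : partial 0 (fun y => u e y 1 0) x = p1 + 2 * s1 * x 0 0 + m1 * x 1 0.
  by rewrite poly2_partial// !h1 !mxE /=; field.
have D11 x : partial 1 (fun y => u e y 1 0) x = q1 + m1 * x 0 0 + 2 * k1 * x 1 0.
  by rewrite poly2_partial// !h1 !mxE /=; field.
pose a := t 0 0; pose b := t 1 0.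
pose H x y := (q0 + m0 * x + 2 * k0 * y + (p1 + 2 * s1 * x + m1 * y)) / 2.
pose TT x y := (a * (p0 + 2 * s0 * x + m0 * y) + b * H x y) * a +
               (a * H x y + b * (q1 + m1 * x + 2 * k1 * y)) * b.
pose TN x y := (a * H x y + b * (q1 + m1 * x + 2 * k1 * y)) * a -
               (a * (p0 + 2 * s0 * x + m0 * y) + b * H x y) * b.
have dE i j x : def u e x i j = (partial j (fun y => u e y i 0) x + partial i (fun y => u e y j 0) x) / 2.
  by rewrite mxE.
have ETT x : tt e (def u) x = TT (x 0 0) (x 1 0).
  by rewrite /Defs.tt -Et dotvE !mulmx2E !dE D00 D10 D01 D11 /TT /H /a /b; field.
have ETN x : tn e (def u) x = TN (x 0 0) (x 1 0).
  by rewrite /Defs.tn -Et -En dotvE !mulmx2E !dE n0 n1 D00 D10 D01 D11 /TN /H /a /b; field.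
have ECU x : curlT u e x = p1 + 2 * s1 * x 0 0 + m1 * x 1 0 - (q0 + m0 * x 0 0 + 2 * k0 * x 1 0).
  by rewrite /curlT D01 D10.
have aTT : affine_fun (tt e (def u)).
  by exists (TT 1 0 - TT 0 0), (TT 0 1 - TT 0 0), (TT 0 0) => x; rewrite ETT /TT /H; field.
have aTN : affine_fun (tn e (def u)).
  by exists (TN 1 0 - TN 0 0), (TN 0 1 - TN 0 0), (TN 0 0) => x; rewrite ETN /TN /H; field.
pose X := S 0 0; pose Y := S 1 0.
exists (TT X Y), (TT a b - TT 0 0), (TN X Y), (TN a b - TN 0 0), (TT (- b) a - TT 0 0).
have aE (p q : plane) i : (p + q) i 0 = p i 0 + q i 0 by rewrite mxE.
have oE (p : plane) i : (- p) i 0 = - p i 0 by rewrite mxE.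
have zE (p : plane) k i : (k *: p) i 0 = k * p i 0 by rewrite mxE.
have cmE := (aE, oE, zE).
(* The factor [a ^+ 2 + b ^+ 2], equal to 1, makes both sides homogeneous in [a] and [b], so that
   the identities hold as polynomial ones. *)
have dwE : dw = (a ^+ 2 + b ^+ 2) * dw by rewrite t1 mul1r.
have cE : curlT u e E = (a ^+ 2 + b ^+ 2) * curlT u e E by rewrite t1 mul1r.
split; [split => s| | | |split].
- by rewrite ETT edge_ptE -/S -?Et -?En !cmE -/X -/Y -/a -/b /TT /H; field.
- by rewrite ETN edge_ptE -/S -?Et -?En !cmE -/X -/Y -/a -/b /TN /H; field.
- apply: (is_derive_eq (poly2_derive _ _ (poly2_affine aTN))).
  by rewrite !ETN edge_ptE -/S -?Et -?En !cmE -/X -/Y -/a -/b /TN /H; field.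
- apply: (is_derive_eq (poly2_derive _ _ (poly2_affine aTT))).
  by rewrite !ETT edge_ptE -/S -?Et -?En !cmE n0 n1 -/a -/b /TT /H; field.
- by rewrite dotvE EE !cmE !h0 !h1 !cmE -/X -/Y -/a -/b /TT /H; field; rewrite ?L0.
- by rewrite dwE dotvE n0 n1 /dw !ECU EE !cmE !h0 !h1 !cmE -/X -/Y -/a -/b /TN /H; field; rewrite ?L0.
- by rewrite dotvE EE !cmE !h0 !h1 !cmE -/X -/Y -/a -/b /TT /H; field.
- by rewrite dwE /dw !ECU EE !cmE -/X -/Y -/a -/b /TN /TT /H; field.
- by rewrite cE dotvE n0 n1 !ECU EE !cmE !h0 !h1 !cmE -/X -/Y -/a -/b /TN /TT /H; field.
Qed.

End Edges.

(** * Unisolvence on [A0] *)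

Section DofsA0.
Variable R : realType.
Local Notation plane := (plane R).
Variables (v : 'I_3 -> plane) (c : plane) (o : 'I_3 -> bool).
Hypothesis hv : area v != 0.
Hypothesis hc : forall l, 0 < lam v l c.
Local Notation AF := (AF v c).
Local Notation len := (len v o).
Local Notation vs := (vs o).
Local Notation ve := (ve o).
Local Notation len_neq0 := (len_neq0 o hv).

Lemma dotv_comb (x y z : plane) (p q : R) : dotv x (p *: y + q *: z) = p * dotv x y + q * dotv x z.
Proof. by rewrite !dotvE !mxE; ring. Qed.

(** The curl of [AF a b om] at [v l], by [AF_curl_v] the same on both pieces there. For given [a]
    and [b] it is equivalent to [om], and it is what the edge formulas contain. *)
Definition Om (a b : 'I_3 -> plane) (om : 'I_3 -> R) (l : 'I_3) : R := cPol v a b (v l) + om l.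

Lemma Sf_mu0 a b g e k x : mu v c k x = 0 -> Sf v c a b g e k x = Pol v a b x.
Proof.
by move=> h; rewrite /Sf /Bub h big1 => [|l _]; rewrite ?mul0r ?mulr0 ?addr0.
Qed.

Lemma Pol_v a b l : Pol v a b (v l) = a l.
Proof. by rewrite /Pol (sum3 _ l) !ordS3 !(lam_vE hv); ring. Qed.

Lemma AF_v a b om k l : k != l -> AF a b om k (v l) = a l.
Proof. by move=> kl; apply/colP => i; rewrite mxE Sf_mu0 ?Pol_v// (mu_v c hv). Qed.

Lemma AF_curl_v a b om k l : k != l -> curlT (AF a b om) k (v l) = Om a b om l.
Proof.
move=> kl; rewrite (AF_curl hv hc) (mu_v c hv kl) (bigD1 l)//= (lam_v hv) eqxx mulr1n subr0 mulr1.
by rewrite big1 ?addr0// => m ml; rewrite (lam_v hv) (negbTE ml) mulr0n subr0 mulr0.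
Qed.

Lemma AF_mid a b om e : AF a b om e (v (vs e) + (len e / 2) *: tau v o e) =
  (1 / 2) *: (a (vs e) + a (ve e)) + (1 / 4) *: b e.
Proof.
have [n1 n2 n3] := vs_neq o e.
have L0 := len_neq0 e.
have E l : lam v l (v (vs e) + (len e / 2) *: tau v o e) = ((l == vs e)%:R + (l == ve e)%:R) / 2.
  by rewrite lamD dlamZ (dlam_tau o hv) (lam_v hv); field.
apply/colP => i; rewrite mxE Sf_mu0; last by rewrite /mu E n1 n2 !mulr0n; field; exact: (cneq0 hc).
rewrite /Pol (sum3 _ e) !E n1 n2 !mxE !ordS3 n1 n2.
have [m1 m2 m3 m4 [m5 m6]] := ordS_neq e.
by rewrite /vs /ve; case: (o e); rewrite !eqxx m5 m6 ?mulr1n ?mulr0n; field.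
Qed.

Lemma AF_comb r a b om a' b' om' :
  r *: AF a b om + AF a' b' om' =
  AF (fun l => r *: a l + a' l) (fun l => r *: b l + b' l) (fun l => r * om l + om' l).
Proof.
apply/funext => k; apply/funext => x; apply/colP => i; rewrite /= !mxE.
rewrite /Sf /Pol !(sum3 _ 0) !mxE; ring.
Qed.

Lemma AF0 : AF (fun=> 0) (fun=> 0) (fun=> 0) = 0.
Proof.
apply/funext => k; apply/funext => x; apply/colP => i; rewrite /= !mxE.
rewrite /Sf /Pol !(sum3 _ 0) !mxE; ring.
Qed.

Lemma A0_comb r u w : A0 v c u -> A0 v c w -> A0 v c (r *: u + w).
Proof.
move=> /(A0_struct hv hc)[a [b [om ->]]] /(A0_struct hv hc)[a' [b' [om' ->]]].
by rewrite AF_comb; exact: A0_AF.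
Qed.

Lemma A0_0 : A0 v c 0.
Proof. by rewrite -AF0; exact: A0_AF. Qed.

Lemma AF_poly2 a b om k i : poly_fun 2 (fun x => AF a b om k x i 0).
Proof.
have := Sf_poly2 c hv (fun l => a l i 0) (fun l => b l i 0) (fun l => - om l * rot (v l - c) i 0) 0 k.
by congr poly_fun; apply/funext => x; rewrite mxE.
Qed.

(** By [AF_mid] the second difference along the edge is [- b e / 2], which turns the factor
    [4 / L ^+ 2] into [- 2 / L ^+ 2]. *)
Lemma edge_data_AF a b om e : let L := len e in
  exists A0 A1 B0 B1 G,
  [/\ edge_data v o e (def (AF a b om)) A0 A1 B0 B1 G,
      A1 = - 2 / L ^+ 2 * dotv (tau v o e) (b e),
      B1 = - 2 / L ^+ 2 * dotv (nu v o e) (b e) - (Om a b om (ve e) - Om a b om (vs e)) / (2 * L),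
      A0 * L + A1 * L ^+ 2 / 2 = dotv (tau v o e) (a (ve e) - a (vs e)) &
      L * (B1 - G) = (Om a b om (ve e) - Om a b om (vs e)) / 2 /\
      B0 * L + G * L ^+ 2 / 2 = dotv (nu v o e) (a (ve e) - a (vs e)) - L * Om a b om (ve e) / 2].
Proof.
move=> L; have [A0 [A1 [B0 [B1 [G]]]]] := edge_data_def o hv (AF_poly2 a b om e).
have [n1 n2 n3] := vs_neq o e.
rewrite AF_mid !AF_v ?n1 ?n2// !AF_curl_v ?n1 ?n2// -/L => -[h1 h2 h3 h4 [h5 h6]].
have L0 : L != 0 := len_neq0 e.
exists A0, A1, B0, B1, G; split => //; rewrite ?h2 ?h3 !dotvE;
  rewrite ![((_ + _ - _) : plane) _ 0]mxE ![((_ + _) : plane) _ 0]mxE ![(- _ : plane) _ 0]mxE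
  ![(_ *: _ : plane) _ 0]mxE ![((_ + _) : plane) _ 0]mxE ![(_ *: _ : plane) _ 0]mxE
  ![((_ + _) : plane) _ 0]mxE; field; rewrite ?L0//.
Qed.

(** The triangular order: vertex values are [a], vertex curls are [Om]; with [Om] known, the two
    moments against [chi] are the tangential and normal components of [b e]; then [om] follows. *)
Lemma A0_dofs_inj chi a b om : is_chi v o chi ->
  (forall i, dof0 v o chi i (AF a b om) = 0) -> AF a b om = 0.
Proof.
move=> hchi h.
have a0 j : a j = 0.
  apply/colP => l; have [n1 n2] := ordS_neqs j.
  by have := h (inl (inl (j, l))); rewrite /= AF_v// mxE.
have Om0 j : Om a b om j = 0.
  by have := h (inl (inr j)); have [n1 n2] := ordS_neqs j; rewrite /= AF_curl_v.
have b0 e : b e = 0.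
  have [A0 [A1 [B0 [B1 [G [hd h1 h2 _ _]]]]]] := edge_data_AF a b om e.
  have [z z0 hz] := dof_chi_data hv e hchi.
  have [e1 e2] := hz _ _ _ _ _ _ hd.
  have L0 := len_neq0 e.
  have q0 : - 2 / len e ^+ 2 != 0.
    by rewrite mulf_neq0// ?oppr_eq0 ?invr_eq0 ?expf_neq0// pnatr_eq0.
  have /= t1 := h (inr (inl e)); have /= t2 := h (inr (inr e)).
  rewrite e1 h1 in t1; rewrite e2 h2 !Om0 subrr mul0r subr0 in t2.
  have [n0 n1] := nuE v o e; have tt := tau1 o hv e.
  move/eqP: t1; rewrite mulf_eq0 (negbTE z0) /= mulf_eq0 (negbTE q0) /= dotvE => /eqP t1.
  move/eqP: t2; rewrite mulf_eq0 (negbTE z0) /= mulf_eq0 (negbTE q0) /= dotvE n0 n1 => /eqP t2.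
  have := cramer0 (p := tau v o e 0 0) (q := tau v o e 1 0) (r := - tau v o e 1 0) (s := tau v o e 0 0)
    (x := b e 0 0) (y := b e 1 0).
  case=> //; first by rewrite mulrN opprK -!expr2 tt oner_eq0.
  by move=> x0 y0; apply: planeP; rewrite ?x0 ?y0 mxE.
have om0 l : om l = 0.
  have := Om0 l; rewrite /Om /cPol /dPol !(sum3 _ 0) !a0 !b0 !mxE => H; rewrite -[RHS]H; ring.
rewrite -AF0; congr AF; apply/funext => l; by rewrite ?a0 ?b0 ?om0.
Qed.

Lemma A0_dofs_surj chi k : is_chi v o chi ->
  exists2 u, A0 v c u & forall i, dof0 v o chi i u = k i.
Proof.
move=> hchi.
pose a j : plane := \col_l k (inl (inl (j, l))).
pose O j := k (inl (inr j)).
have /choice[z hz] : forall e, exists z, z != 0 /\ forall u A0 A1 B0 B1 G, edge_data v o e u A0 A1 B0 B1 G ->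
    dof_tt v o chi e u = z * A1 /\ dof_tn v o chi e u = z * B1.
  by move=> e; have [z z0 hz] := dof_chi_data hv e hchi; exists z.
pose p e := - (k (inr (inl e)) / z e) * len e ^+ 2 / 2.
pose q e := - (k (inr (inr e)) / z e + (O (ve e) - O (vs e)) / (2 * len e)) * len e ^+ 2 / 2.
pose b e := p e *: tau v o e + q e *: nu v o e.
pose om l := O l - cPol v a b (v l).
have OmE l : Om a b om l = O l by rewrite /Om /om addrC subrK.
exists (AF a b om); first exact: A0_AF.
move=> [[[j l]|j]|[e|e]] /=.
- by have [n1 n2] := ordS_neqs j; rewrite AF_v// mxE.
- by have [n1 n2] := ordS_neqs j; rewrite AF_curl_v// OmE.
- have [A0 [A1 [B0 [B1 [G [hd h1 h2 _ _]]]]]] := edge_data_AF a b om e.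
  have [z0 hz'] := hz e; have [-> _] := hz' _ _ _ _ _ _ hd.
  have L0 := len_neq0 e; have [n0 n1] := nuE v o e; have t1 := tau1 o hv e.
  have Eb : dotv (tau v o e) (b e) = p e * (tau v o e 0 0 ^+ 2 + tau v o e 1 0 ^+ 2).
    by rewrite dotv_comb !dotvE n0 n1; ring.
  by rewrite h1 Eb t1 /p; field; rewrite L0 z0.
- have [A0 [A1 [B0 [B1 [G [hd h1 h2 _ _]]]]]] := edge_data_AF a b om e.
  have [z0 hz'] := hz e; have [_ ->] := hz' _ _ _ _ _ _ hd.
  have L0 := len_neq0 e; have [n0 n1] := nuE v o e; have t1 := tau1 o hv e.
  have Eb : dotv (nu v o e) (b e) = q e * (tau v o e 0 0 ^+ 2 + tau v o e 1 0 ^+ 2).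
    by rewrite dotv_comb !dotvE n0 n1; ring.
  by rewrite h2 Eb t1 !OmE /q; field; rewrite L0 z0.
Qed.

(** Linearity is read off the explicit values of the functionals on the family [AF]. *)
Lemma dof0_comb chi i r u w : is_chi v o chi -> A0 v c u -> A0 v c w ->
  dof0 v o chi i (r *: u + w) = r * dof0 v o chi i u + dof0 v o chi i w.
Proof.
move=> hchi /(A0_struct hv hc)[a [b [om ->]]] /(A0_struct hv hc)[a' [b' [om' ->]]].
have OmD l : Om (fun l => r *: a l + a' l) (fun l => r *: b l + b' l) (fun l => r * om l + om' l) l =
    r * Om a b om l + Om a' b' om' l.
  by rewrite /Om /cPol /dPol !(sum3 _ 0) !mxE; ring.
case: i => [[[j l]|j]|[e|e]] /=; first by rewrite !mxE.
- by have [n1 n2] := ordS_neqs j; rewrite AF_comb !AF_curl_v// OmD.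
- rewrite AF_comb.
  have [A0 [A1 [B0 [B1 [G [hd h1 h2 _ _]]]]]] := edge_data_AF a b om e.
  have [A0' [A1' [B0' [B1' [G' [hd' h1' h2' _ _]]]]]] := edge_data_AF a' b' om' e.
  have [A0_ [A1_ [B0_ [B1_ [G_ [hd_ h1_ h2_ _ _]]]]]] := edge_data_AF (fun l => r *: a l + a' l) (fun l => r *: b l + b' l) (fun l => r * om l + om' l) e.
  have [z z0 hz] := dof_chi_data hv e hchi.
  have [-> _] := hz _ _ _ _ _ _ hd; have [-> _] := hz _ _ _ _ _ _ hd'; have [-> _] := hz _ _ _ _ _ _ hd_.
  rewrite h1 h1' h1_ !dotvE ![((_ + _) : plane) _ 0]mxE ![(_ *: _ : plane) _ 0]mxE; ring.
- rewrite AF_comb.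
  have [A0 [A1 [B0 [B1 [G [hd h1 h2 _ _]]]]]] := edge_data_AF a b om e.
  have [A0' [A1' [B0' [B1' [G' [hd' h1' h2' _ _]]]]]] := edge_data_AF a' b' om' e.
  have [A0_ [A1_ [B0_ [B1_ [G_ [hd_ h1_ h2_ _ _]]]]]] := edge_data_AF (fun l => r *: a l + a' l) (fun l => r *: b l + b' l) (fun l => r * om l + om' l) e.
  have [z z0 hz] := dof_chi_data hv e hchi.
  have [_ ->] := hz _ _ _ _ _ _ hd; have [_ ->] := hz _ _ _ _ _ _ hd'; have [_ ->] := hz _ _ _ _ _ _ hd_.
  rewrite h2 h2' h2_ !OmD !dotvE ![((_ + _) : plane) _ 0]mxE ![(_ *: _ : plane) _ 0]mxE; ring.
Qed.

Lemma A0_unisolvent chi : is_chi v o chi ->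
  has_dim (A0 v c) 15 /\ unisolvent (A0 v c) (dof0 v o chi).
Proof.
move=> hchi; apply: unisolvent_of_bij.
- exact: A0_0.
- by move=> *; exact: A0_comb.
- by move=> *; exact: dof0_comb.
- by move=> u /(A0_struct hv hc)[a [b [om ->]]]; exact: A0_dofs_inj.
- by move=> k; exact: A0_dofs_surj.
- by rewrite !card_sum !card_prod !card_ord.
Qed.

End DofsA0.

(** * Densities that are constant on each piece *)

Section PiecewiseConstant.
Variable R : realType.
Local Notation plane := (plane R).
Variables (v : 'I_3 -> plane) (c : plane).
Hypothesis hv : area v != 0.
Hypothesis hc : forall l, 0 < lam v l c.
Local Notation K := (K v c).

Lemma indic_K k (phi : plane -> R) : continuous phi ->
  plane_integrable (T v) (fun x => \1_(K k) x * phi x) /\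
  plane_int (T v) (fun x => \1_(K k) x * phi x) = plane_int (K k) phi.
Proof.
move=> cphi.
have sub : @pt R @^-1` K k `<=` @pt R @^-1` T v by move=> p; exact: (K_sub hv hc).
have mT : measurable (@pt R @^-1` T v : set (measurableTypeR R * measurableTypeR R)).
  rewrite /T (hull_tri v 0); apply: measurable_tri; rewrite -(areaE v 0); exact: hv.
have E : (fun p : R * R => \1_(K k) (pt p) * phi (pt p)) =
    (fun p => phi (pt p)) \_ (@pt R @^-1` K k).
  apply/funext => p; rewrite indicE patchE.
  have -> : (p \in @pt R @^-1` K k) = (pt p \in K k) by apply/idP/idP; rewrite !inE.
  by case: ifP => h; rewrite ?mul1r ?mul0r.
split.
- apply: (integrableS (E := setT)) => //.
  have := integrable_K hv hc k cphi; rewrite /plane_integrable => H.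
  have mK := measurable_K hv hc k.
  move: H => /(integrable_mkcond _ mK); congr (integrable _ _).
  apply/funext => p; have := congr1 (fun g => (g p)%:E) E => /= ->.
  by rewrite !patchE; case: ifP.
- rewrite /plane_int; under eq_Rintegral do rewrite (congr1 (fun g => g _) E).
  by rewrite -Rintegral_mkcondr setIidr.
Qed.

(** [sven_integrable] asks for one function on [T]. A combination of indicators of the closed pieces
    serves; since each indicator is integrated separately, the overlap along the segments is
    harmless. *)
Lemma pw_const_density (q : 'I_3 -> R) : exists2 f, plane_integrable (T v) f &
  forall phi, continuous phi ->
    plane_int (T v) (fun x => f x * phi x) = pw_int v c (fun k x => q k * phi x).
Proof.
pose f0 x := q 0 * \1_(K 0) x : R; pose f1 x := q (ordS 0) * \1_(K (ordS 0)) x : R.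
pose f2 x := q (ordS (ordS 0)) * \1_(K (ordS (ordS 0))) x : R.
have mT : measurable (@pt R @^-1` T v : set (measurableTypeR R * measurableTypeR R)).
  rewrite /T (hull_tri v 0); apply: measurable_tri; rewrite -(areaE v 0); exact: hv.
have I (k : 'I_3) (phi : plane -> R) : continuous phi ->
    plane_integrable (T v) (fun x => q k * (\1_(K k) x * phi x)).
  move=> cphi; have [H _] := indic_K k cphi.
  rewrite /plane_integrable; under eq_fun do rewrite EFinM.
  exact: integrableZl.
exists (fun x => f0 x + f1 x + f2 x) => [|phi cphi].
  have c1 : continuous (fun _ : plane => 1 : R) by exact: cst_continuous.
  have J k := I k _ c1.
  rewrite /plane_integrable; under eq_fun do rewrite !EFinD.
  have E k : (fun p : R * R => (q k * \1_(K k) (pt p))%:E) = (fun p => (q k * (\1_(K k) (pt p) * 1))%:E).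
    by apply/funext => p; rewrite mulr1.
  rewrite /f0 /f1 /f2; apply: integrableD => //; [apply: integrableD => //|]; rewrite E; exact: J.
have -> : plane_int (T v) (fun x => (f0 x + f1 x + f2 x) * phi x) =
    plane_int (T v) (fun x => q 0 * (\1_(K 0) x * phi x) + q (ordS 0) * (\1_(K (ordS 0)) x * phi x) +
       q (ordS (ordS 0)) * (\1_(K (ordS (ordS 0))) x * phi x)).
  by congr plane_int; apply/funext => x; rewrite /f0 /f1 /f2; ring.
have J k := I k _ cphi; have [K0 E0] := indic_K 0 cphi.
have [K1 E1] := indic_K (ordS 0) cphi; have [K2 E2] := indic_K (ordS (ordS 0)) cphi.
rewrite /pw_int (sum3 _ 0) !(plane_intZ hv hc)// -E0 -E1 -E2.
have J01 := integrableD mT (J 0) (J (ordS 0)).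
rewrite /plane_int RintegralD//; last exact: J.
rewrite RintegralD//; [|exact: J|exact: J].
by rewrite !RintegralZl.
Qed.

End PiecewiseConstant.

(** * The space W *)

Section Forms.
Variable R : realType.
Local Notation plane := (plane R).
Variables (v : 'I_3 -> plane) (c : plane).
Hypothesis hv : area v != 0.
Hypothesis hc : forall l, 0 < lam v l c.
Local Notation lam := (lam v).
Local Notation dlam := (dlam v).
Local Notation evec := (evec v).
Local Notation Sf := (Sf v c).
Local Notation cneq0 := (cneq0 hc).

Definition bil (G : 'I_2 -> 'I_2 -> R) (x y : plane) : R :=
  x 0 0 * y 0 0 * G 0 0 + x 0 0 * y 1 0 * G 0 1 + x 1 0 * y 0 0 * G 1 0 + x 1 0 * y 1 0 * G 1 1.

(** Coordinates in the basis formed by the two edges that meet at [v l]. *)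
Lemma evec_expand l (x : plane) i :
  x i 0 = - dlam (ordS (ordS l)) x * evec (ordS l) i 0 + dlam (ordS l) x * evec (ordS (ordS l)) i 0.
Proof.
have := hv; rewrite (areaE v l) /dlam (areaE v l) /evec /det2 !ordS3 !mxE => h.
by case: (ord2_cases i) => ->; field.
Qed.

Lemma bil_expand G l x y : G 1 0 = G 0 1 ->
  bil G x y = dlam (ordS (ordS l)) x * dlam (ordS (ordS l)) y * bil G (evec (ordS l)) (evec (ordS l)) +
    dlam (ordS l) x * dlam (ordS l) y * bil G (evec (ordS (ordS l))) (evec (ordS (ordS l))) -
    (dlam (ordS (ordS l)) x * dlam (ordS l) y + dlam (ordS l) x * dlam (ordS (ordS l)) y) *
      bil G (evec (ordS l)) (evec (ordS (ordS l))).
Proof.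
move=> sG; rewrite /bil sG.
rewrite (evec_expand l x 0) (evec_expand l x 1) (evec_expand l y 0) (evec_expand l y 1).
ring.
Qed.

(** By [dSf_jump] the density is affine in [t]. Up to nonzero factors, [t = 0] gives the form of the
    [mu k ^ 2] coefficients at [v j - c], and [t = 1] that of the [j]-th bubble coefficients. *)
Lemma conormal_Sf (ap bp gp aq bq gq ar br gr : 'I_3 -> R) (ep eq er : R) j (t : R) :
  let d := v j - c in
  conormal v c (Sf ap bp gp ep) (Sf aq bq gq eq) (Sf ar br gr er) j (c + t *: d) =
  - (t * (d 0 0 ^+ 2 * gp j + 2 * (d 0 0 * d 1 0) * gr j + d 1 0 ^+ 2 * gq j) +
     2 * (1 - t) * (d 0 0 ^+ 2 * ep + 2 * (d 0 0 * d 1 0) * er + d 1 0 ^+ 2 * eq)) /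
   (lam (ordS j) c * lam (ordS (ordS j)) c * area v).
Proof.
move=> d; rewrite /conormal /jump !(Sf_partial hv hc) !(dSf_jump hv hc) -/d.
have -> : det2 d (delta_mx 0 0) = - d 1 0.
  by rewrite /det2 [X in _ * X - _]mxE [X in _ - _ * X]mxE /=; ring.
have -> : det2 d (delta_mx 1 0) = d 0 0.
  by rewrite /det2 [X in _ * X - _]mxE [X in _ - _ * X]mxE /=; ring.
by field; rewrite hv !cneq0.
Qed.

Lemma affine_partial f i x : affine_fun f -> partial i f x = f (delta_mx i 0) - f (0 : plane).
Proof.
move=> af; rewrite poly2_partial; last exact: poly2_affine.
by move: af => [p [q [r h]]]; rewrite !h !mxE; field.
Qed.

Lemma conormal_affine p q r j : (forall k, poly_fun 2 (p k)) -> (forall k, poly_fun 2 (q k)) ->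
  (forall k, poly_fun 2 (r k)) -> affine_fun (conormal v c p q r j).
Proof.
move=> hp hq hr; rewrite /conormal /jump.
have affC (f g : plane -> R) (y z : R) : affine_fun f -> affine_fun g -> affine_fun (fun x => y * f x - z * g x).
  move=> af ag; have := affine_comb y (- z) 0 af ag; congr affine_fun.
  by apply/funext => x; rewrite addr0 mulNr.
have affB (f g : plane -> R) : affine_fun f -> affine_fun g -> affine_fun (fun x => f x - g x).
  by move=> af ag; have := affC _ _ 1 1 af ag; congr affine_fun; apply/funext => x; rewrite !mul1r.
by apply: (affC); apply: (affB); apply: (affB); apply: poly2_partial_affine.
Qed.

Lemma sven_piece_cst p q r : poly_fun 2 p -> poly_fun 2 q -> poly_fun 2 r ->
  exists k, forall x : plane, sven_piece p q r x = k.
Proof.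
move=> hp hq hr; eexists => x; rewrite /sven_piece.
by rewrite (affine_partial 1 x (poly2_partial_affine 1 hp)) (affine_partial 0 x (poly2_partial_affine 0 hq))
  (affine_partial 1 x (poly2_partial_affine 0 hr)) (affine_partial 0 x (poly2_partial_affine 1 hr)).
Qed.

(* The general element of [W] is [Wf h]. Its [l]-th coefficient is the symmetric form
   with values [h e] at [evec e], for [e] the two edges that meet at [v l], and 0 at
   [v l - c]; [rW] is the mixed value that achieves the latter. *)
Definition rW (h : 'I_3 -> R) (l : 'I_3) : R :=
  (lam (ordS (ordS l)) c * h (ordS l) / lam (ordS l) c +
   lam (ordS l) c * h (ordS (ordS l)) / lam (ordS (ordS l)) c) / 2.

Definition form (h : 'I_3 -> R) (l : 'I_3) (x y : plane) : R :=
  dlam (ordS (ordS l)) x * dlam (ordS (ordS l)) y * h (ordS l) +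
  dlam (ordS l) x * dlam (ordS l) y * h (ordS (ordS l)) -
  (dlam (ordS (ordS l)) x * dlam (ordS l) y + dlam (ordS l) x * dlam (ordS (ordS l)) y) * rW h l.

Definition SW h l (i j : 'I_2) : R := form h l (delta_mx i 0) (delta_mx j 0).

Definition Wf (h : 'I_3 -> R) : 'I_3 -> plane -> 'M[R]_2 := fun k x =>
  \matrix_(i, j) Sf (fun=> 0) (fun=> 0) (fun l => SW h l i j) 0 k x.

Lemma SW_sym h l i j : SW h l i j = SW h l j i.
Proof. by rewrite /SW /form; ring. Qed.

Lemma bil_SW h l x y : bil (SW h l) x y = form h l x y.
Proof.
rewrite /bil /SW /form (dlamE v _ x) (dlamE v (ordS l) x) (dlamE v _ y) (dlamE v (ordS l) y).
ring.
Qed.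

Lemma form_d h l : form h l (v l - c) (v l - c) = 0.
Proof.
have [n1 n2 n3 n4 [n5 n6]] := ordS_neq l.
by rewrite /form /rW !(dlam_vc c hv) n1 n2 !mulr0n; field; rewrite !cneq0.
Qed.

Lemma dlam_evec l m : dlam l (evec m) = (l == ordS (ordS m))%:R - (l == ordS m)%:R.
Proof. by rewrite /evec (dlam_v hv). Qed.

Lemma form_evec h k l : k != l -> form h l (evec k) (evec k) = h k.
Proof.
have [n1 n2 n3 n4 [n5 n6]] := ordS_neq l.
case: (ordS_cases l k) => ->; rewrite ?eqxx// => _; rewrite /form !dlam_evec !ordS3 !eqxx ?n1 ?n2 ?n3 ?n4 ?n5 ?n6 ?mulr0n ?mulr1n; ring.
Qed.

(** Two edges and [v l - c] are pairwise nonparallel. The values on the edges leave only the mixed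
    value free, and the value on [v l - c] fixes it, as both [lam] factors in front of it are
    nonzero. *)
Lemma form_unique (G : 'I_2 -> 'I_2 -> R) h l : G 1 0 = G 0 1 ->
  bil G (evec (ordS l)) (evec (ordS l)) = h (ordS l) ->
  bil G (evec (ordS (ordS l))) (evec (ordS (ordS l))) = h (ordS (ordS l)) ->
  bil G (v l - c) (v l - c) = 0 -> forall i j, G i j = SW h l i j.
Proof.
move=> sG h1 h2 h0.
have r : bil G (evec (ordS l)) (evec (ordS (ordS l))) = rW h l.
  have [n1 n2 n3 n4 [n5 n6]] := ordS_neq l.
  move: h0; rewrite (bil_expand l _ _ sG) h1 h2 !(dlam_vc c hv) n1 n2 !mulr0n /rW => h0.
  have c1 := cneq0 (ordS l); have c2 := cneq0 (ordS (ordS l)).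
  apply: (mulfI c1); apply: (mulfI c2); apply: (mulfI (_ : (2 : R) != 0)); first by rewrite pnatr_eq0.
  apply/eqP; rewrite -subr_eq0; apply/eqP; rewrite -[RHS]oppr0 -[in RHS]h0; field.
  by rewrite c1 c2.
have E x y : bil G x y = form h l x y by rewrite (bil_expand l _ _ sG) h1 h2 r.
move=> i j; rewrite /SW -E /bil.
by case: (ord2_cases i) => ->; case: (ord2_cases j) => ->; rewrite !mxE /=; ring.
Qed.

End Forms.

Section SpaceW.
Variable R : realType.
Local Notation plane := (plane R).
Variables (v : 'I_3 -> plane) (c : plane) (o : 'I_3 -> bool).
Hypothesis hv : area v != 0.
Hypothesis hc : forall l, 0 < lam v l c.
Local Notation lam := (lam v).
Local Notation dlam := (dlam v).
Local Notation evec := (evec v).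
Local Notation Sf := (Sf v c).
Local Notation Wf := (Wf v c).
Local Notation SW := (SW v c).
Local Notation cneq0 := (cneq0 hc).
Local Notation tau := (tau v o).
Local Notation nu := (nu v o).
Local Notation len := (len v o).
Local Notation edge_pt := (edge_pt v o).
Local Notation vs := (vs o).
Local Notation ve := (ve o).

(** The shape of an element of [W] before its coefficients are identified; [Wf h] is the case
    [G = SW h]. *)
Definition Gu (G : 'I_3 -> 'I_2 -> 'I_2 -> R) : 'I_3 -> plane -> 'M[R]_2 := fun k x =>
  \matrix_(i, j) Sf (fun=> 0) (fun=> 0) (fun l => G l i j) 0 k x.

Lemma Gu_poly2 G k i j : poly_fun 2 (fun x => Gu G k x i j).
Proof.
have := Sf_poly2 c hv (fun=> 0) (fun=> 0) (fun l => G l i j) 0 k.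
by congr poly_fun; apply/funext => x; rewrite mxE.
Qed.

Lemma dotv_bil (A : 'M[R]_2) (t n : plane) : dotv (A *m t) n = bil (fun i j => A i j) n t.
Proof. by rewrite dotvE !mulmx2E /bil; ring. Qed.

Lemma dotv_Gu G k x (t n : plane) :
  dotv (Gu G k x *m t) n = Sf (fun=> 0) (fun=> 0) (fun l => bil (G l) n t) 0 k x.
Proof.
rewrite dotv_bil /bil /Gu; set m := Sf; rewrite !mxE /m /Sf /Pol !(sum3 _ 0); ring.
Qed.

Lemma Sf00_mu0 g e k x : mu v c k x = 0 -> Sf (fun=> 0) (fun=> 0) g e k x = 0.
Proof. by move=> h; rewrite Sf_mu0// /Pol big1// => l _; rewrite !mul0r addr0. Qed.

Lemma mu_edge e s : mu v c e (edge_pt e s) = 0.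
Proof. by rewrite /mu (lam_edge o hv) mul0r. Qed.

(** On edge [e] the factor [mu e] is 0, so only its own derivative survives; the cofactor
    interpolates linearly between the coefficients at the two endpoints. *)
Lemma Gu_derive G e t n w s :
  is_derive (edge_pt e s) w (fun x => dotv (Gu G e x *m t) n : R^o)
    (dlam e w / lam e c * \sum_l bil (G l) n t * lam l (edge_pt e s)).
Proof.
rewrite (_ : (fun x => _) = Sf (fun=> 0) (fun=> 0) (fun l => bil (G l) n t) 0 e); last first.
  by apply/funext => x; rewrite dotv_Gu.
apply: (is_derive_eq (poly2_derive _ _ (Sf_poly2 c hv _ _ _ _ _))).
rewrite -(poly2_derive_val _ _ (Sf_poly2 c hv _ _ _ _ _)) (Sf_derive hv hc) /dSf mul0r addr0.
rewrite /dPol big1 ?add0r => [|l _]; last by rewrite !mul0r addr0.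
rewrite mulr_sumr; apply: eq_bigr => l _; rewrite /dBub mu_edge; ring.
Qed.

Lemma dlam_nu e : dlam e (nu e) != 0.
Proof.
apply/eqP => h; have [n0 n1] := nuE v o e; have t1 := tau1 o hv e.
have t0 := dlam_tau0 o hv e.
have := dlamE v e (nu e); rewrite h n0 n1 => E1; move: t0; rewrite dlamE => E2.
have [] := @cramer0 R (tau e 0 0) (tau e 1 0) (- tau e 1 0) (tau e 0 0)
   (dlam e (delta_mx 0 0)) (dlam e (delta_mx 1 0)).
- by rewrite mulrN opprK -!expr2 t1 oner_eq0.
- exact: E2.
- exact/esym.
move=> z0 z1; have := dlam_vc c hv e e; rewrite dlamE z0 z1 !mulr0 addr0 eqxx mulr1n => /esym/eqP.
have := lam_sum hv e c; have := hc (ordS e); have := hc (ordS (ordS e)) => p1 p2 S.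
by move/eqP => q; lra.
Qed.

Lemma bil_evec (G : 'I_2 -> 'I_2 -> R) e : bil G (evec e) (evec e) = len e ^+ 2 * bil G (tau e) (tau e).
Proof.
have E i : evec e i 0 = (if o e then -1 else 1) * len e * tau e i 0.
  have := congr1 (fun y : plane => y i 0) (tauE o hv e).
  rewrite /evec /vs /ve mxE => H; rewrite -mulrA H; case: (o e); rewrite !mxE; ring.
by rewrite /bil !E; case: (o e); ring.
Qed.

(** On the boundary only [Pol a b] is visible; its values at vertices and midpoints determine [a]
    and [b]. *)
Lemma Sf_bdry0 a b g e0 : (forall e s, s \in `[0, len e] -> Sf a b g e0 e (edge_pt e s) = 0) ->
  forall k x, Sf a b g e0 k x = Sf (fun=> 0) (fun=> 0) g e0 k x.
Proof.
move=> h.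
have P0 e s : s \in `[0, len e] -> Pol v a b (edge_pt e s) = 0.
  by move=> hs; rewrite -(h e s hs) Sf_mu0// mu_edge.
have L0 e := ltW (len_gt0 o hv e).
have as0 e : a (vs e) = 0.
  have := P0 e 0; rewrite edge_ptE scale0r addr0 Pol_v//; apply.
  by rewrite in_itv /= lexx L0.
have ae0 e : a (ve e) = 0.
  have := P0 e (len e); rewrite edge_ptE -(edge_pt_len o hv) Pol_v//; apply.
  by rewrite in_itv /= lexx L0.
have a0 l : a l = 0.
  have := as0 (ordS l); have := ae0 (ordS l); rewrite /vs /ve !ordS3; by case: (o _).
have b0 e : b e = 0.
  have := P0 e (len e / 2); rewrite in_itv /= divr_ge0//= ler_pdivrMr// ler_peMr ?ler1n// => /(_ isT).
  have [n1 n2 n3] := vs_neq o e.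
  have E l : lam l (edge_pt e (len e / 2)) = ((l == vs e)%:R + (l == ve e)%:R) / 2.
    have Ln := len_neq0 o hv e.
    by rewrite edge_ptE lamD dlamZ (dlam_tau o hv) (lam_v hv); field.
  rewrite /Pol (sum3 _ e) !E !a0 !ordS3 n1 n2 => H.
  have [m1 m2 m3 m4 [m5 m6]] := ordS_neq e.
  move: H; rewrite /vs /ve; case: (o e); rewrite !eqxx m5 m6 ?mulr1n ?mulr0n => H; lra.
by move=> k x; rewrite /Sf /Pol; congr (_ + _ + _); apply: eq_bigr => l _; rewrite a0 b0.
Qed.

Lemma W_struct u : W v c o u -> exists h, u = Wf h.
Proof.
move=> [[hu sym] cu [f [fi hf]] bd hD].
have ag i j : edge_agree v c (fun k x => u k x i j).
  by move=> l t t01; rewrite (continuous_edge _ cu t01).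
have S i j : exists g e, forall k x, u k x i j = Sf (fun=> 0) (fun=> 0) g e k x.
  have [a [b [g [e E]]]] := Sf_struct hv hc (fun k => hu k i j) (ag i j).
  exists g, e => k x; rewrite E; apply: Sf_bdry0 => e' s hs.
  by rewrite -E bd// mxE.
have [gp [ep Ep]] := S 0 0; have [gq [eq Eq]] := S 1 1; have [gr [er Er]] := S 0 1.
have sy k x : u k x 1 0 = u k x 0 1 by rewrite -[in LHS]sym mxE.
pose p k x := u k x 0 0; pose q k x := u k x 1 1; pose r k x := u k x 0 1.
have hp k : poly_fun 2 (p k) := hu k 0 0; have hq k : poly_fun 2 (q k) := hu k 1 1.
have hr k : poly_fun 2 (r k) := hu k 0 1.
have /choice[Q hQ] k := sven_piece_cst (hp k) (hq k) (hr k).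
(* The integral with density [f] forces the segment densities to vanish; they are affine, so both
   endpoints can be evaluated. *)
have J0 : forall j, conormal v c p q r j c = 0 /\ conormal v c p q r j (v j) = 0.
  apply: (edge_jump_zero hv hc (f := f) (q := Q) (rho := orient v)) => //.
  - by move=> j; exact: conormal_affine.
  - exact: orient_neq0.
  - move=> phi hphi; rewrite -hf// (sven_dist_formula hv hc)//; last first.
      by move=> i j k n; apply: poly2_Cn; exact: hu.
    by congr (_ + _); apply: eq_pw_int => k x _; rewrite hQ.
have F : [/\ p = Sf (fun=> 0) (fun=> 0) gp ep, q = Sf (fun=> 0) (fun=> 0) gq eq & r = Sf (fun=> 0) (fun=> 0) gr er].
  by split; apply/funext => k; apply/funext => x; rewrite /p /q /r ?Ep ?Eq ?Er.
case: F => Fp Fq Fr; rewrite {}Fp {}Fq {}Fr in J0.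
pose d j := v j - c.
have nz (j : 'I_3) : lam (ordS j) c * lam (ordS (ordS j)) c * area v != 0.
  exact: mulf_neq0 (mulf_neq0 (cneq0 _) (cneq0 _)) hv.
have HE j : d j 0 0 ^+ 2 * ep + 2 * (d j 0 0 * d j 1 0) * er + d j 1 0 ^+ 2 * eq = 0.
  have [+ _] := J0 j; rewrite (_ : conormal _ _ _ _ _ _ c = conormal v c (Sf (fun=> 0) (fun=> 0) gp ep)
     (Sf (fun=> 0) (fun=> 0) gq eq) (Sf (fun=> 0) (fun=> 0) gr er) j (c + 0 *: (v j - c))); last first.
    by rewrite scale0r addr0.
  rewrite (conormal_Sf hv hc) -/(d j) => /eqP; rewrite mulf_eq0 invr_eq0 (negbTE (nz j)) orbF oppr_eq0 => /eqP H.
  by lra.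
have HG j : d j 0 0 ^+ 2 * gp j + 2 * (d j 0 0 * d j 1 0) * gr j + d j 1 0 ^+ 2 * gq j = 0.
  have [_ +] := J0 j; rewrite (_ : conormal _ _ _ _ _ _ (v j) = conormal v c (Sf (fun=> 0) (fun=> 0) gp ep)
     (Sf (fun=> 0) (fun=> 0) gq eq) (Sf (fun=> 0) (fun=> 0) gr er) j (c + 1 *: (v j - c))); last first.
    by rewrite scale1r addrC subrK.
  rewrite (conormal_Sf hv hc) -/(d j) => /eqP; rewrite mulf_eq0 invr_eq0 (negbTE (nz j)) orbF oppr_eq0 => /eqP H.
  by lra.
(* The form with entries [ep], [er], [eq] vanishes on all three [v l - c]. The weights [lam l c]
   balance these vectors, so polarisation gives 0 for the mixed value on two of them, and the form
   vanishes on a basis. *)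
have [ep0 [eq0 er0]] : ep = 0 /\ eq = 0 /\ er = 0.
  pose d1 := d (ordS 0); pose d2 := d (ordS (ordS 0)).
  have X i : lam 0 c * d 0 i 0 = - (lam (ordS 0) c * d1 i 0 + lam (ordS (ordS 0)) c * d2 i 0).
    have P0 := congr1 (fun y : plane => y i 0) (lam_pt hv 0 c); rewrite !mxE in P0.
    have Sm := lam_sum hv 0 c; have dE l : d l i 0 = v l i 0 - c i 0 by rewrite !mxE.
    rewrite /d1 /d2 !dE.
    have : c i 0 * (lam 0 c + lam (ordS 0) c + lam (ordS (ordS 0)) c) = c i 0 by rewrite Sm mulr1.
    by move=> h; lra.
  have E12 : d1 0 0 * d2 0 0 * ep + (d1 0 0 * d2 1 0 + d1 1 0 * d2 0 0) * er + d1 1 0 * d2 1 0 * eq = 0.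
    have H1 := HE (ordS 0); have H2 := HE (ordS (ordS 0)).
    have H0 : (lam 0 c * d 0 0 0) ^+ 2 * ep + 2 * (lam 0 c * d 0 0 0 * (lam 0 c * d 0 1 0)) * er +
        (lam 0 c * d 0 1 0) ^+ 2 * eq = 0.
      by transitivity (lam 0 c ^+ 2 * (d 0 0 0 ^+ 2 * ep + 2 * (d 0 0 0 * d 0 1 0) * er + d 0 1 0 ^+ 2 * eq));
        [ring|rewrite HE mulr0].
    rewrite !X in H0; rewrite -/d1 -/d2 in H1 H2.
    have c1 := cneq0 (ordS 0); have c2 := cneq0 (ordS (ordS 0)).
    have n2 : (2 : R) != 0 by rewrite pnatr_eq0.
    apply: (mulfI (mulf_neq0 n2 (mulf_neq0 c1 c2))); rewrite mulr0.
    transitivity (lam (ordS 0) c ^+ 2 * 0 + lam (ordS (ordS 0)) c ^+ 2 * 0 : R); last by rewrite !mulr0 addr0.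
    move: H0 H1 H2; set E11 := (X in _ -> X = 0 -> _ -> _); set E22 := (X in _ -> _ -> X = 0 -> _) => H0 H1 H2.
    transitivity (0 - lam (ordS 0) c ^+ 2 * E11 - lam (ordS (ordS 0)) c ^+ 2 * E22); last by rewrite H1 H2; ring.
    rewrite -[X in X - _ - _]H0 /E11 /E22; ring.
  have H1 := HE (ordS 0); have H2 := HE (ordS (ordS 0)); rewrite -/d1 -/d2 in H1 H2.
  have D0 : det2 d1 d2 ^+ 2 != 0 by rewrite expf_neq0//; exact: (area_K_neq0 hv hc 0).
  move: H1 H2 E12; set E11 := (X in X = 0 -> _ -> _ -> _); set E22 := (X in _ -> X = 0 -> _ -> _).
  set E12 := (X in _ -> _ -> X = 0 -> _) => H1 H2 H12.
  (* The entries are recovered from the values on the basis [d1], [d2], up to the squared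
     determinant. *)
  split; [|split]; apply: (mulfI D0); rewrite mulr0.
  - transitivity (d2 1 0 ^+ 2 * E11 - 2 * (d1 1 0 * d2 1 0) * E12 + d1 1 0 ^+ 2 * E22);
      [rewrite /E11 /E12 /E22 /det2; ring|rewrite H1 H2 H12; ring].
  - transitivity (d2 0 0 ^+ 2 * E11 - 2 * (d1 0 0 * d2 0 0) * E12 + d1 0 0 ^+ 2 * E22);
      [rewrite /E11 /E12 /E22 /det2; ring|rewrite H1 H2 H12; ring].
  - transitivity (- (d2 0 0 * d2 1 0) * E11 + (d1 0 0 * d2 1 0 + d1 1 0 * d2 0 0) * E12 - d1 0 0 * d1 1 0 * E22);
      [rewrite /E11 /E12 /E22 /det2; ring|rewrite H1 H2 H12; ring].
pose G l (i j : 'I_2) : R := if i == 0 then (if j == 0 then gp l else gr l) else (if j == 0 then gr l else gq l).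
have uG : u = Gu G.
  apply/funext => k; apply/funext => x; apply/matrixP => i j; rewrite mxE.
  case: (ord2_cases i) => ->; case: (ord2_cases j) => ->; rewrite ?sy ?Ep ?Eq ?Er ?ep0 ?eq0 ?er0 //.
(* The normal derivative interpolates the two endpoint coefficients on [(tau e, tau e)]; being
   constant, it makes them equal. *)
have hG e : bil (G (vs e)) (tau e) (tau e) = bil (G (ve e)) (tau e) (tau e).
  have [a ha] := hD e; have L0 := ltW (len_gt0 o hv e).
  have ev s : 'D_(nu e) (tt v o e u) (edge_pt e s) =
      dlam e (nu e) / lam e c * \sum_l bil (G l) (tau e) (tau e) * lam l (edge_pt e s).
    by rewrite uG; have [_ <-] := Gu_derive G e (tau e) (tau e) (nu e) s.
  have z0 : dlam e (nu e) / lam e c != 0 by rewrite mulf_neq0 ?invr_eq0 ?cneq0 ?dlam_nu.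
  have at_v l (F : 'I_3 -> R) : \sum_m F m * lam m (v l) = F l.
    rewrite (bigD1 l)//= (lam_v hv) eqxx mulr1n mulr1 big1 ?addr0// => m ml.
    by rewrite (lam_v hv) (negbTE ml) mulr0n mulr0.
  have h0 := ha 0; have hL := ha (len e); rewrite !ev !edge_ptE scale0r addr0 -(edge_pt_len o hv) !at_v in h0 hL.
  apply: (mulfI z0); rewrite h0 ?hL// in_itv /= ?lexx L0//.
pose h e := bil (G (vs e)) (evec e) (evec e).
have hh e l : e != l -> bil (G l) (evec e) (evec e) = h e.
  move=> el; rewrite /h !bil_evec; congr (_ * _).
  have [n1 n2 n3] := vs_neq o e.
  have [->//|->] : l = vs e \/ l = ve e.
    move: el; rewrite /vs /ve; case: (ordS_cases e l) => ->; rewrite ?eqxx// => _;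
      by case: (o e); first [by left | by right].
  by rewrite hG.
exists h; rewrite uG; apply/funext => k; apply/funext => x; apply/matrixP => i j; rewrite !mxE.
have HGS l i' j' : G l i' j' = SW h l i' j'.
  have [n1 n2 n3 n4 [n5 n6]] := ordS_neq l.
  apply: (form_unique hv hc) => //.
  - by rewrite hh// n1.
  - by rewrite hh// n2.
  - by rewrite -[RHS](HG l) /bil /G /= -/(d l); ring.
by rewrite /Sf; congr (_ + _ + _); apply: eq_bigr => l _; rewrite HGS.
Qed.

End SpaceW.

Section WMembers.
Variable R : realType.
Local Notation plane := (plane R).
Variables (v : 'I_3 -> plane) (c : plane) (o : 'I_3 -> bool).
Hypothesis hv : area v != 0.
Hypothesis hc : forall l, 0 < lam v l c.
Local Notation lam := (lam v).
Local Notation dlam := (dlam v).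
Local Notation Sf := (Sf v c).
Local Notation Wf := (Wf v c).
Local Notation SW := (SW v c).
Local Notation cneq0 := (cneq0 hc).
Local Notation tau := (tau v o).
Local Notation nu := (nu v o).
Local Notation len := (len v o).
Local Notation edge_pt := (edge_pt v o).

(* The value of [sven (Wf h)] on [K k]. *)
Definition Wq (h : 'I_3 -> R) (k : 'I_3) : R :=
  ((1 - 2 * lam k c) * (\sum_l h l / lam l c) - 3 * (h k / lam k c)) / (lam k c * area v ^+ 2).

Lemma Wf_poly2 h k i j : poly_fun 2 (fun x => Wf h k x i j).
Proof. exact: (Gu_poly2 c hv (SW h)). Qed.

Lemma Wf_agree h i j : edge_agree v c (fun k x => Wf h k x i j).
Proof.
by move=> l t t01; rewrite !mxE; exact: (Sf_edge_agree hv hc).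
Qed.

Lemma partial2_Sf g k i j x :
  partial i (partial j (Sf (fun=> 0) (fun=> 0) g 0 k)) x =
  \sum_l g l * (dlam k (delta_mx i 0) * dlam l (delta_mx j 0) + dlam k (delta_mx j 0) * dlam l (delta_mx i 0) -
    lam l c / lam k c * dlam k (delta_mx i 0) * dlam k (delta_mx j 0)) / lam k c.
Proof.
rewrite (affine_partial i x (poly2_partial_affine j (Sf_poly2 c hv _ _ _ _ _))).
have L l (w : plane) : lam l w = lam l 0 + dlam l w by rewrite -lamD add0r.
rewrite !(Sf_partial hv hc) /dSf /dPol /dBub /mu !(sum3 _ 0) !(L _ (delta_mx i 0)).
by field; rewrite !cneq0.
Qed.

(** The inverse of [area] is the determinant of the gradients of [lam k] and [lam (ordS k)], and 1
    is replaced by the sum of the [lam l c]. In these quantities the claim is a rational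
    identity. *)
Lemma Wf_sven_piece h k x :
  sven_piece (fun x => Wf h k x 0 0) (fun x => Wf h k x 1 1) (fun x => Wf h k x 0 1) x = Wq h k.
Proof.
have E i j : (fun x => Wf h k x i j) = Sf (fun=> 0) (fun=> 0) (fun l => SW h l i j) 0 k.
  by apply/funext => y; rewrite mxE.
have S w : dlam (ordS (ordS k)) w = - dlam k w - dlam (ordS k) w by rewrite -[RHS]addr0 -(dlam_sum v k w); ring.
have D : (area v)^-1 = dlam k (delta_mx 0 0) * dlam (ordS k) (delta_mx 1 0) -
    dlam k (delta_mx 1 0) * dlam (ordS k) (delta_mx 0 0).
  have := hv; rewrite /dlam (areaE v k) /evec /det2 !ordS3 !mxE /= => hn; by field.
rewrite /sven_piece !E !partial2_Sf /Wq.
have -> : 1 - 2 * lam k c = lam (ordS k) c + lam (ordS (ordS k)) c - lam k c.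
  by have S1 := lam_sum hv k c; lra.
have -> : (lam k c * area v ^+ 2)^-1 = (area v)^-1 ^+ 2 / lam k c by field; rewrite hv cneq0.
have -> : 3 * (h k / lam k c) = 3 * (h k / lam k c) * (lam k c + lam (ordS k) c + lam (ordS (ordS k)) c).
  by rewrite lam_sum// mulr1.
rewrite D /SW /form /rW !(sum3 _ k) !ordS3 !S.
by field; rewrite !cneq0.
Qed.

(** The terms on the segments vanish because the [j]-th form is 0 on [v j - c] ([form_d]). *)
Lemma Wf_is_sven h : is_sven v c (Wf h) (fun k _ => Wq h k).
Proof.
move=> phi hphi.
rewrite (sven_dist_formula hv hc)//; last first.
- exact: Wf_agree.
- by move=> k x; rewrite !mxE; rewrite /Sf; congr (_ + _ + _); apply: eq_bigr => l _; rewrite SW_sym.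
- by move=> i j k n; apply: poly2_Cn; exact: Wf_poly2.
rewrite big1 ?mulr0 ?addr0 => [|j _].
  by apply: eq_pw_int => k x _; rewrite Wf_sven_piece.
apply: line_int0 => t _.
have E i j' : (fun k x => Wf h k x i j') = Sf (fun=> 0) (fun=> 0) (fun l => SW h l i j') 0.
  by apply/funext => k; apply/funext => y; rewrite mxE.
rewrite !E (conormal_Sf hv hc).
have := form_d hv hc h j; rewrite -bil_SW /bil (SW_sym v c h j 1 0) => H.
rewrite [X in t * X](_ : _ = 0); last by rewrite -[RHS]H; ring.
by rewrite mulr0 add0r !mulr0 !addr0 mulr0 oppr0 !mul0r.
Qed.

(** Both endpoints of the edge carry the same value [h e / len e ^+ 2], and their two coordinates
    add up to 1 on the edge. *)
Lemma tt_slope h e s :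
  \sum_l bil (SW h l) (tau e) (tau e) * lam l (edge_pt e s) = h e / len e ^+ 2.
Proof.
have L0 := len_neq0 o hv e; have [n1 n2 n3 n4 [n5 n6]] := ordS_neq e.
have F l : e != l -> bil (SW h l) (tau e) (tau e) = h e / len e ^+ 2.
  move=> el; have := form_evec c hv h el; rewrite -bil_SW (bil_evec o hv) => <-.
  by field.
rewrite (sum3 _ e) (lam_edge o hv) mulr0 add0r !F ?n3 ?n4// -mulrDr.
have := lam_sum hv e (edge_pt e s); rewrite (lam_edge o hv) add0r => ->.
by rewrite mulr1.
Qed.

Lemma W_Wf h : W v c o (Wf h).
Proof.
split.
- split=> [k i j|k x]; first exact: Wf_poly2.
  apply/matrixP => i j; rewrite !mxE /Sf; congr (_ + _ + _).
  by apply: eq_bigr => l _; rewrite SW_sym.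
- apply: (continuous_glue hv hc) => [k|j t t01].
    by apply: continuous_mx => i j; apply: (@Cn_continuous _ 0); apply: poly2_Cn; exact: Wf_poly2.
  by apply/matrixP => i i'; exact: (Wf_agree h i i').
- have [f fi hf] := pw_const_density hv hc (Wq h).
  exists f; split => // phi hphi; rewrite Wf_is_sven// hf//.
  exact: (Cn_continuous (hphi.1 0%N)).
- by move=> e s _; apply/matrixP => i j; rewrite !mxE Sf00_mu0// mu_edge.
- move=> e; exists (dlam e (nu e) / lam e c * (h e / len e ^+ 2)) => s _.
  have [_ ->] := Gu_derive o hv hc (SW h) e (tau e) (tau e) (nu e) s.
  congr (_ * _).
  exact: tt_slope.
Qed.

(** An element of [W] enters the edge functionals only through its constant normal derivative. *)
Lemma edge_data_Wf h e : edge_data v o e (Wf h) 0 0 0 0 (dlam e (nu e) / lam e c * (h e / len e ^+ 2)).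
Proof.
have Z (t n : plane) s : dotv (Wf h e (edge_pt e s) *m t) n = 0.
  by rewrite [LHS](dotv_Gu v c (SW h)) Sf00_mu0// mu_edge.
split=> s; rewrite ?mul0r ?addr0; [exact: Z|exact: Z| |].
- apply: (is_derive_eq (Gu_derive o hv hc (SW h) e (tau e) (nu e) (tau e) s)).
  by rewrite (dlam_tau0 o hv) !mul0r.
- apply: (is_derive_eq (Gu_derive o hv hc (SW h) e (tau e) (tau e) (nu e) s)).
  by rewrite tt_slope.
Qed.

End WMembers.

(** * Degrees of freedom of A1 *)

Section DofsA1.
Variable R : realType.
Local Notation plane := (plane R).
Variables (v : 'I_3 -> plane) (c : plane) (o : 'I_3 -> bool).
Hypothesis hv : area v != 0.
Hypothesis hc : forall l, 0 < lam v l c.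
Local Notation AF := (AF v c).
Local Notation Wf := (Wf v c).
Local Notation dlam := (dlam v).
Local Notation evec := (evec v).
Local Notation cneq0 := (cneq0 hc).
Local Notation tau := (tau v o).
Local Notation nu := (nu v o).
Local Notation len := (len v o).
Local Notation vs := (vs o).
Local Notation ve := (ve o).
Local Notation Om := (Om v).

(** The constant that [W] prescribes on each edge: the normal derivative of the
    tangential-tangential component of [Wf h]. *)
Definition gW (h : 'I_3 -> R) e := dlam e (nu e) / lam v e c * (h e / len e ^+ 2).
(* On [def a + w], the pairing with [(phi, psi)], [phi s = al + be * s], is
   [psi * X1 + al * X2 + be * X3]: its integrand is the derivative of
   [psi * a . tau + om * phi / 2 - be * a . nu], where [om] is the curl of [a], minus
   [gW * phi]. [dT] and [dN] are the slopes of the two tangential components. *)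
Definition dT (b : 'I_3 -> plane) e := - 2 / len e ^+ 2 * dotv (tau e) (b e).
Definition dN (b : 'I_3 -> plane) (O : 'I_3 -> R) e :=
  - 2 / len e ^+ 2 * dotv (nu e) (b e) - (O (ve e) - O (vs e)) / (2 * len e).
Definition X1 (a : 'I_3 -> plane) e := dotv (tau e) (a (ve e) - a (vs e)).
Definition X2 (O h : 'I_3 -> R) e := (O (ve e) - O (vs e)) / 2 - len e * gW h e.
Definition X3 (a : 'I_3 -> plane) (O h : 'I_3 -> R) e :=
  - dotv (nu e) (a (ve e) - a (vs e)) + len e * O (ve e) / 2 - gW h e * len e ^+ 2 / 2.

Lemma edge_data_A1 a b om h e : exists A0 A1 B0 B1 G,
  [/\ edge_data v o e (def (AF a b om) + Wf h) A0 A1 B0 B1 G, A1 = dT b e, B1 = dN b (Om a b om) e,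
      A0 * len e + A1 * len e ^+ 2 / 2 = X1 a e &
      len e * (B1 - G) = X2 (Om a b om) h e /\
      - (B0 * len e + G * len e ^+ 2 / 2) = X3 a (Om a b om) h e].
Proof.
have [A0 [A1 [B0 [B1 [G [hd h1 h2 h3 [h4 h5]]]]]]] := edge_data_AF o hv hc a b om e.
have H := edge_dataD hd (edge_data_Wf o hv hc h e).
exists (A0 + 0), (A1 + 0), (B0 + 0), (B1 + 0), (G + gW h e); split => //; rewrite ?addr0//.
split; first by rewrite /X2 -h4; ring.
rewrite /X3.
have -> : dotv (nu e) (a (ve e) - a (vs e)) = B0 * len e + G * len e ^+ 2 / 2 + len e * Om a b om (ve e) / 2.
  by rewrite h5; ring.
by field.
Qed.

(** For an affine [m.1] the values at 0 and 1 recover its coefficients, so the pairing is visibly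
    linear in [m]. *)
Definition Lam (m : (R -> R^o) * R^o) x1 x2 x3 : R := m.2 * x1 + m.1 0 * x2 + (m.1 1 - m.1 0) * x3.

Lemma dof_M_A1 m e a b om h : M m ->
  dof_M v o m e (def (AF a b om) + Wf h) =
  Lam m (X1 a e) (X2 (Om a b om) h e) (X3 a (Om a b om) h e).
Proof.
move=> [al [be hm]].
have [A0 [A1 [B0 [B1 [G [hd h1 h2 h3 [h4 h5]]]]]]] := edge_data_A1 a b om h e.
rewrite (dof_M_data hv hd hm) h3 h4 /Lam -h5 !hm; ring.
Qed.

Lemma dof_chi_A1 chi e : is_chi v o chi -> exists2 z, z != 0 & forall a b om h,
  dof_tt v o chi e (def (AF a b om) + Wf h) = z * dT b e /\
  dof_tn v o chi e (def (AF a b om) + Wf h) = z * dN b (Om a b om) e.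
Proof.
move=> hchi; have [z z0 hz] := dof_chi_data hv e hchi; exists z => // a b om h.
have [A0 [A1 [B0 [B1 [G [hd <- <- _ _]]]]]] := edge_data_A1 a b om h e.
exact: hz hd.
Qed.

(** Edge data are determined by the field, here the zero field. Thus [def a + w = 0] gives the
    hypotheses of [A1_core]. *)
Lemma edge_data0 e A0 A1 B0 B1 G : edge_data v o e 0 A0 A1 B0 B1 G ->
  [/\ A0 = 0, A1 = 0, B0 = 0, B1 = 0 & G = 0].
Proof.
move=> [h1 h2 h3 h4].
have Z t n : (fun x : plane => dotv ((0 : 'I_3 -> plane -> 'M[R]_2) e x *m t) n : R^o) = cst 0.
  by apply/funext => x; rewrite /= mul0mx dotvE !mxE; ring.
have ET : tt v o e 0 = cst 0 by exact: Z.
have EN : tn v o e 0 = cst 0 by exact: Z.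
have a0 := h1 0; have a1 := h1 1; have b0 := h2 0; have b1 := h2 1.
rewrite ET /= in a0 a1; rewrite EN /= in b0 b1.
have A00 : A0 = 0 by lra.
have B00 : B0 = 0 by lra.
split => //; [lra|lra|].
have [_ <-] := h4 0; rewrite ET.
have [_ ->] := @is_derive_cst R plane R^o (0 : R) (edge_pt v o e 0) (nu e).
by [].
Qed.

(** The sign between the direction of [tau e] and the cyclic order; it enters twice in the increment
    formulas and cancels. *)
Definition sg e : R := if o e then -1 else 1.

Lemma sgK e : sg e * sg e = 1. Proof. by rewrite /sg; case: (o e); ring. Qed.

Lemma sg_diff (a : 'I_3 -> plane) e :
  a (ve e) - a (vs e) = sg e *: (a (ordS (ordS e)) - a (ordS e)).
Proof.
by rewrite /sg /vs /ve; case: (o e); rewrite ?scale1r// scaleN1r opprB.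
Qed.

Lemma evec_tau e i : evec e i 0 = sg e * len e * tau e i 0.
Proof.
have := congr1 (fun y : plane => y i 0) (tauE o hv e); rewrite (sg_diff v).
rewrite mxE [in X in _ = X -> _]mxE => H.
by rewrite -mulrA H mulrA sgK mul1r.
Qed.

Lemma frame e (x : plane) i : x i 0 = dotv (tau e) x * tau e i 0 + dotv (nu e) x * nu e i 0.
Proof.
have [n0 n1] := nuE v o e; have t1 := tau1 o hv e.
rewrite !dotvE n0 n1; case: (ord2_cases i) => ->; rewrite -[LHS]mul1r -t1 ?n0 ?n1; ring.
Qed.

(** The three edge vectors span the plane, so up to a factor their only linear relation is that they
    add up to zero. *)
Lemma om_cst (O : 'I_3 -> R) : (forall i, \sum_e O e * evec e i 0 = 0) ->
  forall l, O l = O 0.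
Proof.
move=> H.
have Ev i : evec 0 i 0 = - evec (ordS 0) i 0 - evec (ordS (ordS 0)) i 0.
  by rewrite /evec !ordS3 !mxE; ring.
have D : evec (ordS 0) 0 0 * evec (ordS (ordS 0)) 1 0 - evec (ordS (ordS 0)) 0 0 * evec (ordS 0) 1 0 != 0.
  have := hv; rewrite (areaE v 0); congr (_ != 0); rewrite /evec /det2 !ordS3 !mxE; ring.
have F i : evec (ordS 0) i 0 * (O (ordS 0) - O 0) + evec (ordS (ordS 0)) i 0 * (O (ordS (ordS 0)) - O 0) = 0.
  by rewrite -[RHS](H i) (sum3 _ 0) Ev; ring.
have [/eqP + /eqP] := cramer0 (p := evec (ordS 0) 0 0) (q := evec (ordS (ordS 0)) 0 0)
   (r := evec (ordS 0) 1 0) (s := evec (ordS (ordS 0)) 1 0) D (F 0) (F 1).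
rewrite !subr_eq0 => /eqP e1 /eqP e2.
by apply: (ordS_all (k := 0)).
Qed.

Lemma RM_AF (al : plane) (be : R) :
  AF (fun l => al + be *: rot (v l)) (fun=> 0) (fun=> 0) = fun _ x => al + be *: rot x.
Proof.
apply/funext => k; apply/funext => x; apply/colP => i; rewrite mxE.
rewrite /Sf big1 ?addr0; last by move=> l _; rewrite oppr0 !mul0r.
rewrite mul0r addr0 /Pol (sum3 _ 0) !mxE.
have P0 := congr1 (fun y : plane => y 0 0) (lam_pt hv 0 x).
have P1 := congr1 (fun y : plane => y 1 0) (lam_pt hv 0 x).
have S := lam_sum hv 0 x; rewrite !mxE in P0 P1.
rewrite -[in RHS](mulr1 (al i 0)) -[in RHS]S; case: ifP => _; rewrite ?[in RHS]P0 ?[in RHS]P1; ring.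
Qed.

Lemma RM_cPol (al : plane) (be : R) x :
  cPol v (fun l => al + be *: rot (v l)) (fun=> 0) x = 2 * be.
Proof.
rewrite /cPol /dPol !(sum3 _ 0) !mxE /= /dlam /evec /det2 !ordS3 !mxE /=.
have := hv; rewrite (areaE v 0) /det2 !mxE => h; by field.
Qed.

Lemma def_RM (al : plane) (be : R) : def (fun _ x => al + be *: rot x) = 0.
Proof.
apply/funext => k; apply/funext => x; apply/matrixP => i j; rewrite !mxE.
have A (m : 'I_2) : affine_fun (fun y : plane => (al + be *: rot y) m 0).
  have [->|->] := ord2_cases m.
    by exists 0, (- be), (al 0 0) => y; rewrite !mxE /=; ring.
  by exists be, 0, (al 1 0) => y; rewrite !mxE /=; ring.
rewrite !(affine_partial _ _ (A _)) !mxE.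
by case: (ord2_cases i) => ->; case: (ord2_cases j) => -> /=; field.
Qed.

(** Shared by two arguments: the representation of the zero field, which gives directness and the
    kernel of [def], and the injectivity of the degrees of freedom. *)
Lemma A1_core a b om h : let O := Om a b om in
  (forall e, [/\ dT b e = 0, dN b O e = 0, X1 a e = 0, X2 O h e = 0 & X3 a O h e = 0]) ->
  (forall e, h e = 0) /\ RM (AF a b om).
Proof.
move=> O H.
have L0 e := len_neq0 o hv e.
have gE e : len e * gW h e = (O (ve e) - O (vs e)) / 2.
  by have [_ _ _ + _] := H e; rewrite /X2 => E; lra.
(* [X1 = 0] removes the tangential part of the increment. By [X2 = 0] the term of [X3] with [gW] is
   a quarter of [len e] times the difference of [O]; subtracted from half the value at the end of
   the edge it leaves a quarter of the sum. *)
have dE e i : a (ordS (ordS e)) i 0 - a (ordS e) i 0 = (O (ordS e) + O (ordS (ordS e))) / 4 *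
     (if i == 0 then - evec e 1 0 else evec e 0 0).
  have [_ _ x1 _ x3] := H e.
  have Nu : dotv (nu e) (a (ve e) - a (vs e)) = len e * (O (ve e) + O (vs e)) / 4.
    move: x3; rewrite /X3; have := gE e => G1 G2.
    have : gW h e * len e ^+ 2 = len e * ((O (ve e) - O (vs e)) / 2) by rewrite -G1; ring.
    by move=> G3; lra.
  have OO : O (ve e) + O (vs e) = O (ordS e) + O (ordS (ordS e)).
    by rewrite /vs /ve; case: (o e) => //; rewrite addrC.
  have := frame e (a (ve e) - a (vs e)) i; rewrite Nu; move: x1; rewrite /X1 => ->.
  rewrite sg_diff OO mxE [(_ - _ : plane) i 0]mxE [(- _ : plane) i 0]mxE mul0r add0r => E.
  have sgT (z : R) : z = sg e * (sg e * z) by rewrite mulrA sgK mul1r.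
  rewrite [LHS]sgT E !evec_tau.
  by have [n0 n1] := nuE v o e; have [->|->] := ord2_cases i;
    rewrite /= ?n0 ?n1; ring.
have Oc : forall l, O l = O 0.
  apply: om_cst => i.
  pose F (m : 'I_2) e := if m == 0 then - evec e 1 0 else evec e 0 0.
  (* The sum of [O] over the two endpoints is the total minus [O e], and the rotated edges add up to
     zero; so closing the increments around [T] leaves the relation for [O e]. *)
  have Z (m : 'I_2) : \sum_e O e * F m e = 0.
    have SE : F m (ordS (ordS 0)) = - F m 0 - F m (ordS 0).
      by rewrite /F /evec !ordS3 !mxE; case: ifP => _; ring.
    have D2 := dE 0 m; have D0 := dE (ordS 0) m; have D1 := dE (ordS (ordS 0)) m.
    rewrite -/(F m _) !ordS3 in D0 D1 D2; rewrite -/(F m _) in D1; rewrite -/(F m _) in D2.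
    rewrite (sum3 _ 0) SE; rewrite SE in D1; lra.
  have [->|->] := ord2_cases i.
    exact: (Z 1).
  apply/eqP; rewrite -oppr_eq0 -sumrN; apply/eqP; rewrite -[RHS](Z 0); apply: eq_bigr => e _.
  by rewrite /= mulrN.
split=> [e|].
  have E := gE e; rewrite (Oc (ve e)) (Oc (vs e)) subrr mul0r in E.
  have nz : len e * (dlam e (nu e) / lam v e c) / len e ^+ 2 != 0.
    exact: mulf_neq0 (mulf_neq0 (L0 e) (mulf_neq0 (dlam_nu o hv hc e) (invr_neq0 (cneq0 e))))
      (invr_neq0 (expf_neq0 2 (L0 e))).
  by apply: (mulfI nz); rewrite mulr0 -[RHS]E /gW; ring.
have b0 e : b e = 0.
  have [t1 t2 _ _ _] := H e.
  have q0 : - 2 / len e ^+ 2 != 0.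
    by rewrite mulf_neq0// ?oppr_eq0 ?invr_eq0 ?expf_neq0// pnatr_eq0.
  rewrite /dN (Oc (ve e)) (Oc (vs e)) subrr mul0r subr0 in t2.
  move/eqP: t1; rewrite /dT mulf_eq0 (negbTE q0) /= => /eqP t1.
  move/eqP: t2; rewrite mulf_eq0 (negbTE q0) /= => /eqP t2.
  by apply/colP => i; rewrite (frame e (b e) i) t1 t2 !mul0r addr0 mxE.
(* The curl of [al + be *: rot x] is [2 * be]. *)
pose be := O 0 / 2; pose al : plane := a 0 - be *: rot (v 0).
have aE : a = fun l => al + be *: rot (v l).
  apply/funext; apply: (ordS_all (k := 0)); apply/colP => i; rewrite /al /be !mxE.
  - by ring.
  - have := dE (ordS (ordS 0)) i; rewrite !ordS3 !Oc /evec !ordS3 !mxE.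
    by case: ifP => _ E; lra.
  - have := dE (ordS 0) i; rewrite !ordS3 !Oc /evec !ordS3 !mxE.
    by case: ifP => _ E; lra.
have bE : b = fun=> 0 by apply/funext => e; rewrite b0.
have omE : om = fun=> 0.
  apply/funext => l; have := Oc l; rewrite /O /Om aE bE !RM_cPol => E.
  have : O 0 = 2 * be by rewrite /be; field.
  rewrite -(Oc l) /O /Om aE bE RM_cPol => E2; lra.
by exists al, be; rewrite aE bE omE RM_AF.
Qed.

End DofsA1.

Section Basis.
Variables (R : realType) (V : lmodType R) (A : set V) (I : finType) (b : I -> V).
Hypothesis hb : is_basis A b.

Lemma basis_mem i : A (b i).
Proof.
have [_ <-] := hb; exists [ffun j => (j == i)%:R] => //.
rewrite (bigD1 i)//= ffunE eqxx scale1r big1 ?addr0// => j ji.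
by rewrite ffunE (negbTE ji) scale0r.
Qed.

Lemma basis_coord u : A u -> exists k : I -> R, u = \sum_i k i *: b i.
Proof. by have [_ <-] := hb => -[k _ <-]; exists k. Qed.

Lemma basis_uniq (k k' : I -> R) : \sum_i k i *: b i = \sum_i k' i *: b i -> k =1 k'.
Proof.
have [inj _] := hb => E i.
have := inj (finfun k) (finfun k') => /=.
have F (f : I -> R) : \sum_j (finfun f) j *: b j = \sum_j f j *: b j.
  by apply: eq_bigr => j _; rewrite ffunE.
by rewrite !F => /(_ E) /ffunP/(_ i); rewrite !ffunE.
Qed.

End Basis.

(** * Unisolvence on [A1], directness of the sum and kernel of [def] *)

Section UnisolvenceA1.
Variable R : realType.
Local Notation plane := (plane R).
Variables (v : 'I_3 -> plane) (c : plane) (o : 'I_3 -> bool).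
Hypothesis hv : area v != 0.
Hypothesis hc : forall l, 0 < lam v l c.
Local Notation AF := (AF v c).
Local Notation Wf := (Wf v c).
Local Notation dlam := (dlam v).
Local Notation evec := (evec v).
Local Notation cneq0 := (cneq0 hc).
Local Notation tau := (tau v o).
Local Notation nu := (nu v o).
Local Notation len := (len v o).
Local Notation vs := (vs o).
Local Notation ve := (ve o).
Local Notation Om := (Om v).
Local Notation X1 := (X1 v o).
Local Notation X2 := (X2 v c o).
Local Notation X3 := (X3 v c o).
Local Notation dT := (dT v o).
Local Notation dN := (dN v o).

Lemma def_AF_comb r a b om a' b' om' :
  r *: def (AF a b om) + def (AF a' b' om') = def (r *: AF a b om + AF a' b' om').
Proof.
rewrite AF_comb; apply/funext => k; apply/funext => x; apply/matrixP => i j; rewrite /= !mxE /partial.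
by rewrite !(AF_derive hv hc) /dSf /dPol !(sum3 _ 0) !mxE; field; exact: cneq0.
Qed.

Lemma Wf_comb r h h' : r *: Wf h + Wf h' = Wf (fun l => r * h l + h' l).
Proof.
apply/funext => k; apply/funext => x; apply/matrixP => i j; rewrite /= !mxE.
rewrite /Sf /Pol !(sum3 _ 0) /SW /form /rW; ring.
Qed.

Lemma Wf0 : Wf (fun=> 0) = 0.
Proof.
apply/funext => k; apply/funext => x; apply/matrixP => i j; rewrite /= !mxE.
rewrite /Sf /Pol !(sum3 _ 0) /SW /form /rW; ring.
Qed.

Lemma A1P u : A1 v c o u <-> exists a b om h, u = def (AF a b om) + Wf h.
Proof.
split=> [[_ [_ [/(A0_struct hv hc)[a [b [om ->]]] /(W_struct hv hc)[h ->] ->]]]|[a [b [om [h ->]]]]].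
  by exists a, b, om, h.
by exists (AF a b om), (Wf h); split => //; [exact: A0_AF|exact: W_Wf].
Qed.

Lemma A1_eq0 a b om h : def (AF a b om) + Wf h = 0 -> (forall e, h e = 0) /\ RM (AF a b om).
Proof.
move=> E; apply: (A1_core hv hc (o := o)) => e.
have [A0 [A1 [B0 [B1 [G [hd h1 h2 h3 [h4 h5]]]]]]] := edge_data_A1 o hv hc a b om h e.
rewrite E in hd; have [a0 a1 b0 b1 g0] := edge_data0 hd.
by rewrite -h1 -h2 -h3 -h4 -h5 a0 a1 b0 b1 g0 !mul0r !addr0 subrr mulr0 oppr0.
Qed.

Lemma A1_comb_AF r a b om h a' b' om' h' :
  r *: (def (AF a b om) + Wf h) + (def (AF a' b' om') + Wf h') =
  def (AF (fun l => r *: a l + a' l) (fun l => r *: b l + b' l) (fun l => r * om l + om' l)) +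
  Wf (fun l => r * h l + h' l).
Proof. by rewrite scalerDr addrACA def_AF_comb AF_comb Wf_comb. Qed.

Lemma OmD r a b om a' b' om' l :
  Om (fun l => r *: a l + a' l) (fun l => r *: b l + b' l) (fun l => r * om l + om' l) l =
    r * Om a b om l + Om a' b' om' l.
Proof. by rewrite /Om /cPol /dPol !(sum3 _ 0) !mxE; ring. Qed.

Lemma dotvD (x y z : plane) r : dotv x (r *: y + z) = r * dotv x y + dotv x z.
Proof. by rewrite !dotvE !mxE; ring. Qed.

(* The increments [rho e + ...] close up around the triangle, for some choice of
   the [O l], because two of the [evec e] form a basis of the plane. *)
Lemma gap_solve (rho : 'I_3 -> plane) : exists (O : 'I_3 -> R) (a : 'I_3 -> plane), forall e,
  a (ordS (ordS e)) - a (ordS e) = rho e + ((O (ordS e) + O (ordS (ordS e))) / 4) *: rot (evec e).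
Proof.
have [s Es] : exists s : 'I_2 -> R, forall i, rho 0 i 0 + rho (ordS 0) i 0 + rho (ordS (ordS 0)) i 0 = s i.
  by exists (fun i => rho 0 i 0 + rho (ordS 0) i 0 + rho (ordS (ordS 0)) i 0).
(* The corrections add up to [- rot (\sum_e B e *: evec e) / 4], which must cancel the gap [s]; so
   [w], the value required of this sum, satisfies [rot w = 4 s]. *)
have [w w0 w1] : exists2 w : plane, w 0 0 = 4 * s 1 & w 1 0 = - (4 * s 0).
  by exists (\col_i (if i == 0 then 4 * s 1 else - (4 * s 0))); rewrite mxE.
(* Constants in [B] do not change the sum, so [B 0] is set to 0; the other two are the coordinates
   of [w] in two edges. *)
have [B [Q0 Qa Qb]] : exists B : 'I_3 -> R, [/\ B 0 = 0, B (ordS 0) = - dlam (ordS (ordS 0)) w &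
    B (ordS (ordS 0)) = dlam (ordS 0) w].
  by exists (fun l => if l == 0 then 0 else if l == ordS 0 then - dlam (ordS (ordS 0)) w else dlam (ordS 0) w).
have [del Ed] : exists del : 'I_3 -> plane,
    forall e, del e = rho e + ((B (ordS e) + B (ordS (ordS e))) / 4) *: rot (evec e).
  by eexists => e; reflexivity.
have [a [a0 a1 a2]] : exists a : 'I_3 -> plane, [/\ a 0 = 0, a (ordS 0) = del (ordS (ordS 0)) &
    a (ordS (ordS 0)) = - del (ordS 0)].
  by exists (fun l => if l == 0 then 0 else if l == ordS 0 then del (ordS (ordS 0)) else - del (ordS 0)).
exists B, a => e; rewrite -Ed; move: e; apply: (ordS_all (k := 0)); rewrite ?ordS3 ?a0 ?a1 ?a2.
2: by rewrite sub0r opprK.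
2: by rewrite subr0.
have dE e i : del e i 0 = rho e i 0 + (B (ordS e) + B (ordS (ordS e))) / 4 * (if i == 0 then - evec e 1 0 else evec e 0 0).
  by rewrite Ed 3!mxE.
have Ev i : evec 0 i 0 = - evec (ordS 0) i 0 - evec (ordS (ordS 0)) i 0.
  by rewrite /evec !ordS3 !mxE; ring.
have Ew i : w i 0 = B (ordS 0) * evec (ordS 0) i 0 + B (ordS (ordS 0)) * evec (ordS (ordS 0)) i 0.
  by rewrite Qa Qb; exact: evec_expand.
have R0 i : rho 0 i 0 = s i - rho (ordS 0) i 0 - rho (ordS (ordS 0)) i 0 by rewrite -Es; ring.
have s0 : s 0 = - w 1 0 / 4 by rewrite w1; field.
have s1 : s 1 = w 0 0 / 4 by rewrite w0; field.
have opE (x y : plane) i : (- x - y) i 0 = - x i 0 - y i 0 by rewrite !mxE.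
by apply: planeP; rewrite opE !dE R0 ?s0 ?s1 !Ew /= !Ev !ordS3 Q0; field.
Qed.

Section Dofs.
Variables (m : 'I_3 -> 'I_3 -> (R -> R^o) * R^o) (chi : 'I_3 -> R -> R).
Hypothesis hm : forall e, is_basis (@M R) (m e).
Hypothesis hchi : is_chi v o chi.

Lemma dof1_comb i r u w : A1 v c o u -> A1 v c o w ->
  dof1 v o m chi i (r *: u + w) = r * dof1 v o m chi i u + dof1 v o m chi i w.
Proof.
move=> /A1P[a [b [om [h ->]]]] /A1P[a' [b' [om' [h' ->]]]].
rewrite A1_comb_AF; case: i => [[e l]|[e|e]] /=.
- rewrite !(dof_M_A1 o hv hc)//; try exact: (basis_mem (hm e)).
  have DX : (r *: a (ve e) + a' (ve e)) - (r *: a (vs e) + a' (vs e)) =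
      r *: (a (ve e) - a (vs e)) + (a' (ve e) - a' (vs e)).
    by rewrite scalerBr opprD addrACA.
  by rewrite /Lam /X1 /X2 /X3 !OmD DX !dotvD /gW; ring.
- have [z _ H] := dof_chi_A1 hv hc e hchi.
  have [-> _] := H a b om h; have [-> _] := H a' b' om' h'; have [-> _] := H (fun l => r *: a l + a' l) (fun l => r *: b l + b' l)
    (fun l => r * om l + om' l) (fun l => r * h l + h' l).
  by rewrite /dT dotvD; ring.
- have [z _ H] := dof_chi_A1 hv hc e hchi.
  have [_ ->] := H a b om h; have [_ ->] := H a' b' om' h'; have [_ ->] := H (fun l => r *: a l + a' l) (fun l => r *: b l + b' l)
    (fun l => r * om l + om' l) (fun l => r * h l + h' l).
  by rewrite /dN !OmD dotvD; ring.
Qed.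

Lemma Lam_sum (k : 'I_3 -> R) (f : 'I_3 -> (R -> R^o) * R^o) x1 x2 x3 :
  Lam (\sum_l k l *: f l) x1 x2 x3 = \sum_l k l * Lam (f l) x1 x2 x3.
Proof.
rewrite !(sum3 _ 0) /Lam /=.
have E (s : R) : (k 0 *: (f 0).1 + k (ordS 0) *: (f (ordS 0)).1 + k (ordS (ordS 0)) *: (f (ordS (ordS 0))).1 : R -> R^o) s =
   k 0 * (f 0).1 s + k (ordS 0) * (f (ordS 0)).1 s + k (ordS (ordS 0)) * (f (ordS (ordS 0))).1 s by [].
by rewrite !E -![_ *: _]/(_ * _); ring.
Qed.

(** The elements [mpsi], [mcst], [mlin] of [M] on which [Lam] takes the values [x1], [x2], [x3];
    they mediate between an arbitrary basis [m e] and these numbers. *)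
Definition mcst : (R -> R^o) * R^o := ((fun=> 1), 0).
Definition mlin : (R -> R^o) * R^o := ((fun s => s), 0).
Definition mpsi : (R -> R^o) * R^o := ((fun=> 0), 1).

Lemma M_mcst : M mcst. Proof. by exists 1, 0 => s; rewrite mul0r addr0. Qed.
Lemma M_mlin : M mlin. Proof. by exists 0, 1 => s; rewrite mul1r add0r. Qed.
Lemma M_mpsi : M mpsi. Proof. by exists 0, 0 => s; rewrite mul0r addr0. Qed.

Lemma M_decomp f : M f -> f = f.2 *: mpsi + f.1 0 *: mcst + (f.1 1 - f.1 0) *: mlin.
Proof.
case: f => f1 f2 [al [be h]]; congr (_, _).
  apply/funext => s; rewrite -[RHS]/(f2 * 0 + f1 0 * 1 + (f1 1 - f1 0) * s).
  by rewrite /= in h; rewrite !h; ring.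
by rewrite -[RHS]/(f2 * 1 + f1 0 * 0 + (f1 1 - f1 0) * 0) /=; ring.
Qed.

Lemma Lam_inj e x1 x2 x3 : (forall l, Lam (m e l) x1 x2 x3 = 0) -> [/\ x1 = 0, x2 = 0 & x3 = 0].
Proof.
move=> H.
have Z f : M f -> Lam f x1 x2 x3 = 0.
  move=> /(basis_coord (hm e))[k ->]; rewrite Lam_sum big1// => l _.
  by rewrite H mulr0.
have := Z _ M_mcst; have := Z _ M_mlin; have := Z _ M_mpsi; rewrite /Lam /=.
by move=> h1 h2 h3; split; lra.
Qed.

(** The prescribed values on the basis [m e] extend to a linear form on [M]; [x1], [x2], [x3] are
    its values on [mpsi], [mcst] and [mlin]. *)
Lemma Lam_surj e (k : 'I_3 -> R) : exists x1 x2 x3, forall l, Lam (m e l) x1 x2 x3 = k l.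
Proof.
have [d1 E1] := basis_coord (hm e) M_mpsi.
have [d2 E2] := basis_coord (hm e) M_mcst.
have [d3 E3] := basis_coord (hm e) M_mlin.
exists (\sum_l d1 l * k l), (\sum_l d2 l * k l), (\sum_l d3 l * k l) => l.
pose x := (m e l).2; pose y := (m e l).1 0; pose z := (m e l).1 1 - (m e l).1 0.
have D : \sum_j (l == j)%:R *: m e j = \sum_j (x * d1 j + y * d2 j + z * d3 j) *: m e j.
  rewrite (bigD1 l)//= eqxx scale1r big1 ?addr0; last first.
    by move=> j jl; rewrite eq_sym (negbTE jl) scale0r.
  rewrite [LHS](M_decomp (basis_mem (hm e) l)) -/x -/y -/z E1 E2 E3 !scaler_sumr -!big_split /=.
  by apply: eq_bigr => j _; rewrite !(scalerDl (m e j)) !scalerA.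
have := basis_uniq (hm e) D => U.
rewrite /Lam -/x -/y -/z !mulr_sumr -!big_split /=.
rewrite (bigD1 l)//= big1 ?addr0 => [|j jl].
  by have := U l; rewrite eqxx => U1; rewrite -[RHS]mul1r -[1]/(true%:R) U1; ring.
have := U j; rewrite eq_sym (negbTE jl) => U0.
transitivity ((x * d1 j + y * d2 j + z * d3 j) * k j); first by ring.
by rewrite -U0 mul0r.
Qed.

Lemma A1_dofs_inj u : A1 v c o u -> (forall i, dof1 v o m chi i u = 0) -> u = 0.
Proof.
move=> /A1P[a [b [om [h ->]]]] H.
have [h0 [al [be rE]]] : (forall e, h e = 0) /\ RM (AF a b om).
  apply: (A1_core hv hc (o := o)) => e.
  have [|x1 x2 x3] := @Lam_inj e (X1 a e) (X2 (Om a b om) h e) (X3 a (Om a b om) h e).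
    move=> l; rewrite -(dof_M_A1 o hv hc e a b om h (basis_mem (hm e) l)).
    exact: (H (inl (e, l))).
  have [z z0 Hz] := dof_chi_A1 hv hc e hchi; have [t1 t2] := Hz a b om h.
  split=> //; apply: (mulfI z0); rewrite mulr0.
  - by rewrite -t1; exact: (H (inr (inl e))).
  - by rewrite -t2; exact: (H (inr (inr e))).
by rewrite rE def_RM add0r -[RHS]Wf0; congr (Wf _); apply/funext => e.
Qed.

Lemma A1_dofs_surj k : exists2 u, A1 v c o u & forall i, dof1 v o m chi i u = k i.
Proof.
have /choice[x1 /choice[x2 /choice[x3 hx]]] := fun e => Lam_surj e (fun l => k (inl (e, l))).
have /choice[z hz] : forall e, exists z, z != 0 /\ forall a b om h,
    dof_tt v o chi e (def (AF a b om) + Wf h) = z * dT b e /\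
    dof_tn v o chi e (def (AF a b om) + Wf h) = z * dN b (Om a b om) e.
  by move=> e; have [z z0 H] := dof_chi_A1 hv hc e hchi; exists z.
have L0 e := len_neq0 o hv e.
(* Eliminating [gW] between [X2] and [X3] leaves [len e / 4] times the sum of [O] over the
   endpoints, minus [Y e], as the normal part of the increment of [a]; the tangential part is
   [x1 e]. *)
pose Y e := x3 e - len e / 2 * x2 e.
pose rho (e : 'I_3) : plane := sg R o e *: (x1 e *: tau e - Y e *: nu e).
have /= := gap_solve rho; case=> O [a da].
pose p e := - (k (inr (inl e)) / z e) * len e ^+ 2 / 2.
pose q e := - (k (inr (inr e)) / z e + (O (ve e) - O (vs e)) / (2 * len e)) * len e ^+ 2 / 2.
pose b e := p e *: tau e + q e *: nu e.
pose om l := O l - cPol v a b (v l).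
have OmE : Om a b om = O by apply/funext => l; rewrite /Om /om addrC subrK.
(* With [O] known, [X2] is solved for [gW] and hence for [h]. *)
pose h e := ((O (ve e) - O (vs e)) / 2 - x2 e) / len e * len e ^+ 2 / (dlam e (nu e) / lam v e c).
have gE e : gW v c o h e = ((O (ve e) - O (vs e)) / 2 - x2 e) / len e.
  by rewrite /gW /h; field; rewrite L0 cneq0 (dlam_nu o hv hc).
have aE e : a (ve e) - a (vs e) = x1 e *: tau e + (len e * (O (ve e) + O (vs e)) / 4 - Y e) *: nu e.
  have OO : O (ve e) + O (vs e) = O (ordS e) + O (ordS (ordS e)).
    by rewrite /vs /ve; case: (o e) => //; rewrite addrC.
  rewrite sg_diff da /rho OO.
  have -> : rot (evec e) = (sg R o e * len e) *: nu e.
    apply/colP => i; rewrite [LHS]mxE [RHS]mxE !(evec_tau o hv).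
    have [n0 n1] := nuE v o e.
    by have [->|->] := ord2_cases i;
      rewrite /= ?n0 ?n1 ?mulrN.
  move: (tau e) (nu e) (Y e) => t n y.
  rewrite -[RHS]scale1r -(sgK R o e); apply/colP => i; rewrite !mxE; ring.
have fr e : [/\ dotv (tau e) (tau e) = 1, dotv (tau e) (nu e) = 0, dotv (nu e) (tau e) = 0 & dotv (nu e) (nu e) = 1].
  have [n0 n1] := nuE v o e; have t1 := tau1 o hv e; rewrite !dotvE n0 n1.
  by split; rewrite -?t1; ring.
exists (def (AF a b om) + Wf h); first by apply/A1P; exists a, b, om, h.
move=> [[e l]|[e|e]] /=.
- rewrite (dof_M_A1 o hv hc _ _ _ _ _ (basis_mem (hm e) l)) -hx OmE; have [f1 f2 f3 f4] := fr e.
  have -> : X1 a e = x1 e by rewrite /X1 aE dotv_comb f1 f2; ring.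
  have E2 : X2 O h e = x2 e by rewrite /X2 gE; field.
  have -> : X3 a O h e = x3 e by rewrite /X3 aE dotv_comb f3 f4 gE /Y; field.
  by rewrite E2.
- have [z0 H] := hz e; have [-> _] := H a b om h; have [f1 f2 f3 f4] := fr e.
  by rewrite /dT /b dotv_comb f1 f2 /p; field; rewrite z0 L0.
- have [z0 H] := hz e; have [_ ->] := H a b om h; have [f1 f2 f3 f4] := fr e.
  by rewrite OmE /dN /b dotv_comb f3 f4 /q; field; rewrite z0 L0.
Qed.

Lemma A1_unisolvent : has_dim (A1 v c o) 15 /\ unisolvent (A1 v c o) (dof1 v o m chi).
Proof.
apply: unisolvent_of_bij.
- apply/A1P; exists (fun=> 0), (fun=> 0), (fun=> 0), (fun=> 0).
  rewrite Wf0 addr0 -(def_RM 0 0); congr def.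
  rewrite -(RM_AF c hv); congr (AF _ _ _); apply/funext => l; by rewrite scale0r addr0.
- move=> r u w /A1P[a [b [om [h ->]]]] /A1P[a' [b' [om' [h' ->]]]].
  by apply/A1P; rewrite A1_comb_AF; do 4 eexists.
- by move=> i r u w hu hw; exact: dof1_comb.
- exact: A1_dofs_inj.
- exact: A1_dofs_surj.
- by rewrite !card_sum !card_prod !card_ord.
Qed.

End Dofs.

(** A common element is both a [def (AF a b om)] and a [Wf h], so [A1_eq0] with [- h] applies. *)
Lemma A1_direct : @def R @` A0 v c `&` W v c o = [set 0].
Proof.
apply/seteqP; split => [u [[a0 /(A0_struct hv hc)[a [b [om ->]]] E] /(W_struct hv hc)[h hE]]|_ ->].
  have [h0 _] : (forall e, - h e = 0) /\ RM (AF a b om).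
    have F := Wf_comb (-1) h (fun=> 0); rewrite Wf0 addr0 in F.
    apply: (@A1_eq0 a b om (fun e => - h e)); rewrite E hE.
    rewrite (_ : (fun e => - h e) = (fun l => -1 * h l + 0)); last by apply/funext => l; rewrite mulN1r addr0.
    by rewrite -F scaleN1r subrr.
  rewrite hE /= -Wf0; congr (Wf _); apply/funext => e; apply/eqP; rewrite -oppr_eq0; exact/eqP.
split; last by rewrite -Wf0; exact: W_Wf.
by exists (fun _ x => 0 + 0 *: rot x); [rewrite -(RM_AF c hv); exact: A0_AF|exact: def_RM].
Qed.

Lemma def_ker : [set u | A0 v c u /\ def u = 0] = @RM R.
Proof.
apply/seteqP; split => [u [/(A0_struct hv hc)[a [b [om ->]]] E]|_ [al [be ->]]].
  by apply: (proj2 (@A1_eq0 a b om (fun=> 0) _)); rewrite Wf0 addr0.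
by split; [rewrite -(RM_AF c hv); exact: A0_AF|exact: def_RM].
Qed.

End UnisolvenceA1.

(** * A2 and exactness *)

Section Exactness.
Variable R : realType.
Local Notation plane := (plane R).
Variables (v : 'I_3 -> plane) (c : plane) (o : 'I_3 -> bool).
Hypothesis hv : area v != 0.
Hypothesis hc : forall l, 0 < lam v l c.
Local Notation AF := (AF v c).
Local Notation Wf := (Wf v c).
Local Notation lam := (lam v).
Local Notation K := (K v c).
Local Notation cneq0 := (cneq0 hc).

Lemma affine_par f (a b d : plane) s t : affine_fun f ->
  f (par a b d s t) = (1 - s - t) * f a + s * f b + t * f d.
Proof. by move=> [p [q [r h]]]; rewrite !h /par !mxE; ring. Qed.

(** The vertex rule, exact for affine functions; the 6 combines the average of three values with the
    half in the area of a triangle. *)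
Lemma plane_int_affine (a b d : plane) f : det2 (b - a) (d - a) != 0 -> affine_fun f ->
  plane_int (tri a b d) f = `|det2 (b - a) (d - a)| / 6 * (f a + f b + f d).
Proof.
move=> nz af; rewrite plane_int_tri//; last exact: continuous_affine.
rewrite -mulrA; congr (_ * _).
transitivity (\int[@lebesgue_measure R]_(t in `[0, 1])
   (((f a + f b) / 2 + (f d - f a - f b) * t) + ((f a + f b) / 2 - f d) * t ^+ 2)).
  apply: eq_Rintegral => t; rewrite inE /= in_itv /= => /andP[_ t1].
  rewrite (@int_quad R _ ((1 - t) * f a + t * f d) (f b - f a) 0); first by field.
    by rewrite subr_ge0.
  by move=> s; rewrite affine_par//; ring.
rewrite (@int_quad R 1 ((f a + f b) / 2) (f d - f a - f b) ((f a + f b) / 2 - f d)) ?ler01//.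
by field.
Qed.

Lemma A2P (q : 'I_3 -> plane -> R^o) : A2 q <-> exists r : 'I_3 -> R, q = fun k _ => r k.
Proof.
split=> [h|[r ->] k]; last by apply/poly0P; exists (r k).
have /choice[r hr] : forall k, exists r, forall x, q k x = r by move=> k; apply/poly0P; exact: h.
by exists r; apply/funext => k; apply/funext => x; rewrite hr.
Qed.

Definition mean (r : 'I_3 -> R) (f : plane -> R) : R :=
  `|area v| / 6 * \sum_k r k * lam k c * (f c + f (v (ordS k)) + f (v (ordS (ordS k)))).

Lemma pw_int_mean r f : affine_fun f -> pw_int v c (fun k x => r k * f x) = mean r f.
Proof.
move=> af; rewrite /mean mulr_sumr; apply: eq_bigr => k _.
rewrite (plane_intZ hv hc); last exact: continuous_affine.
rewrite (K_tri v c k) plane_int_affine//; last exact: area_K_neq0.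
by rewrite area_K// normrM (gtr0_norm (hc k)); field.
Qed.

(** [lam l] takes the values [lam l c], 0, 1 on the corners of two pieces, while on [K l] both outer
    values are 0. Against the weighted sum this leaves a rank-one term and a diagonal one. *)
Lemma mean_lam r l : mean r (lam l) =
  `|area v| / 6 * ((\sum_k r k * lam k c) * (lam l c + 1) - r l * lam l c).
Proof.
have [n1 n2 n3 n4 [n5 n6]] := ordS_neq l.
rewrite /mean !(sum3 _ l) !ordS3 !(lam_v hv) !eqxx n3 n4 ?mulr0n ?mulr1n; congr (_ * _); ring.
Qed.

Lemma mean_comb r (I : Type) (s : seq I) (k : I -> R) (f : I -> plane -> R^o) :
  mean r (\sum_(i <- s) k i *: f i) = \sum_(i <- s) k i * mean r (f i).
Proof.
elim: s => [|i s IH].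
  rewrite !big_nil /mean big1 ?mulr0// => j _.
  by rewrite -[X in _ * X]/(0 + 0 + 0 : R) !addr0 mulr0.
rewrite !big_cons -IH /mean !(sum3 _ 0).
set g := \sum_(j <- s) _.
have E x : (k i *: f i + g) x = k i * f i x + g x by [].
rewrite !E; ring.
Qed.

Lemma affine_lam_sum (f : plane -> R^o) : affine_fun f -> f = \sum_l (f (v l) : R) *: (lam l : plane -> R^o).
Proof.
move=> af; apply/funext => x; rewrite fct_sumE.
have E l : ((f (v l) : R) *: (lam l : plane -> R^o)) x = f (v l) * lam l x by [].
rewrite (sum3 _ 0) !E; have [p [q [r h]]] := af.
have P0 := congr1 (fun y : plane => y 0 0) (lam_pt hv 0 x).
have P1 := congr1 (fun y : plane => y 1 0) (lam_pt hv 0 x).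
rewrite !mxE in P0 P1; rewrite !h {1}P0 {1}P1.
have Se : r * (lam 0 x + lam (ordS 0) x + lam (ordS (ordS 0)) x) = r by rewrite lam_sum// mulr1.
by rewrite -{1}Se; ring.
Qed.

Lemma area6 : `|area v| / 6 != 0.
Proof. by rewrite mulf_neq0 ?invr_eq0 ?normr_eq0 ?hv ?pnatr_eq0. Qed.

Lemma A2_unisolvent (p : 'I_3 -> plane -> R^o) : is_basis (@P1 R) p ->
  has_dim (@A2 R) 3 /\ unisolvent (@A2 R) (dof2 v c p).
Proof.
move=> hp.
have ap i : affine_fun (p i) by apply/poly1P; exact: (basis_mem hp i).
have Pl l : @P1 R (lam l) by apply/poly1P; exact: lam_affine.
have dofE i r : dof2 v c p i (fun k _ => r k) = mean r (p i) by exact: pw_int_mean.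
apply: unisolvent_of_bij.
- by apply/A2P; exists (fun=> 0).
- by move=> a u w /A2P[r ->] /A2P[r' ->]; apply/A2P; exists (fun k => a * r k + r' k).
- move=> i a u w /A2P[r ->] /A2P[r' ->].
  rewrite -[_ *: _ + _]/(fun (k : 'I_3) (_ : plane) => a * r k + r' k : R^o) !dofE /mean !(sum3 _ 0); ring.
- move=> u /A2P[r ->] H.
  have Z l : mean r (lam l) = 0.
    have [k E] := basis_coord hp (Pl l); rewrite E mean_comb big1// => i _.
    by rewrite -dofE H mulr0.
  have Y l : (\sum_k r k * lam k c) * (lam l c + 1) = r l * lam l c.
    by have /eqP := Z l; rewrite mean_lam mulf_eq0 (negbTE area6) /= subr_eq0 => /eqP.
  (* Summing over [l] gives four times this sum on the left and the sum itself on the right. *)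
  have S0 : \sum_k r k * lam k c = 0.
    have [s Es] : exists s, s = \sum_k r k * lam k c by eexists.
    have y0 := Y 0; have y1 := Y (ordS 0); have y2 := Y (ordS (ordS 0)).
    rewrite -Es in y0 y1 y2 *; rewrite (sum3 _ 0) in Es.
    have S1 : s * (lam 0 c + lam (ordS 0) c + lam (ordS (ordS 0)) c) = s by rewrite lam_sum// mulr1.
    by clear -y0 y1 y2 Es S1; lra.
  apply/funext => k; apply/funext => x; apply: (mulIf (cneq0 k)).
  by rewrite -[LHS]/(r k * lam k c) -Y S0 !mul0r.
- move=> k.
  have /choice[d hd] := fun l => basis_coord hp (Pl l).
  pose y l := \sum_i d l i * k i.
  pose y' l := y l / (`|area v| / 6).
  (* Summing the three equations shows that the weighted sum of [r] must be a third of the sum of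
     the [y']. *)
  pose s := (y' 0 + y' (ordS 0) + y' (ordS (ordS 0))) / 3.
  pose r l := (s * (lam l c + 1) - y' l) / lam l c.
  exists (fun k _ => r k); first by apply/A2P; exists r.
  have Sr : \sum_k r k * lam k c = s.
    rewrite (sum3 _ 0) /r !divfK ?cneq0//.
    have S1 := lam_sum hv 0 c.
    have E : s * (lam 0 c + lam (ordS 0) c + lam (ordS (ordS 0)) c) = s by rewrite S1 mulr1.
    have E2 : y' 0 + y' (ordS 0) + y' (ordS (ordS 0)) = 3 * s by rewrite /s; field.
    by move: E E2; clear; move: (y' _) (y' _) (y' _) s => *; lra.
  have ml l : mean r (lam l) = y l.
    rewrite mean_lam Sr /r divfK ?cneq0// opprB addrC subrK /y' mulrC divfK//; exact: area6.
  move=> i; rewrite dofE {1}(affine_lam_sum (ap i)) mean_comb.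
  under eq_bigr do rewrite ml /y mulr_sumr.
  rewrite exchange_big /=.
  (* [p i] is expanded in barycentric coordinates and these in [p]; by uniqueness of coordinates the
     product of the two transition matrices is the identity. *)
  have D : \sum_j (i == j)%:R *: p j = \sum_j (\sum_l p i (v l) * d l j) *: p j.
    rewrite (bigD1 i)//= eqxx scale1r big1 ?addr0; last first.
      by move=> j ji; rewrite eq_sym (negbTE ji) scale0r.
    pose pv l : R := p i (v l).
    transitivity (\sum_l pv l *: \sum_j d l j *: p j).
      by rewrite [LHS](affine_lam_sum (ap i)); apply: eq_bigr => l _; congr (_ *: _); exact: hd.
    have F l x : (pv l *: \sum_j d l j *: p j) x = pv l * (d l 0 * p 0 x + d l (ordS 0) * p (ordS 0) x +
        d l (ordS (ordS 0)) * p (ordS (ordS 0)) x) by rewrite (sum3 _ 0).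
    apply/funext => x; rewrite fct_sumE (sum3 _ 0) !F !(sum3 _ 0).
    pose S j : R := pv 0 * d 0 j + pv (ordS 0) * d (ordS 0) j + pv (ordS (ordS 0)) * d (ordS (ordS 0)) j.
    rewrite -[RHS]/(S 0 * p 0 x + S (ordS 0) * p (ordS 0) x + S (ordS (ordS 0)) * p (ordS (ordS 0)) x).
    by rewrite /S; ring.
  have U := basis_uniq hp D.
  rewrite (bigD1 i)//= [X in _ + X]big1 ?addr0 => [|j ji].
    have := U i; rewrite eqxx => U1.
    transitivity ((\sum_l p i (v l) * d l i) * k i); last by rewrite -U1 mul1r.
    by rewrite mulr_suml; apply: eq_bigr => l _; rewrite mulrA.
  have := U j; rewrite eq_sym (negbTE ji) => U0.
  transitivity ((\sum_l p i (v l) * d l j) * k j); last by rewrite -U0 mul0r.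
  by rewrite mulr_suml; apply: eq_bigr => l _; rewrite mulrA.
- by rewrite card_ord.
Qed.

(** A bump inside [K k] sees only the value on that piece. This makes the piecewise constant sven of
    a field well defined. *)
Lemma is_sven_uniq (u : 'I_3 -> plane -> 'M[R]_2) (r r' : 'I_3 -> R) :
  is_sven v c u (fun k _ => r k) -> is_sven v c u (fun k _ => r' k) -> r =1 r'.
Proof.
move=> h h' k; have [phi [tphi off pos]] := bump_K hv hc k.
have cphi : continuous phi by exact: (Cn_continuous (tphi.1 0%N)).
have E (q : 'I_3 -> R) : pw_int v c (fun k x => q k * phi x) = q k * plane_int (K k) phi.
  rewrite /pw_int (bigD1 k)//= (plane_intZ hv hc)// big1 ?addr0// => l lk.
  rewrite -[RHS](mul0r (plane_int (K l) phi)) -(plane_intZ hv hc)//.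
  by apply: eq_Rintegral => x; rewrite inE /= => hx; rewrite (off l _ lk hx) !mulr0.
have := h phi tphi; rewrite (h' phi tphi) !E => /mulIf e; apply/esym/e.
by rewrite gt_eqF.
Qed.

Lemma sven_distD (u w : 'I_3 -> plane -> 'M[R]_2) phi :
  (forall i j k n, Cn n (fun x => u k x i j)) -> (forall i j k n, Cn n (fun x => w k x i j)) ->
  test_function (T v) phi -> sven_dist v c (u + w) phi = sven_dist v c u phi + sven_dist v c w phi.
Proof.
move=> cu cw [sphi _].
have cF (f : 'I_3 -> plane -> 'M[R]_2) : (forall i j k n, Cn n (fun x => f k x i j)) ->
    forall k, continuous (fun x : plane => f k x 0 0 * partial 1 (partial 1 phi) x +
      f k x 1 1 * partial 0 (partial 0 phi) x - f k x 1 0 * partial 0 (partial 1 phi) x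
      - f k x 0 1 * partial 1 (partial 0 phi) x).
  move=> cf k; apply: (@Cn_continuous _ 0).
  have dd i j : Cn 0 (partial i (partial j phi)) by apply: Cn_partial; apply: Cn_partial; exact: sphi.
  by apply: CnB; [apply: CnB; [apply: CnD|]|]; apply: CnM.
rewrite /sven_dist -(pw_intD hv hc)//; [|exact: cF|exact: cF].
apply: eq_pw_int => k x _.
have E i j : (u + w) k x i j = u k x i j + w k x i j by rewrite /= mxE.
rewrite !E; generalize (partial 1 (partial 1 phi) x) (partial 0 (partial 0 phi) x)
  (partial 0 (partial 1 phi) x) (partial 1 (partial 0 phi) x) => *; ring.
Qed.

Lemma def_Cn a b om i j k n : Cn n (fun x => def (AF a b om) k x i j).
Proof.
apply: poly2_Cn; apply: poly2_affine.
have [p [q [r h]]] := poly2_partial_affine j (AF_poly2 c hv a b om k i).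
have [p' [q' [r' h']]] := poly2_partial_affine i (AF_poly2 c hv a b om k j).
by exists ((p + p') / 2), ((q + q') / 2), ((r + r') / 2) => x; rewrite mxE h h'; field.
Qed.

Lemma AF_sven0 a b om phi : test_function (T v) phi -> sven_dist v c (def (AF a b om)) phi = 0.
Proof.
move=> hphi; apply: (sven_dist_def hv hc) => // [i k n|i].
  by apply: poly2_Cn; exact: (AF_poly2 c hv).
have [_ cA _] := A0_AF hv hc a b om.
by move=> j t t01; rewrite (continuous_edge _ cA t01).
Qed.

Lemma A1_is_sven a b om h : is_sven v c (def (AF a b om) + Wf h) (fun k _ => Wq v c h k).
Proof.
move=> phi hphi; rewrite sven_distD//; last 2 first.
- by move=> *; exact: def_Cn.
- by move=> *; apply: poly2_Cn; exact: Wf_poly2.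
by rewrite AF_sven0// add0r; exact: (Wf_is_sven hv hc).
Qed.

Lemma Wq_inj h : (forall k, Wq v c h k = 0) -> forall k, h k = 0.
Proof.
move=> H; pose g k := h k / lam k c.
have E k : (1 - 2 * lam k c) * (\sum_l g l) = 3 * g k.
  have /eqP := H k; rewrite /Wq mulf_eq0 invr_eq0 mulf_eq0 (negbTE (cneq0 k)) expf_eq0 (negbTE hv) /= orbF.
  by rewrite subr_eq0 => /eqP.
have S0 : \sum_l g l = 0.
  have [s Es] : exists s, s = \sum_l g l by eexists.
  have e0 := E 0; have e1 := E (ordS 0); have e2 := E (ordS (ordS 0)).
  rewrite -Es in e0 e1 e2 *; rewrite (sum3 _ 0) in Es.
  have S1 : s * (lam 0 c + lam (ordS 0) c + lam (ordS (ordS 0)) c) = s by rewrite lam_sum// mulr1.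
  by clear -e0 e1 e2 Es S1; lra.
move=> k; have := E k; rewrite S0 mulr0 => /esym/eqP; rewrite mulf_eq0 pnatr_eq0 /=.
by rewrite /g mulf_eq0 invr_eq0 (negbTE (cneq0 k)) orbF => /eqP.
Qed.

Lemma Wq_surj r : exists h, forall k, Wq v c h k = r k.
Proof.
pose rho k := r k * (lam k c * area v ^+ 2).
(* The value that the equations, summed over the pieces, force on the sum of the [g k]. *)
have [G EG] : exists G, G = - (rho 0 + rho (ordS 0) + rho (ordS (ordS 0))) / 2 by eexists.
pose g k := ((1 - 2 * lam k c) * G - rho k) / 3.
have Sg : \sum_l g l = G.
  rewrite (sum3 _ 0) /g; have S1 := lam_sum hv 0 c.
  have E : G * (lam 0 c + lam (ordS 0) c + lam (ordS (ordS 0)) c) = G by rewrite S1 mulr1.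
  move: E EG; clear; move: (rho _) (rho _) (rho _) => *; lra.
exists (fun k => g k * lam k c) => k; rewrite /Wq.
have -> : \sum_l g l * lam l c / lam l c = G.
  by rewrite -Sg; apply: eq_bigr => l _; rewrite mulfK ?cneq0.
by rewrite mulfK ?cneq0// /g /rho; field; rewrite hv cneq0.
Qed.

Lemma A1_sven u : A1 v c o u -> exists! q, A2 q /\ is_sven v c u q.
Proof.
move=> /(A1P o hv hc)[a [b [om [h ->]]]]; exists (fun k _ => Wq v c h k); split.
  by split; [apply/A2P; exists (Wq v c h)|exact: A1_is_sven].
move=> q [/A2P[r ->] hr]; apply/funext => k; apply/funext => x.
exact: (is_sven_uniq (A1_is_sven a b om h) hr).
Qed.

Lemma sven_ker : [set u | A1 v c o u /\ is_sven v c u 0] = @def R @` A0 v c.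
Proof.
have z0 phi : pw_int v c (fun k x => (0 : 'I_3 -> plane -> R^o) k x * phi x) = 0.
  rewrite /pw_int big1// => k _; transitivity (plane_int (K k) (fun=> 0 * 0 : R)).
    by apply: eq_Rintegral => x _; rewrite -[LHS]/(0 * phi (pt x)) !mul0r.
  by rewrite (plane_intZ hv hc) ?mul0r//; exact: cst_continuous.
apply/seteqP; split => [u [/(A1P o hv hc)[a [b [om [h ->]]]] h0]|_ [a0 /(A0_struct hv hc)[a [b [om ->]]] <-]].
  exists (AF a b om); first exact: A0_AF.
  have hq : forall k, Wq v c h k = 0.
    by apply: (@is_sven_uniq _ _ (fun=> 0) (A1_is_sven a b om h)); exact: h0.
  rewrite (_ : h = fun=> 0); last by apply/funext; exact: Wq_inj.
  by rewrite Wf0 addr0.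
split.
  by apply/(A1P o hv hc); exists a, b, om, (fun=> 0); rewrite Wf0 addr0.
by move=> phi hphi; rewrite AF_sven0// z0.
Qed.

Lemma sven_surj q : A2 q -> exists2 u, A1 v c o u & is_sven v c u q.
Proof.
move=> /A2P[r ->]; have [h hr] := Wq_surj r.
exists (def (AF (fun=> 0) (fun=> 0) (fun=> 0)) + Wf h).
  by apply/(A1P o hv hc); do 4 eexists.
have := A1_is_sven (fun=> 0) (fun=> 0) (fun=> 0) h.
by congr is_sven; apply/funext => k; apply/funext => x; rewrite hr.
Qed.

Lemma def_A1 : @def R @` A0 v c `<=` A1 v c o.
Proof. by rewrite -sven_ker => u []. Qed.

End Exactness.

Unset Implicit Arguments.

Theorem theorem6p5 (R : realType) (v : 'I_3 -> plane R) (c : plane R)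
    (o : 'I_3 -> bool) (chi : 'I_3 -> R -> R)
    (m : 'I_3 -> 'I_3 -> (R -> R^o) * R^o) (p : 'I_3 -> plane R -> R^o)
    (hv : nondegenerate v)
    (hc : (T v)° c)
    (hchi : is_chi v o chi)
    (hm : forall e, is_basis (@M R) (m e))
    (hp : is_basis (@P1 R) p) :
  [/\ has_dim (A0 v c) 15 /\ unisolvent (A0 v c) (dof0 v o chi),
      (@def R @` A0 v c `&` W v c o = [set 0] /\ has_dim (A1 v c o) 15) /\
        unisolvent (A1 v c o) (dof1 v o m chi),
      has_dim (@A2 R) 3 /\ unisolvent (@A2 R) (dof2 v c p) &
      [/\ [set u | A0 v c u /\ def u = 0] = @RM R,
          @def R @` A0 v c `<=` A1 v c o,
          forall u, A1 v c o u -> exists! q, A2 q /\ is_sven v c u q,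
          [set u | A1 v c o u /\ is_sven v c u 0] = @def R @` A0 v c &
          forall q, A2 q -> exists2 u, A1 v c o u & is_sven v c u q]].
Proof.
have hv' : area v != 0 by rewrite -nondegenerateE.
have hc' l : 0 < lam v l c by move: l; exact/(hull_interior hv').
have hd := A1_direct o hv' hc'.
split.
- exact: A0_unisolvent.
- have [h1 h2] := A1_unisolvent hv' hc' hm hchi.
  by split; [split|].
- exact: A2_unisolvent.
split; [exact: def_ker|exact: def_A1|move=> u; exact: A1_sven|exact: sven_ker|move=> q; exact: sven_surj].
Qed.
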